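(* For every $\epsilon > 0$ there exists $\delta > 0$ such that the following holds. Suppose there is an approximator $\mathtt{approx}$ running in time polynomial in $n$ such that, for every $n$ and every $\bm J \in \mathbb{R}^{n \times n}_{\mathrm{sym}}$ with $\lambda_{\max}(\bm J) - \lambda_{\min}(\bm J) \leq 1 + \epsilon$, with probability $1 - o(1)$ (as $n \to \infty$), $F \sim \mathtt{approx}(\bm J)$ satisfies \[ \left| \log Z(\bm J) - F \right| < \delta n . \] Then the Wishart hardness conjecture is false; that is, there exist $\beta > -1$ and $\gamma > 0$ with $\beta^2 < \gamma$ and a randomized algorithm $f : (\mathbb{R}^n)^N \to \{\mathtt{p}, \mathtt{q}\}$ running in time polynomial in $n$ such that \[ \lim_{n\to\infty} \mathbb{P}[f(\bm y_1,\dots,\bm y_N) = \mathtt{p}] = \lim_{n\to\infty} \mathbb{Q}[f(\bm y_1,\dots,\bm y_N) = \mathtt{q}] = 1, \] where $(\mathbb{P}, \mathbb{Q}) = \mathsf{Wishart}(n, \beta, \gamma)$.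
   Context: For $\bm J \in \mathbb{R}^{n\times n}_{\mathrm{sym}}$, the partition function is $Z(\bm J) = \sum_{\bm x \in \{\pm 1\}^n} \exp\left(\tfrac12 \bm x^\top \bm J \bm x\right)$. An approximator is a randomized algorithm taking as input $\bm J \in \mathbb{R}^{n\times n}_{\mathrm{sym}}$ and outputting a random real number; $\mathtt{approx}(\bm J)$ denotes the law of its output. The notation $o(1)$ refers to the limit $n \to \infty$. Wishart spiked matrix model: for $\beta \in [-1,\infty)$, $\gamma > 0$ and $n \in \mathbb{N}$, let $N = \lceil n/\gamma \rceil$. Under $\mathbb{Q}$, $\bm y_1,\dots,\bm y_N \sim \mathcal{N}(\bm 0, \bm I_n)$ independently. Under $\mathbb{P}$, first draw $\bm x \sim \mathrm{Unif}(\{\pm1\}^n)$, then $\bm y_1, \dots, \bm y_N \sim \mathcal{N}(\bm 0, \bm I_n + \tfrac{\beta}{n}\bm x \bm x^\top)$ independently. The pair $(\mathbb{P},\mathbb{Q})$ is denoted $\mathsf{Wishart}(n,\beta,\gamma)$. *)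

(* Defs.v *)
From HB Require Import structures.
From mathcomp Require Import all_boot all_order all_algebra.
From mathcomp Require Import all_classical all_reals all_analysis.
From mathcomp Require Import measurable_realfun.
From mathcomp Require Import ring lra.

Set Implicit Arguments.
Unset Strict Implicit.
Unset Printing Implicit Defensive.

Import Order.TTheory GRing.Theory Num.Theory.
Import numFieldNormedType.Exports.

Local Open Scope classical_set_scope.
Local Open Scope ring_scope.

(* The model of computation is a unit-cost real RAM with a generator of
    independent uniform random numbers in [0, 1], presented as a WHILE language.
    A program is a finite object: its only real constants are rational.

    The memory has natural-number variables and real arrays; array [a] is indexed
    by two natural numbers.  Index arithmetic is limited to addition and truncated
    subtraction, and there is no rounding from reals to integers, so that unit
    cost cannot be abused through arithmetic on huge integers.  Real operations
    are exact.  Division by zero, logarithms and square roots of negative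
    numbers have the default values of the library. *)

Inductive nexp : Type :=
| NCst of nat
| NVar of nat
| NAdd of nexp & nexp
| NSub of nexp & nexp.

Inductive rexp : Type :=
| RCst of rat
| RNat of nexp
| RGet of nat & nexp & nexp
| RAdd of rexp & rexp
| RSub of rexp & rexp
| RMul of rexp & rexp
| RDiv of rexp & rexp
| RSqrt of rexp
| RExp of rexp
| RLn of rexp.

Inductive bexp : Type :=
| BNlt of nexp & nexp
| BRlt of rexp & rexp
| BNot of bexp
| BAnd of bexp & bexp.

Inductive cmd : Type :=
| Skip
| NSet of nat & nexp
| RSet of nat & nexp & nexp & rexp
| Draw of nat & nexp & nexp (* store a fresh uniform number of [0, 1] *)
| Seq of cmd & cmd
| If of bexp & cmd & cmd
| While of bexp & cmd.

Section Machine.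
Variable R : realType.

(* [drawn] counts the random numbers used so far. *)
Record state : Type := State {
  nvar : nat -> nat ;
  rarr : nat -> nat -> nat -> R ;
  drawn : nat }.

Fixpoint neval (s : state) (e : nexp) : nat :=
  match e with
  | NCst m => m
  | NVar i => nvar s i
  | NAdd e1 e2 => (neval s e1 + neval s e2)%N
  | NSub e1 e2 => (neval s e1 - neval s e2)%N
  end.

Fixpoint reval (s : state) (e : rexp) : R :=
  match e with
  | RCst q => ratr q
  | RNat m => (neval s m)%:R
  | RGet a i j => rarr s a (neval s i) (neval s j)
  | RAdd e1 e2 => reval s e1 + reval s e2
  | RSub e1 e2 => reval s e1 - reval s e2
  | RMul e1 e2 => reval s e1 * reval s e2
  | RDiv e1 e2 => reval s e1 / reval s e2
  | RSqrt e1 => Num.sqrt (reval s e1)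
  | RExp e1 => expR (reval s e1)
  | RLn e1 => ln (reval s e1)
  end.

Fixpoint beval (s : state) (e : bexp) : bool :=
  match e with
  | BNlt e1 e2 => (neval s e1 < neval s e2)%N
  | BRlt e1 e2 => reval s e1 < reval s e2
  | BNot e1 => ~~ beval s e1
  | BAnd e1 e2 => beval s e1 && beval s e2
  end.

Definition nset (s : state) (i v : nat) : state :=
  State (fun i' => if i' == i then v else nvar s i') (rarr s) (drawn s).

Definition rset (s : state) (a i j : nat) (v : R) : state :=
  State (nvar s)
    (fun a' i' j' => if [&& a' == a, i' == i & j' == j] then v
                     else rarr s a' i' j')
    (drawn s).

Definition tick_drawn (s : state) : state :=
  State (nvar s) (rarr s) (drawn s).+1.

(* One unit of time; the list is the stack of commands still to be executed, and
   [w] the stream of random numbers. *)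
Definition step (w : nat -> R) (cf : seq cmd * state) : seq cmd * state :=
  let: (K, s) := cf in
  match K with
  | [::] => cf
  | c :: K' =>
    match c with
    | Skip => (K', s)
    | NSet i e => (K', nset s i (neval s e))
    | RSet a i j e => (K', rset s a (neval s i) (neval s j) (reval s e))
    | Draw a i j =>
        (K', tick_drawn (rset s a (neval s i) (neval s j) (w (drawn s))))
    | Seq c1 c2 => (c1 :: c2 :: K', s)
    | If b c1 c2 => ((if beval s b then c1 else c2) :: K', s)
    | While b c1 => if beval s b then (c1 :: c :: K', s) else (K', s)
    end
  end.

Definition run (c : cmd) (w : nat -> R) (s : state) (t : nat) :
  seq cmd * state := iter t (step w) ([:: c], s).

Definition halts_within (c : cmd) (s : state) (t : nat) : Prop :=
  forall w : nat -> R, (forall i, 0 <= w i <= 1) -> (run c w s t).1 = [::].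

(* The initial memory holds the dimensions in variables 0 and 1, the entries in
   array 0, and zeros elsewhere. *)
Definition load (m n : nat) (A : 'M[R]_(m, n)) : state :=
  State (fun i => match i with 0 => m | 1 => n | _ => 0 end)%N
    (fun a i j =>
       if a is 0%N then
         match insub i, insub j with
         | Some i', Some j' => A i' j'
         | _, _ => 0
         end
       else 0)
    0.

Definition real_output (s : state) : R := rarr s 0 0 0.

(* Every polynomial in n is bounded by some [poly_bound k n]. *)
Definition poly_bound (k n : nat) : nat := (n ^ k + k)%N.

End Machine.

Inductive verdict : Type := verdict_p | verdict_q.

Definition verdict_output (R : realType) (s : state R) : verdict :=
  if nvar s 0 == 0%N then verdict_q else verdict_p.

Section IidLaw.
Context d (T : measurableType d) (R : realType).

Definition tuple_cons (n : nat) (p : T * n.-tuple T) : n.+1.-tuple T :=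
  [the n.+1.-tuple T of p.1 :: p.2].

Lemma measurable_tuple_cons n : measurable_fun setT (@tuple_cons n).
Proof. by apply: measurable_cons. Qed.

HB.instance Definition _ n :=
  isMeasurableFun.Build _ _ _ _ (@tuple_cons n) (@measurable_tuple_cons n).

(* The law of n independent variables with law P. *)
Fixpoint iid_law (P : probability T R) (n : nat) : probability (n.-tuple T) R :=
  match n with
  | 0 => \d_([tuple])
  | m.+1 => distribution (P \x iid_law P m)%E (@tuple_cons m)
  end.

End IidLaw.

Section Randomness.
Variable R : realType.

Definition uniform01 : probability (measurableTypeR R) R :=
  uniform_prob (@ltr01 R).

(* At most t random numbers are used in time t. *)
Definition tape_law (t : nat) : probability (t.-tuple (measurableTypeR R)) R :=
  iid_law uniform01 t.

Definition tape (t : nat) (w : t.-tuple (measurableTypeR R)) (i : nat) : R :=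
  nth 0 (w : seq R) i.

End Randomness.

Section Gaussian.
Variable R : realType.

Definition psd (n : nat) (A : 'M[R]_n) : Prop :=
  A^T = A /\ forall v : 'rV[R]_n, 0 <= (v *m A *m v^T) 0 0.

(* The positive semidefinite square root; see [psd_sqrt_unique]. *)
Definition psd_sqrt (n : nat) (S : 'M[R]_n) : 'M[R]_n :=
  xget 0 [set A : 'M[R]_n | psd A /\ A *m A = S].

Definition row_of (n : nat) (t : n.-tuple (measurableTypeR R)) : 'rV[R]_n :=
  \row_i tnth t i.

Definition lin_tuple (n : nat) (A : 'M[R]_n) (t : n.-tuple (measurableTypeR R)) :
  n.-tuple (measurableTypeR R) := [tuple (row_of t *m A) 0 j | j < n].

Lemma measurable_lin_tuple n (A : 'M[R]_n) : measurable_fun setT (lin_tuple A).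
Proof.
apply/measurable_fun_tnthP => j.
rewrite (_ : _ \o _ = fun t => \sum_(k < n) tnth t k * A k j); last first.
  apply/funext => t /=; rewrite tnth_map tnth_ord_tuple mxE.
  by apply: eq_bigr => k _; rewrite mxE.
apply: measurable_sum => k; apply: measurable_funM => //.
exact: measurable_tnth.
Qed.

HB.instance Definition _ n (A : 'M[R]_n) :=
  isMeasurableFun.Build _ _ _ _ (lin_tuple A) (@measurable_lin_tuple n A).

Definition std_gaussian (n : nat) :
  probability (n.-tuple (measurableTypeR R)) R := iid_law (normal_prob 0 1) n.

(* N(0, S) for a positive semidefinite S: the law of S^(1/2) g, g standard. *)
Definition gaussian (n : nat) (S : 'M[R]_n) :
  probability (n.-tuple (measurableTypeR R)) R :=
  distribution (std_gaussian n) (lin_tuple (psd_sqrt S)).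

Lemma rv_norm_ge0 n (v : 'rV[R]_n) : 0 <= (v *m v^T) 0 0.
Proof.
by rewrite mxE sumr_ge0 // => i _; rewrite mxE -expr2 sqr_ge0.
Qed.

Lemma rv_norm_eq0 n (v : 'rV[R]_n) : (v *m v^T) 0 0 = 0 -> v = 0.
Proof.
rewrite mxE => /psumr_eq0P v0; apply/rowP => i; rewrite mxE.
apply/eqP; rewrite -sqrf_eq0 expr2; apply/eqP.
have <- : v 0 i * v^T i 0 = v 0 i * v 0 i by rewrite [v^T _ _]mxE.
by apply: v0 => // j _; rewrite mxE -expr2 sqr_ge0.
Qed.

Lemma quad_ge0 (a c : R) : 0 <= a -> 0 <= c ->
  (forall t, 0 <= 2 * t * a + t ^+ 2 * c) -> a = 0.
Proof.
move=> a0 c0 /(_ (- a / (c + 1))).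
have c1 : c + 1 != 0 by apply: lt0r_neq0; lra.
have c2 : 0 < (c + 1) ^+ 2 by rewrite exprn_gt0 //; lra.
have -> : 2 * (- a / (c + 1)) * a + (- a / (c + 1)) ^+ 2 * c =
  - (a ^+ 2 * (c + 2)) / (c + 1) ^+ 2 by field.
rewrite pmulr_lge0 ?invr_gt0 // oppr_ge0 => h.
have : a ^+ 2 <= 0 by rewrite -(pmulr_lle0 _ (_ : 0 < c + 2)) //; lra.
by rewrite le_eqVlt ltNge sqr_ge0 orbF sqrf_eq0 => /eqP.
Qed.

Lemma psd_kernel n (A : 'M[R]_n) (v : 'rV[R]_n) :
  psd A -> (v *m A *m v^T) 0 0 = 0 -> v *m A = 0.
Proof.
move=> [symA posA] v0; apply: rv_norm_eq0.
set w := v *m A; set a := (w *m w^T) 0 0.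
have a0 : 0 <= a by exact: rv_norm_ge0.
set c := (w *m A *m w^T) 0 0.
have c0 : 0 <= c by exact: posA.
have wAv : w *m A *m v^T = w *m w^T.
  by rewrite -mulmxA /w trmx_mul symA.
have mxD (X Y : 'M[R]_1) : (X + Y) 0 0 = X 0 0 + Y 0 0 by rewrite mxE.
have mxZ t (X : 'M[R]_1) : (t *: X) 0 0 = t * X 0 0 by rewrite mxE.
have key t : 0 <= 2 * t * a + t ^+ 2 * c.
  have := posA (v + t *: w).
  rewrite [(_ + _)^T]raddfD /= [(_ *: _)^T]linearZ /= !mulmxDl !mulmxDr.
  rewrite -!scalemxAl -!scalemxAr wAv -/w !mxD !mxZ v0 -/a -/c; lra.
exact: (quad_ge0 a0 c0 key).
Qed.

Lemma sandwich_diag n (D C : 'M[R]_n) i : D^T = D ->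
  (D *m C *m D) i i = (row i D *m C *m (row i D)^T) 0 0.
Proof.
move=> symD; rewrite -row_mul [LHS]mxE [RHS]mxE; apply: eq_bigr => k _.
have -> : (row i D)^T k 0 = D i k by rewrite !mxE.
have -> : D k i = D i k by rewrite -[in LHS]symD mxE.
by congr (_ * _); rewrite [RHS]mxE.
Qed.

Lemma psd_sqrt_unique n (A B : 'M[R]_n) :
  psd A -> psd B -> A *m A = B *m B -> A = B.
Proof.
move=> pA pB AB; pose D := A - B.
have symD : D^T = D by rewrite /D raddfB /= pA.1 pB.1.
have rowq (C : 'M[R]_n) i := sandwich_diag C i symD.
have tr0 : \tr (D *m A *m D) + \tr (D *m B *m D) = 0.
  have -> : \tr (D *m A *m D) = \tr (A *m A *m A) - \tr (B *m A *m A) -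
      (\tr (A *m A *m B) - \tr (B *m A *m B)).
    by rewrite /D mulmxBr !mulmxBl !raddfB.
  have -> : \tr (D *m B *m D) = \tr (A *m B *m A) - \tr (B *m B *m A) -
      (\tr (A *m B *m B) - \tr (B *m B *m B)).
    by rewrite /D mulmxBr !mulmxBl !raddfB.
  have -> : \tr (B *m A *m A) = \tr (B *m B *m B) by rewrite -mulmxA AB mulmxA.
  have -> : \tr (A *m B *m B) = \tr (A *m A *m A) by rewrite -mulmxA -AB mulmxA.
  have -> : \tr (A *m B *m A) = \tr (A *m A *m B) by rewrite mxtrace_mulC mulmxA.
  have -> : \tr (B *m A *m B) = \tr (B *m B *m A) by rewrite mxtrace_mulC mulmxA.
  by rewrite AB; ring.
have trA : 0 <= \tr (D *m A *m D) by rewrite sumr_ge0 // => i _; rewrite rowq pA.2.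
have trB : 0 <= \tr (D *m B *m D) by rewrite sumr_ge0 // => i _; rewrite rowq pB.2.
have DC (C : 'M[R]_n) : psd C -> \tr (D *m C *m D) = 0 -> D *m C = 0.
  move=> pC /psumr_eq0P tC; apply/row_matrixP => i; rewrite row_mul row0.
  apply: psd_kernel => //; rewrite -rowq; apply: tC => // j _.
  by rewrite rowq pC.2.
have DA : D *m A = 0 by apply: DC => //; lra.
have DB : D *m B = 0 by apply: DC => //; lra.
have DD : D *m D = 0 by rewrite {2}/D mulmxBr DA DB subrr.
apply/eqP; rewrite -subr_eq0 -/D; apply/eqP/row_matrixP => i; rewrite row0.
apply: rv_norm_eq0; have := sandwich_diag 1%:M i symD.
by rewrite !mulmx1 DD mxE => <-.
Qed.

Lemma psd_sqrtE n (A S : 'M[R]_n) : psd A -> A *m A = S -> psd_sqrt S = A.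
Proof.
move=> pA AS; apply: xget_unique; first by split.
by move=> B [pB BS]; apply: psd_sqrt_unique => //; rewrite BS AS.
Qed.

End Gaussian.

Section Models.
Variable R : realType.

(* {-1, 1}^n is indexed by boolean functions. *)
Definition spin (n : nat) (s : {ffun 'I_n -> bool}) : 'rV[R]_n :=
  \row_i (-1) ^+ s i.

Definition partition_function (n : nat) (J : 'M[R]_n) : R :=
  \sum_(s : {ffun 'I_n -> bool}) expR (2^-1 * (spin s *m J *m (spin s)^T) 0 0).

Definition lambda_max (n : nat) (J : 'M[R]_n) : R := sup [set a | eigenvalue J a].
Definition lambda_min (n : nat) (J : 'M[R]_n) : R := inf [set a | eigenvalue J a].

Definition num_samples (gamma : R) (n : nat) : nat :=
  `|Num.ceil (n%:R / gamma)|%N.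

Definition sample (n N : nat) := N.-tuple (n.-tuple (measurableTypeR R)).

Definition spiked_cov (n : nat) (beta : R) (x : 'rV[R]_n) : 'M[R]_n :=
  1%:M + (beta / n%:R) *: (x^T *m x).

Lemma spin_norm n (s : {ffun 'I_n -> bool}) : spin s *m (spin s)^T = (n%:R)%:M.
Proof.
apply/matrixP => i j; rewrite !ord1 !mxE eqxx mulr1n.
under eq_bigr do rewrite !mxE -expr2 sqrr_sign.
by rewrite sumr_const card_ord.
Qed.

(* [gaussian] is thus N(0, S) at every covariance matrix used below. *)
Lemma psd_sqrt_spiked_cov n (beta : R) (s : {ffun 'I_n -> bool}) : -1 <= beta ->
  psd_sqrt (spiked_cov beta (spin s)) =
    1%:M + ((Num.sqrt (1 + beta) - 1) / n%:R) *: ((spin s)^T *m spin s) /\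
  psd_sqrt (spiked_cov beta (spin s)) *m psd_sqrt (spiked_cov beta (spin s)) =
    spiked_cov beta (spin s).
Proof.
move=> beta1; set r := Num.sqrt (1 + beta).
have r0 : 0 <= r by exact: sqrtr_ge0.
have r2 : r * r = 1 + beta by rewrite -expr2 sqr_sqrtr //; lra.
pose P : 'M[R]_n := n%:R^-1 *: ((spin s)^T *m spin s).
have PP : P *m P = P.
  rewrite /P -scalemxAl -scalemxAr scalerA mulmxA -(mulmxA _ _ _^T) spin_norm.
  rewrite mul_mx_scalar -scalemxAl scalerA.
  have [n0|n0] := eqVneq (n%:R : R) 0; first by rewrite n0 invr0 !mul0r.
  by congr (_ *: _); field.
have symP : P^T = P by rewrite /P linearZ /= trmx_mul trmxK.
pose A : 'M[R]_n := 1%:M + (r - 1) *: P.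
have AE : 1%:M + ((r - 1) / n%:R) *: ((spin s)^T *m spin s) = A.
  by rewrite /A /P scalerA.
have SE : spiked_cov beta (spin s) = 1%:M + beta *: P.
  by rewrite /spiked_cov /P scalerA.
move: P PP symP @A AE SE => P PP symP A AE SE.
have AA : A *m A = spiked_cov beta (spin s).
  rewrite SE (_ : beta = (r - 1) + ((r - 1) + (r - 1) * (r - 1))); last first.
    by rewrite (_ : beta = r * r - 1); [ring | rewrite r2; ring].
  rewrite /A; move: (r - 1) => c.
  rewrite mulmxDl mul1mx -scalemxAl mulmxDr mulmx1 -scalemxAr PP.
  by rewrite scalerDl scalerDl scalerDr scalerA -addrA.
have pA : psd A.
  split; first by rewrite /A raddfD /= trmx1 linearZ /= symP.
  move=> v.
  have -> : A = (1%:M - P) *m (1%:M - P)^T + r *: (P *m P^T).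
    rewrite raddfB /= trmx1 symP mulmxBl !mulmxBr !mul1mx !mulmx1 PP subrr subr0.
    by rewrite /A scalerBl scale1r addrC -addrA (addrC (- _)) addrC.
  have vCv (C : 'M[R]_n) : 0 <= (v *m (C *m C^T) *m v^T) 0 0.
    by have := rv_norm_ge0 (v *m C); rewrite trmx_mul !mulmxA.
  rewrite mulmxDr mulmxDl mxE addr_ge0 // -scalemxAr -scalemxAl mxE.
  by rewrite mulr_ge0.
by rewrite AE (psd_sqrtE pA AA).
Qed.

Definition wishart_null (n N : nat) : probability (sample n N) R :=
  iid_law (gaussian (1%:M : 'M[R]_n)) N.

(* The law of the sample given x = [spin s]. *)
Definition wishart_given (n N : nat) (beta : R) (s : {ffun 'I_n -> bool}) :
  probability (sample n N) R := iid_law (gaussian (spiked_cov beta (spin s))) N.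

Definition wishart_planted (n N : nat) (beta : R) : set (sample n N) -> \bar R :=
  fun A => (((2 ^+ n)^-1)%:E *
    \sum_(s : {ffun 'I_n -> bool}) wishart_given N beta s A)%E.

Section PlantedProbability.
Variables (n N : nat) (beta : R).

Let w_ge0 : 0 <= (2 ^+ n)^-1 :> R.
Proof. by rewrite invr_ge0 exprn_ge0. Qed.

Let w : {nonneg R} := NngNum w_ge0.

Let laws (k : nat) : probability (sample n N) R :=
  wishart_given N beta (nth [ffun=> false] (enum {ffun 'I_n -> bool}) k).

Let plantedE : @wishart_planted n N beta =
  mscale w (msum laws #|{ffun 'I_n -> bool}|).
Proof.
apply/funext => A; rewrite /wishart_planted /mscale /msum /=; congr (_ * _)%E.
rewrite big_enum_val /=; apply: eq_bigr => k _.
by rewrite (enum_val_nth [ffun=> false]).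
Qed.

Let planted0 : wishart_planted beta (set0 : set (sample n N)) = 0%E.
Proof. by rewrite plantedE measure0. Qed.

Let planted_ge0 A : (0 <= @wishart_planted n N beta A)%E.
Proof. by rewrite plantedE measure_ge0. Qed.

Let planted_sigma_additive : semi_sigma_additive (@wishart_planted n N beta).
Proof. by rewrite plantedE; exact: measure_semi_sigma_additive. Qed.

HB.instance Definition _ := isMeasure.Build _ _ _ (@wishart_planted n N beta)
  planted0 planted_ge0 planted_sigma_additive.

Let planted_setT : @wishart_planted n N beta setT = 1%E.
Proof.
rewrite /wishart_planted.
under eq_bigr do rewrite probability_setT.
rewrite sumEFin sumr_const card_ffun card_bool card_ord natrX -EFinM mulVf //.
Qed.

HB.instance Definition _ := Measure_isProbability.Build _ _ _
  (@wishart_planted n N beta) planted_setT.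

End PlantedProbability.

Definition sample_mx (n N : nat) (y : sample n N) : 'M[R]_(N, n) :=
  \matrix_(i, j) tnth (tnth y i) j.

Definition polytime_approximator (c : cmd) (k : nat) : Prop :=
  forall (n : nat) (J : 'M[R]_n), J^T = J -> halts_within c (load J) (poly_bound k n).

Definition approx_output (c : cmd) (k n : nat) (J : 'M[R]_n)
    (w : (poly_bound k n).-tuple (measurableTypeR R)) : R :=
  real_output (run c (tape w) (load J) (poly_bound k n)).2.

Definition approx_law (c : cmd) (k n : nat) (J : 'M[R]_n) : set R -> \bar R :=
  pushforward (tape_law R (poly_bound k n)) (@approx_output c k n J).

Definition polytime_test (gamma : R) (c : cmd) (k : nat) : Prop :=
  forall (n : nat) (y : sample n (num_samples gamma n)),
    halts_within c (load (sample_mx y)) (poly_bound k n).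

Definition test_verdict (c : cmd) (k n N : nat) (y : sample n N)
    (w : (poly_bound k n).-tuple (measurableTypeR R)) : verdict :=
  verdict_output (run c (tape w) (load (sample_mx y)) (poly_bound k n)).2.

(* The internal randomness of the test is independent of the sample. *)
Definition test_prob (c : cmd) (k n N : nat) (P : probability (sample n N) R)
    (v : verdict) : \bar R :=
  (P \x tape_law R (poly_bound k n))%E [set yw | test_verdict c yw.1 yw.2 = v].

End Models.

(* Main.v *)
(* The test runs the approximator on J = (1 + e) K, where K is the projection onto
   the orthogonal complement of y_1, ..., y_N, computed by Gram-Schmidt, and
   N is about (1 - a) n. The spectral width of J is at most 1 + e.
   Under Q, each Gram-Schmidt step multiplies the moments of x K x^T, for fixed x
   in {-1, 1}^n, by at most an explicit factor; summing the exponential series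
   bounds E exp ((1 + e)/2 x K x^T) on a likely event, and Markov's inequality
   gives ln Z(J) <= (ln 2 + 0.3 e^2) n with high probability.
   Under P with beta close to -1, the hidden x is almost orthogonal to the samples,
   so x K x^T >= (1 - e/100) n. The Gibbs variational principle, applied to the
   product measure on {-1, 1}^n of mean rho x with rho^2 = 3e/2, then gives
   ln Z(J) >= (ln 2 + 0.34 e^2) n. Hence an error below e^2 n / 100 separates P
   from Q, whereas beta^2 < 1 < gamma = 1 / (1 - a). *)

Require Import Defs.
From HB Require Import structures.
From mathcomp Require Import all_boot all_order all_algebra.
From mathcomp Require Import all_classical all_reals all_analysis.
From mathcomp Require Import measurable_realfun.
From mathcomp Require Import ring lra zify.

Set Implicit Arguments.
Unset Strict Implicit.
Unset Printing Implicit Defensive.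

Import Order.TTheory GRing.Theory Num.Theory.
Import numFieldNormedType.Exports.

Local Open Scope classical_set_scope.
Local Open Scope ring_scope.

(** Width 1 is critical. For lam = 1 + e the annealed exponent in excess of ln 2 is about (lam - 1 -
    ln lam) / 2, close to e^2 / 4, whereas the mean-field gain e rho^2 / 2 - rho^4 / 12 can reach 3
    e^2 / 4. Both are quadratic in e, so explicit constants must keep them apart; the cruder quartic
    coefficient 0.175 proved for the entropy still leaves 0.34 against 0.3. Gram-Schmidt takes the
    place of the rotational invariance of a random subspace: given the past, a fresh sample enters
    only through one-dimensional Gaussian integrals. Restricting to samples of typical norm also
    makes the rank at each step deterministic. The planted samples are a linear image of null
    samples, so the planted kernel is controlled by a null estimate: negative moments show that a
    fixed x keeps a constant fraction of its squared length in the null kernel. Success events of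
    programs are never shown measurable, so the inequalities applied to them are proved for
    arbitrary sets. *)

(** * Monotonicity of integrals without measurability *)

Section LowerIntegral.
Context d (T : measurableType d) (R : realType).
Variable mu : {measure set T -> \bar R}.
Local Open Scope ereal_scope.
Import HBNNSimple.

(* The library integral of a nonnegative function is a supremum over simple
   functions, so it is monotone even on nonmeasurable functions. *)
Lemma ge0_le_lower_integral (f g : T -> \bar R) :
  (forall x, 0 <= f x) -> (forall x, f x <= g x) ->
  \int[mu]_x f x <= \int[mu]_x g x.
Proof.
move=> f0 fg; have g0 x : 0 <= g x by exact: le_trans (fg x).
rewrite !ge0_integralTE// ge_ereal_sup// => _ [h/= hf <-].
by apply: ereal_sup_ubound; exists h => //= x; exact: le_trans (fg x).
Qed.

(** A simple function below f can be set to zero off E without changing its integral, and then lies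
    below g everywhere. This lets random tapes be assumed to stay in [0, 1]. *)
Lemma ge0_le_lower_integral_conull (E : set T) (f g : T -> \bar R) :
  measurable E -> mu (~` E) = 0 -> (forall x, 0 <= f x) ->
  (forall x, 0 <= g x) -> (forall x, E x -> f x <= g x) ->
  \int[mu]_x f x <= \int[mu]_x g x.
Proof.
move=> mE E0 f0 g0 fg.
rewrite [leLHS]ge0_integralTE// ge_ereal_sup// => _ [h/= hf <-].
have h0 x : 0 <= (h x)%:E by rewrite lee_fin.
rewrite -integralT_nnsfun.
rewrite (@ge0_negligible_integral _ _ _ mu setT (~` E))//; last 2 first.
- exact: measurableC.
- exact/measurable_EFinP.
rewrite setTD setCK integral_mkcond; apply: ge0_le_lower_integral => x.
  by apply: erestrict_ge0.
rewrite patchE; case: ifPn => //; rewrite inE => Ex.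
exact: le_trans (hf x) (fg _ Ex).
Qed.

End LowerIntegral.

(** * Laws of independent samples *)

Section Iid.
Context d (T : measurableType d) (R : realType).
Variable P : probability T R.
Local Open Scope ereal_scope.

(** The product measure is by definition the integral of the measures of sections, so A is arbitrary
    here, and hence in the comparisons below. *)
Lemma iid_lawS n (A : set (n.+1.-tuple T)) :
  iid_law P n.+1 A = \int[P]_x iid_law P n [set t | A (tuple_cons (x, t))].
Proof.
apply: eq_integral => x _ /=; congr (iid_law P n _).
by apply/seteqP; split => t; rewrite /xsection /= inE.
Qed.

Lemma iid_law0 (A : set (0.-tuple T)) : iid_law P 0 A = (\1_A [tuple])%:E.
Proof. by []. Qed.

Lemma le_iid_law n (A B : set (n.-tuple T)) : A `<=` B ->
  iid_law P n A <= iid_law P n B.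
Proof.
elim: n A B => [|n IH] A B AB.
  rewrite !iid_law0 lee_fin !indicE ler_nat.
  by case: (boolP (_ \in A)) => //; rewrite inE => /AB; rewrite -in_setE => ->.
rewrite !iid_lawS; apply: ge0_le_lower_integral => // x.
by apply: IH => t; exact: AB.
Qed.

Lemma iid_law_le1 n (A : set (n.-tuple T)) : iid_law P n A <= 1.
Proof. by rewrite -(probability_setT (iid_law P n)); exact: le_iid_law. Qed.

(** Compares a tape with a longer one that extends it: coordinates are integrated one at a time, and
    the surplus ones carry total mass 1. Only coordinates in the conull set E have to be
    considered. *)
Lemma iid_law_prefix (E : set T) n m (A : set (n.-tuple T))
    (B : set (m.-tuple T)) : (n <= m)%N ->
  measurable E -> P (~` E) = 0 ->
  (forall (u : n.-tuple T) (v : m.-tuple T), A u ->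
     take n v = u -> (forall i, E (tnth v i)) -> B v) ->
  iid_law P n A <= iid_law P m B.
Proof.
move=> nm mE E0; elim: m n nm A B => [|m IH] [|n] nm A B AB.
- rewrite !iid_law0 lee_fin !indicE ler_nat.
  case: (boolP (_ \in A)) => //; rewrite inE => A0.
  by rewrite mem_set //; apply: AB A0 _ _ => // -[].
- by [].
- have [A0|A0] := pselect (A [tuple]); last first.
    by rewrite iid_law0 indicE memNset // measure_ge0.
  rewrite iid_law0 indicE mem_set // iid_lawS.
  rewrite -[leLHS](@probability_setT _ _ _ P) -[leLHS]mul1e -integral_cst //=.
  apply: (ge0_le_lower_integral_conull mE E0) => // x Ex.
  rewrite (_ : 1 = iid_law P 0 [set [tuple]]); last first.
    by rewrite iid_law0 indicE mem_set.
  apply: IH => // u v _ _ Ev; apply: AB A0 _ _ => [|i]; first by rewrite take0.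
  have [j ->|->] := unliftP ord0 i; last by rewrite /= tnth0.
  by rewrite tnthS.
- rewrite !iid_lawS; apply: (ge0_le_lower_integral_conull mE E0) => // x Ex.
  apply: IH => // u v Au uv Ev; apply: AB Au _ _ => [|i]; first by rewrite /= uv.
  have [j ->|->] := unliftP ord0 i; last by rewrite /= tnth0.
  by rewrite tnthS.
Qed.

Lemma integral_iid_lawS n (f : n.+1.-tuple T -> \bar R) :
  measurable_fun setT f -> (forall x, 0 <= f x) ->
  \int[iid_law P n.+1]_t f t =
  \int[P]_x \int[iid_law P n]_t f (tuple_cons (x, t)).
Proof.
move=> mf f0; rewrite /= ge0_integral_distribution //=.
rewrite fubini_tonelli1 //; apply: measurableT_comp => //.
Qed.

End Iid.

Lemma iid_law_distribution d1 d2 (T1 : measurableType d1)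
    (T2 : measurableType d2) (R : realType) (P : probability T1 R)
    (X : {mfun T1 >-> T2}) n (A : set (n.-tuple T2)) : measurable A ->
  iid_law (distribution P X) n A =
  iid_law P n [set t : n.-tuple T1 | A [the n.-tuple T2 of map X t]].
Proof.
elim: n A => [|n IH] A mA.
  rewrite !iid_law0 !indicE; congr (nat_of_bool _)%:R%:E.
  apply: asbool_equiv_eq => /=.
  rewrite (_ : [tuple] = [the 0.-tuple T2 of map X [tuple]]) //; exact/val_inj.
pose cons2 x := [set t | A (tuple_cons (x, t))] : set (n.-tuple T2).
have mA2 x : measurable (cons2 x).
  have m2 : measurable_fun setT (fun t : n.-tuple T2 => tuple_cons (x, t)).
    apply: (@measurableT_comp _ _ _ _ _ _ (@tuple_cons _ T2 n)).
      exact: measurable_tuple_cons.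
    exact: pair1_measurable.
  by rewrite -[cons2 x]setTI; exact: m2.
rewrite !iid_lawS ge0_integral_distribution //=; last first.
  rewrite (_ : (fun x => _) = iid_law (distribution P X) n \o
    xsection [set p | A (tuple_cons p)]).
    apply: measurable_fun_xsection; rewrite -[X in measurable X]setTI.
    exact: (@measurable_tuple_cons _ T2 n measurableT _ mA).
  apply/funext => x /=; congr (iid_law _ n _).
  by apply/seteqP; split => t; rewrite /xsection /= inE.
apply: eq_integral => x _; rewrite [LHS](IH (cons2 (X x))) //.
by congr (iid_law P n _); apply/funext => t; rewrite /cons2 /=;
   congr (A _); exact/val_inj.
Qed.

(** * Densities and one-dimensional Gaussian integrals *)

Section Density.
Context d (T : measurableType d) (R : realType).
Variables (mu nu : {measure set T -> \bar R}) (g : T -> R).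
Hypotheses (mg : measurable_fun setT g) (g0 : forall x, 0 <= g x).
Hypothesis nuE :
  forall A, measurable A -> nu A = (\int[mu]_(x in A) (g x)%:E)%E.
Local Open Scope ereal_scope.
Import HBNNSimple.

Let nu_indic E : measurable E ->
  \int[nu]_x (\1_E x)%:E = \int[mu]_x ((\1_E x)%:E * (g x)%:E).
Proof.
move=> mE; rewrite integral_indic // setIT nuE // integral_mkcond.
apply: eq_integral => x _; rewrite patchE indicE.
by case: ifPn => _; rewrite ?mul1e ?mul0e.
Qed.

Let nu_nnsfun (f : {nnsfun T >-> R}) :
  \int[nu]_x (f x)%:E = \int[mu]_x ((f x)%:E * (g x)%:E).
Proof.
under [LHS]eq_integral do rewrite fimfunE -fsumEFin//.
rewrite [LHS]ge0_integral_fsum//; last 2 first.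
  by move=> r; exact/measurable_EFinP/measurableT_comp.
  by move=> n x _; rewrite EFinM nnfun_muleindic_ge0.
under [RHS]eq_integral.
  move=> x xD; rewrite fimfunE -fsumEFin// ge0_mule_fsuml; last first.
    by move=> r; rewrite EFinM nnfun_muleindic_ge0.
  over.
rewrite [RHS]ge0_integral_fsum//; last 2 first.
  move=> r; apply: emeasurable_funM; apply/measurable_EFinP => //.
  exact: measurableT_comp.
  move=> n x _; apply: mule_ge0; last by rewrite lee_fin.
  by rewrite EFinM nnfun_muleindic_ge0.
apply: eq_fsbigr => r _.
have m1 : measurable_fun setT (fun x => (\1_(f @^-1` [set r]) x)%:E : \bar R).
  exact/measurable_EFinP/measurable_indic.
have [r0|r0] := leP 0%R r; last first.
  rewrite preimage_nnfun0 //.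
  by rewrite !integral0_eq // => x _; rewrite indic0 mulr0 ?mul0e.
under eq_integral do rewrite EFinM.
under [RHS]eq_integral do rewrite EFinM -muleA.
rewrite !ge0_integralZl//; first by rewrite nu_indic.
  by apply: emeasurable_funM => //; exact/measurable_EFinP.
by move=> x _; rewrite mule_ge0 // lee_fin.
Qed.

Lemma ge0_integral_density (f : T -> \bar R) :
  measurable_fun setT f -> (forall x, 0 <= f x) ->
  \int[nu]_x f x = \int[mu]_x (f x * (g x)%:E).
Proof.
move=> mf f0; pose f_ := nnsfun_approx measurableT mf.
transitivity (lim (\int[nu]_x (f_ n x)%:E @[n --> \oo])).
  rewrite -monotone_convergence//=.
  - apply: eq_integral => x _; apply/esym/cvg_lim => //=.
    exact: cvg_nnsfun_approx.
  - by move=> n; exact/measurable_EFinP/measurable_funTS.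
  - by move=> n ? _; rewrite lee_fin.
  - by move=> ? _ ? ? mn; rewrite lee_fin; exact/lefP/nd_nnsfun_approx.
transitivity (lim (\int[mu]_x ((f_ n x)%:E * (g x)%:E) @[n --> \oo])).
  congr (lim _); congr (_ @ \oo); apply/funext => n; exact: nu_nnsfun.
rewrite -monotone_convergence//=.
- apply: eq_integral => x _; apply/cvg_lim => //=.
  by apply: cvgeZr => //; exact: cvg_nnsfun_approx.
- move=> n; apply: emeasurable_funM; apply/measurable_EFinP => //.
- by move=> n ? _; rewrite mule_ge0 ?lee_fin.
- move=> x _ ? ? mn; apply: lee_wpmul2r; first by rewrite lee_fin.
  by rewrite lee_fin; exact/lefP/nd_nnsfun_approx.
Qed.

End Density.

Section Gauss1.
Variable R : realType.
Local Open Scope ereal_scope.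

Lemma integral_normal_prob (m s : R) (f : R -> \bar R) :
  measurable_fun setT f -> (forall x, 0 <= f x) ->
  \int[normal_prob m s]_x f x =
  \int[lebesgue_measure]_x (f x * (normal_pdf m s x)%:E).
Proof.
move=> mf f0; apply: ge0_integral_density => //.
  exact: measurable_normal_pdf.
exact: normal_pdf_ge0.
Qed.

(** The term x^2 / 2 cancels the standard density, leaving exp(- b x^2 / 2 + c x), a multiple of the
    normal density of mean c / b and variance 1 / b. *)
Lemma gauss_integral_affine (b c : R) : (0 < b)%R ->
  \int[normal_prob 0 1]_x (expR (2^-1 * (x ^+ 2 - b * x ^+ 2) + c * x))%:E =
  ((Num.sqrt b)^-1 * expR (c ^+ 2 / (2 * b)))%:E.
Proof.
move=> b0.
have sb0 : (0 < (Num.sqrt b)^-1)%R by rewrite invr_gt0 sqrtr_gt0.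
have mf : measurable_fun setT
    (fun x : R => expR (2^-1 * (x ^+ 2 - b * x ^+ 2) + c * x)).
  apply: measurableT_comp => //; apply: measurable_funD => //.
  apply: measurable_funM => //; apply: measurable_funB => //.
  by apply: measurable_funM.
rewrite integral_normal_prob; first last.
- by move=> x; rewrite lee_fin expR_ge0.
- exact/measurable_EFinP.
transitivity (\int[lebesgue_measure]_x
  (((Num.sqrt b)^-1 * expR (c ^+ 2 / (2 * b)))%:E *
   (normal_pdf (c / b) (Num.sqrt b)^-1 x)%:E)).
  apply: eq_integral => x _; rewrite -!EFinM; congr EFin.
  rewrite !normal_pdfE ?oner_eq0 ?gt_eqF // /normal_peak /normal_fun.
  have -> : ((Num.sqrt b)^-1 ^+ 2 = b^-1)%R.
    by rewrite exprVn sqr_sqrtr // ltW.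
  rewrite expr1n mul1r -mulrnAr sqrtrM ?invr_ge0 ?(ltW b0) // sqrtrV ?(ltW b0) //.
  set p := Num.sqrt (pi *+ 2).
  have -> : (((Num.sqrt b)^-1 * p)^-1 = Num.sqrt b * p^-1)%R.
    by rewrite invfM invrK.
  have sb : (Num.sqrt b != 0)%R by rewrite gt_eqF // sqrtr_gt0.
  rewrite [LHS]mulrCA -expRD.
  transitivity (p^-1 * (expR (c ^+ 2 / (2 * b)) *
     expR (- (x - c / b) ^+ 2 / (b^-1 *+ 2))))%R; last first.
    move: (expR _) (expR _) => E1 E2; field; apply/andP; split => //.
    by rewrite gt_eqF // sqrtr_gt0 pmulrn_lgt0 // pi_gt0.
  rewrite -expRD; congr (_ * expR _)%R.
  by field; rewrite gt_eqF.
rewrite ge0_integralZl_EFin //.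
- by rewrite integral_normal_pdf mule1.
- by move=> x _; rewrite lee_fin normal_pdf_ge0.
- by apply/measurable_EFinP; exact: measurable_normal_pdf.
Qed.
End Gauss1.

(** * Gaussian integrals of quadratic forms and projections *)

Section Quad.
Variable R : realType.
Implicit Types n : nat.

Definition qform n (B : 'M[R]_n) (v : 'rV[R]_n) : R := (v *m B *m v^T) 0 0.

Definition posdef n (B : 'M[R]_n) :=
  B^T = B /\ forall v : 'rV[R]_n, v != 0 -> 0 < qform B v.

Lemma row_of_cons n (x : R) (t : n.-tuple (measurableTypeR R)) :
  row_of (tuple_cons (x, t) : n.+1.-tuple (measurableTypeR R)) =
  row_mx (x%:M : 'rV_1) (row_of t) :> 'rV[R]_(1 + n).
Proof.
apply/rowP => i; rewrite !mxE; case: splitP => j ij.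
  rewrite [i](_ : _ = ord0); last by apply/val_inj => /=; rewrite ij ord1.
  by rewrite tnth0 ord1 mxE eqxx mulr1n.
rewrite mxE [i](_ : _ = lift ord0 j); first by rewrite tnthS.
by apply/val_inj => /=; rewrite ij.
Qed.

Lemma mx11E (A : 'M[R]_1) : A = (A 0 0)%:M.
Proof. by apply/matrixP => i j; rewrite !ord1 mxE eqxx mulr1n. Qed.

Lemma qform_block n (b x : R) (r : 'rV[R]_n) (C : 'M[R]_n) (v : 'rV[R]_n) :
  qform (block_mx b%:M r r^T C : 'M[R]_(1 + n)) (row_mx x%:M v) =
  b * x ^+ 2 + 2 * x * (r *m v^T) 0 0 + qform C v.
Proof.
rewrite /qform mul_row_block tr_row_mx mul_row_col tr_scalar_mx.
have mxD (X Y : 'M[R]_1) : (X + Y) 0 0 = X 0 0 + Y 0 0 by rewrite mxE.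
rewrite !mulmxDl !mxD -!scalar_mxM !mul_mx_scalar mul_scalar_mx -scalemxAl.
have mxZ (t : R) (X : 'M[R]_1) : (t *: X) 0 0 = t * X 0 0 by rewrite mxE.
rewrite !mxZ.
have -> : (v *m r^T) 0 0 = (r *m v^T) 0 0.
  by rewrite -[r in RHS]trmxK -trmx_mul [RHS]mxE.
rewrite !mxE eqxx mulr1n; ring.
Qed.

Lemma det_block_schur n (b : R) (r : 'rV[R]_n) (C : 'M[R]_n) : b != 0 ->
  \det (block_mx b%:M r r^T C : 'M[R]_(1 + n)) =
  b * \det (C - b^-1 *: (r^T *m r)).
Proof.
move=> b0.
have -> : block_mx b%:M r r^T C =
    block_mx (1%:M : 'M[R]_1) 0 (b^-1 *: r^T) 1%:M *m
    block_mx b%:M r 0 (C - b^-1 *: (r^T *m r)).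
  rewrite mulmx_block !mul1mx !mul0mx !addr0 -scalemxAl mul_mx_scalar.
  by rewrite scalerA mulVf // scale1r -scalemxAl addrC subrK.
by rewrite det_mulmx det_lblock det_ublock !det1 !mul1r det_scalar1.
Qed.

Lemma qform_schur n (b : R) (r : 'rV[R]_n) (C : 'M[R]_n) v :
  qform (C - b^-1 *: (r^T *m r)) v = qform C v - b^-1 * (r *m v^T) 0 0 ^+ 2.
Proof.
rewrite /qform mulmxBr mulmxBl mxE [in X in _ + X]mxE; congr (_ - _).
rewrite -scalemxAr -scalemxAl mxE; congr (_ * _).
have -> : v *m (r^T *m r) *m v^T = (v *m r^T) *m (r *m v^T).
  by rewrite !mulmxA.
rewrite [v *m r^T]mx11E mul_scalar_mx mxE expr2; congr (_ * _).
by rewrite -[r in RHS]trmxK -trmx_mul [RHS]mxE.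
Qed.

Lemma posdef_schur n (b : R) (r : 'rV[R]_n) (C : 'M[R]_n) :
  posdef (block_mx b%:M r r^T C : 'M[R]_(1 + n)) ->
  0 < b /\ posdef (C - b^-1 *: (r^T *m r)).
Proof.
move=> [symB posB]; have b0 : 0 < b.
  have := posB (row_mx 1%:M 0); rewrite qform_block /qform.
  rewrite !mul0mx trmx0 mulmx0 !mxE expr1n mulr1 mulr0 !addr0; apply.
  apply/eqP => /(congr1 lsubmx); rewrite row_mxKl linear0 => /matrixP /(_ 0 0).
  by rewrite !mxE eqxx => /eqP; rewrite oner_eq0.
split=> //; split.
  rewrite raddfB /= linearZ /= trmx_mul trmxK; congr (_ - _).
  move: symB; rewrite tr_block_mx => /(congr1 drsubmx).
  by rewrite !block_mxKdr.
(* This first coordinate minimizes the form over all vectors ending in v, and the minimum is the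
   Schur complement at v. *)
move=> v v0; have := posB (row_mx (- (r *m v^T) 0 0 / b)%:M v).
rewrite qform_block.
rewrite qform_schur.
set a := (r *m v^T) 0 0.
have -> : b * (- a / b) ^+ 2 + 2 * (- a / b) * a + qform C v =
  qform C v - b^-1 * a ^+ 2 by field; rewrite gt_eqF.
apply; apply: contra v0 => /eqP /(congr1 rsubmx).
by rewrite row_mxKr linear0 => ->.
Qed.

Lemma posdef_submx n (B : 'M[R]_(1 + n)) : posdef B ->
  B = block_mx (B 0 0)%:M (ursubmx B) (ursubmx B)^T (drsubmx B).
Proof.
move=> [symB _]; rewrite -[LHS]submxK [ulsubmx _]mx11E; congr block_mx.
  by congr (_%:M); rewrite !mxE; congr (B _ _); exact/val_inj.
by rewrite -[in LHS]symB trmx_ursub.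
Qed.

Lemma measurable_row_of n (i : 'I_n) :
  measurable_fun setT (fun t : n.-tuple (measurableTypeR R) => row_of t 0 i).
Proof.
rewrite (_ : (fun t => _) = (@tnth n _)^~ i); first exact: measurable_tnth.
by apply/funext => t; rewrite mxE.
Qed.

Lemma measurable_qform d (T : measurableType d) n (B : T -> 'M[R]_n)
    (v : T -> 'rV[R]_n) :
  (forall i j, measurable_fun setT (fun t => B t i j)) ->
  (forall i, measurable_fun setT (fun t => v t 0 i)) ->
  measurable_fun setT (fun t => qform (B t) (v t)).
Proof.
move=> mB mv; rewrite (_ : (fun t => _) =
  fun t => \sum_j (\sum_i v t 0 i * B t i j) * v t 0 j); last first.
  apply/funext => t; rewrite /qform mxE; apply: eq_bigr => j _.
  by rewrite !mxE.
apply: measurable_sum => j; apply: measurable_funM => //.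
by apply: measurable_sum => i; exact: measurable_funM.
Qed.

Lemma measurable_gauss_weight n (B : 'M[R]_n) :
  measurable_fun setT (fun t : n.-tuple (measurableTypeR R) =>
    (expR (2^-1 * (qform 1%:M (row_of t) - qform B (row_of t))))%:E).
Proof.
apply/measurable_EFinP/measurableT_comp => //; apply: measurable_funM => //.
apply: measurable_funB; apply: measurable_qform => // i;
  exact: measurable_row_of.
Qed.

Lemma qform_row1 n (x : R) (v : 'rV[R]_n) :
  qform (1%:M : 'M[R]_(1 + n)) (row_mx x%:M v) = x ^+ 2 + qform 1%:M v.
Proof.
have := qform_block 1 x (0 : 'rV[R]_n) 1%:M v.
by rewrite trmx0 -scalar_mx_block => ->; rewrite mul0mx mxE mulr0 addr0 mul1r.
Qed.

(** Integrating out the first coordinate gives a factor b^(-1/2) and, on completing the square, the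
    same integral for the Schur complement of b, whose determinant is det B / b. *)
Lemma std_gaussian_qform n (B : 'M[R]_n) : posdef B ->
  (\int[std_gaussian R n]_t
     (expR (2^-1 * (qform 1%:M (row_of t) - qform B (row_of t))))%:E =
   ((Num.sqrt (\det B))^-1)%:E)%E.
Proof.
elim: n B => [B _|n IH B pB].
  rewrite integral_dirac //; last exact: measurable_gauss_weight.
  rewrite det_mx00 sqrtr1 invr1 /qform.
  have -> : row_of [tuple] = 0 :> 'rV[R]_0 by apply/rowP => -[].
  by rewrite !mul0mx !mxE subrr mulr0 expR0 diracT mul1e.
have mf := measurable_gauss_weight B.
have f0 (t : n.+1.-tuple (measurableTypeR R)) : (0 <=
    (expR (2^-1 * (qform 1%:M (row_of t) - qform B (row_of t))))%:E)%E.
  by rewrite lee_fin expR_ge0.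
rewrite /std_gaussian ge0_integral_distribution //=.
rewrite fubini_tonelli2 //=; last first.
  by apply: (measurableT_comp mf); exact: measurable_tuple_cons.
have EB := posdef_submx pB; move: (pB); rewrite EB => /posdef_schur [b0 pS].
set b := B 0 0 in EB b0 pS *; set r := @ursubmx R 1 n 1 n B in EB pS *.
set C := @drsubmx R 1 n 1 n B in EB pS *.
rewrite det_block_schur ?gt_eqF // sqrtrM ?(ltW b0) // invfM EFinM -(IH _ pS).
have mS := measurable_gauss_weight (C - b^-1 *: (r^T *m r)).
rewrite -ge0_integralZl_EFin ?invr_ge0 ?sqrtr_ge0 //.
apply: eq_integral => t _; rewrite /fubini_G /=.
under eq_integral => x _.
  rewrite row_of_cons qform_row1 qform_block.
  rewrite (_ : 2^-1 * _ = 2^-1 * (qform 1%:M (row_of t) - qform C (row_of t)) +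
    (2^-1 * (x ^+ 2 - b * x ^+ 2) + (- (r *m (row_of t)^T) 0 0) * x)); last first.
    by field.
  rewrite expRD EFinM; over.
rewrite ge0_integralZl_EFin //=.
  rewrite gauss_integral_affine // -!EFinM qform_schur mulrCA -expRD.
  by congr (_ * expR _)%:E; field; rewrite gt_eqF.
apply/measurable_EFinP/measurableT_comp => //; apply: measurable_funD.
  apply: measurable_funM => //; apply: measurable_funB => //.
  exact: measurable_funM.
exact: measurable_funM.
Qed.

(** Sylvester's identity, from two equal products of block triangular matrices. It turns a
    determinant of size n into one of size [\rank K]. *)
Lemma det_addmx1C m n (A : 'M[R]_(m, n)) (B : 'M[R]_(n, m)) :
  \det (1%:M + A *m B) = \det (1%:M + B *m A).
Proof.
have E : block_mx (1%:M : 'M[R]_m) 0 B (1%:M : 'M[R]_n) *m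
    block_mx 1%:M (- A) 0 (1%:M + B *m A) =
    block_mx (1%:M + A *m B) (- A) 0 1%:M *m block_mx 1%:M 0 B 1%:M.
  rewrite !mulmx_block !mulmx1 !mul1mx !mul0mx !mulmx0 !addr0 mulNmx add0r.
  by rewrite mulmxN addrK [X in block_mx _ _ _ X]addrC addrK !add0r.
move/(congr1 determinant): E; rewrite !det_mulmx !det_lblock !det_ublock.
by rewrite !det1 !mul1r !mulr1.
Qed.

Definition proj n (K : 'M[R]_n) := K^T = K /\ K *m K = K.

(** Write K = A C with A of full column rank and C of full row rank. Idempotence reads A C A C = A
    C; cancelling A on the left and C on the right leaves C A = 1. *)
Lemma proj_base n (K : 'M[R]_n) : proj K -> row_base K *m col_base K = 1%:M.
Proof.
move=> [_ KK]; have /row_fullP [L L1] := col_base_full K.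
have /row_freeP [D D1] := row_base_free K.
have E : col_base K *m row_base K *m (col_base K *m row_base K) =
  col_base K *m row_base K by rewrite !mulmx_base.
move: E L1 D1; move: (col_base K) (row_base K) => A C E L1 D1.
have /(congr1 (mulmx^~ D)) := congr1 (mulmx L) E.
by rewrite /= !mulmxA L1 !mul1mx -(mulmxA _ _ D) D1 mulmx1.
Qed.

Lemma proj_trace n (K : 'M[R]_n) : proj K -> \tr K = (\rank K)%:R.
Proof.
move=> pK; have := mxtrace_mulC (col_base K) (row_base K).
by rewrite mulmx_base proj_base // mxtrace1.
Qed.

Lemma det_proj n (K : 'M[R]_n) (c : R) : proj K ->
  \det (1%:M + c *: K) = (1 + c) ^+ \rank K.
Proof.
move=> pK; have := det_addmx1C (c *: col_base K) (row_base K).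
rewrite -scalemxAl -scalemxAr mulmx_base proj_base // => ->.
by rewrite scalemx1 -raddfD /= det_scalar.
Qed.

Lemma qform_proj n (K : 'M[R]_n) v : proj K -> qform K v = qform 1%:M (v *m K).
Proof.
by move=> [tK KK]; rewrite /qform mulmx1 trmx_mul tK mulmxA -[in RHS](mulmxA v) KK.
Qed.

Lemma qform1_ge0 n (v : 'rV[R]_n) : 0 <= qform 1%:M v.
Proof. by rewrite /qform mulmx1; exact: rv_norm_ge0. Qed.

Lemma qform1_gt0 n (v : 'rV[R]_n) : v != 0 -> 0 < qform 1%:M v.
Proof.
move=> v0; rewrite lt_neqAle qform1_ge0 andbT eq_sym.
apply: contra v0 => /eqP; rewrite /qform mulmx1 => v0.
by apply/eqP/rv_norm_eq0.
Qed.

Lemma qform_proj_ge0 n (K : 'M[R]_n) v : proj K -> 0 <= qform K v.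
Proof. by move=> pK; rewrite qform_proj // qform1_ge0. Qed.

Lemma qformD n (A B : 'M[R]_n) v : qform (A + B) v = qform A v + qform B v.
Proof. by rewrite /qform mulmxDr mulmxDl mxE. Qed.

Lemma qformZ n (A : 'M[R]_n) c v : qform (c *: A) v = c * qform A v.
Proof. by rewrite /qform -scalemxAr -scalemxAl mxE. Qed.

Lemma qformN n (A : 'M[R]_n) v : qform (- A) v = - qform A v.
Proof. by rewrite -scaleN1r qformZ mulN1r. Qed.

Lemma proj_compl n (K : 'M[R]_n) : proj K -> proj (1%:M - K).
Proof.
move=> [tK KK]; split; first by rewrite raddfB /= trmx1 tK.
by rewrite mulmxBl !mulmxBr !mul1mx !mulmx1 KK subrr subr0.
Qed.

Lemma qform_proj_le n (K : 'M[R]_n) v : proj K -> qform K v <= qform 1%:M v.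
Proof.
move=> /proj_compl /(@qform_proj_ge0 _ _ v).
by rewrite qformD qformN subr_ge0.
Qed.

Lemma posdef_proj n (K : 'M[R]_n) (c : R) : proj K -> 0 < 1 + c ->
  posdef (1%:M + c *: K).
Proof.
move=> pK c1; split; first by rewrite raddfD /= trmx1 linearZ /= pK.1.
move=> v v0; rewrite qformD qformZ.
have := qform1_gt0 v0; have := qform_proj_le v pK; have := qform_proj_ge0 v pK.
move: (qform K v) (qform 1%:M v) => a b a0 ab b0.
have [c0|c0] := leP 0 c; first by rewrite ltr_wpDr // mulr_ge0.
have : c * b <= c * a by rewrite ler_nM2l.
have : 0 < (1 + c) * b by rewrite mulr_gt0.
lra.
Qed.

(** The Laplace transform of a chi-squared variable with [\rank K] degrees of freedom. Negative s
    above -1/2 serves for upper tails. *)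
Lemma std_gaussian_proj n (K : 'M[R]_n) (s : R) : proj K -> 0 < 1 + 2 * s ->
  (\int[std_gaussian R n]_t (expR (- s * qform K (row_of t)))%:E =
   ((Num.sqrt ((1 + 2 * s) ^+ \rank K))^-1)%:E)%E.
Proof.
move=> pK s1; rewrite -det_proj // -std_gaussian_qform; last exact: posdef_proj.
apply: eq_integral => t _; congr (expR _)%:E.
by rewrite qformD qformZ; field.
Qed.

End Quad.

(** * Gram-Schmidt on projections *)

Section GramSchmidt.
Variable R : realType.
Variable n : nat.
Implicit Types (K : 'M[R]_n) (y u v : 'rV[R]_n).

(* Removes the direction y K from the projection K. If y K = 0, then
   [qform K y]^-1 = 0 and K is left unchanged. *)
Definition gs K y := K - (qform K y)^-1 *: ((y *m K)^T *m (y *m K)).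

Lemma qform_proj_eq0 K y : proj K -> qform K y = 0 -> y *m K = 0.
Proof.
move=> pK; rewrite qform_proj // /qform mulmx1; exact: rv_norm_eq0.
Qed.

Lemma gs_eq K y : proj K -> qform K y = 0 -> gs K y = K.
Proof. by move=> pK q0; rewrite /gs qform_proj_eq0 // mulmx0 scaler0 subr0. Qed.

Lemma norm_proj K y : proj K -> (y *m K) *m (y *m K)^T = (qform K y)%:M.
Proof. by move=> pK; rewrite [LHS]mx11E qform_proj // /qform mulmx1. Qed.

Lemma gs_proj K y : proj K -> proj (gs K y).
Proof.
move=> pK; have [tK KK] := pK.
have [q0|q0] := eqVneq (qform K y) 0; first by rewrite gs_eq.
rewrite /gs; set w := y *m K.
have wK : w *m K = w by rewrite /w -mulmxA KK.
have Kw : K *m w^T = w^T by rewrite -[K in LHS]tK -trmx_mul wK.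
have ww : w *m w^T = (qform K y)%:M by exact: norm_proj.
clearbody w; split; first by rewrite raddfB /= linearZ /= trmx_mul trmxK tK.
rewrite mulmxBl !mulmxBr KK -!scalemxAl -!scalemxAr !mulmxA Kw.
rewrite -!(mulmxA w^T) wK ww mul_scalar_mx -scalemxAr !scalerA.
by rewrite mulVf // mulr1 subrr subr0.
Qed.

Lemma qform_gs K y u : proj K ->
  qform (gs K y) u = qform K u - (qform K y)^-1 * (y *m K *m u^T) 0 0 ^+ 2.
Proof. by move=> _; rewrite /gs qform_schur. Qed.

(** The form of [gs K y] at u is nonnegative; multiplied by [qform K y], this is Cauchy-Schwarz for
    K. *)
Lemma cauchy_proj K y u : proj K ->
  (y *m K *m u^T) 0 0 ^+ 2 <= qform K y * qform K u.
Proof.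
move=> pK; have [q0|q0] := eqVneq (qform K y) 0.
  by rewrite (qform_proj_eq0 pK q0) mul0mx mxE expr0n /= q0 mul0r.
have := qform_proj_ge0 u (gs_proj y pK); rewrite qform_gs // subr_ge0.
rewrite mulrC ler_pdivrMr 1?mulrC // lt_neqAle eq_sym q0.
exact: qform_proj_ge0.
Qed.

(** Rank equals trace for projections, and the rank-one term removed by [gs] has trace 1. *)
Lemma rank_gs K y : proj K -> qform K y != 0 -> \rank K = (\rank (gs K y)).+1.
Proof.
move=> pK q0; apply/eqP; rewrite -(@eqr_nat R) -addn1 natrD.
rewrite -!proj_trace //; last exact: gs_proj.
rewrite /gs raddfB /= mxtraceZ mxtrace_mulC norm_proj // mxtrace_scalar.
by rewrite mulr1n mulVf // subrK.
Qed.

Lemma gs_kill K y : proj K -> y *m gs K y = 0.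
Proof.
move=> pK; have [q0|q0] := eqVneq (qform K y) 0.
  by rewrite gs_eq // qform_proj_eq0.
rewrite /gs mulmxBr -scalemxAr (mulmxA y (y *m K)^T).
have -> : y *m (y *m K)^T = (qform K y)%:M.
  by rewrite [LHS]mx11E trmx_mul pK.1 mulmxA.
by rewrite mul_scalar_mx scalerA mulVf // scale1r subrr.
Qed.

Lemma gs_kill_trans K y v : proj K -> v *m K = 0 -> v *m gs K y = 0.
Proof.
move=> pK vK; have vw : v *m (y *m K)^T = 0.
  by rewrite trmx_mul pK.1 mulmxA vK mul0mx.
by rewrite /gs mulmxBr vK -scalemxAr (mulmxA v (y *m K)^T) vw mul0mx scaler0 subrr.
Qed.

(** Later S is the matrix of all samples: the complement of the final projection then lies in their
    span, while [gsseq_kill] shows that the projection annihilates them. *)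
Lemma gs_span K y m (S : 'M[R]_(m, n)) :
  (1%:M - K <= S)%MS -> (y <= S)%MS -> (1%:M - gs K y <= S)%MS.
Proof.
move=> KS yS; rewrite /gs opprB addrA addrAC addmx_sub // scalemx_sub //.
apply: submx_trans (submxMl _ _) _.
have -> : y *m K = y - y *m (1%:M - K) by rewrite mulmxBr mulmx1 subKr.
by rewrite addmx_sub // eqmx_opp (submx_trans (submxMl _ _)).
Qed.

(* [gsseq 1%:M Y] is the projection onto the orthogonal complement of the
   span of Y. *)
Definition gsseq K (Y : seq (n.-tuple (measurableTypeR R))) : 'M[R]_n :=
  foldl (fun K t => gs K (row_of t)) K Y.

Lemma gsseq_proj K Y : proj K -> proj (gsseq K Y).
Proof.
by elim: Y K => [//|t Y IH] K pK; apply: IH; exact: gs_proj.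
Qed.

Lemma gsseq_kill_trans K Y v : proj K -> v *m K = 0 -> v *m gsseq K Y = 0.
Proof.
elim: Y K => [//|t Y IH] K pK vK; apply: IH; first exact: gs_proj.
exact: gs_kill_trans.
Qed.

Lemma gsseq_kill K Y t : proj K -> t \in Y -> row_of t *m gsseq K Y = 0.
Proof.
elim: Y K => [//|z Y IH] K pK; rewrite inE => /predU1P[->|tY].
  by apply: (@gsseq_kill_trans (gs K (row_of z)) Y); [exact: gs_proj|exact: gs_kill].
by apply: IH => //; exact: gs_proj.
Qed.

Lemma gsseq_span K Y m (S : 'M[R]_(m, n)) : (1%:M - K <= S)%MS ->
  (forall t, t \in Y -> (row_of t <= S)%MS) -> (1%:M - gsseq K Y <= S)%MS.
Proof.
elim: Y K => [//|t Y IH] K KS YS; apply: IH.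
  by apply: gs_span => //; apply: YS; rewrite inE eqxx.
by move=> z zY; apply: YS; rewrite inE zY orbT.
Qed.

Section Measurability.
Context d (T : measurableType d).

Definition measurable_mx (p q : nat) (K : T -> 'M[R]_(p, q)) :=
  forall i j, measurable_fun setT (fun t => K t i j).

Lemma measurable_mulmx (p q r : nat) (A : T -> 'M[R]_(p, q))
    (B : T -> 'M[R]_(q, r)) : measurable_mx A -> measurable_mx B ->
  measurable_mx (fun t => A t *m B t).
Proof.
move=> mA mB i j; rewrite (_ : (fun t => _) =
  fun t => \sum_k A t i k * B t k j); last first.
  by apply/funext => t; rewrite mxE.
by apply: measurable_sum => k; exact: measurable_funM.
Qed.

Lemma measurable_tr (p q : nat) (A : T -> 'M[R]_(p, q)) :
  measurable_mx A -> measurable_mx (fun t => (A t)^T).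
Proof.
move=> mA i j; rewrite (_ : (fun t => _) = fun t => A t j i) //.
by apply/funext => t; rewrite mxE.
Qed.

(** At a zero of f both the inverse and the power -1 are 0, so [gs] is measurable even where the
    norm [qform K y] vanishes. *)
Lemma measurable_funV (f : T -> R) : measurable_fun setT f ->
  (forall t, 0 <= f t) -> measurable_fun setT (fun t => (f t)^-1).
Proof.
move=> mf f0; rewrite (_ : (fun t => _) = (@powR R ^~ (-1)) \o f).
  by apply: measurableT_comp => //; exact: measurable_powR.
by apply/funext => t /=; rewrite powR_inv1.
Qed.

Lemma measurable_gs (K : T -> 'M[R]_n) (y : T -> 'rV[R]_n) :
  (forall t, proj (K t)) -> measurable_mx K -> measurable_mx y ->
  measurable_mx (fun t => gs (K t) (y t)).
Proof.
move=> pK mK my i j.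
have mw := measurable_mulmx my mK.
have := measurable_mulmx (measurable_tr mw) mw.
move=> /(_ i j) mww.
rewrite (_ : (fun t => _) = fun t => K t i j - (qform (K t) (y t))^-1 *
  ((y t *m K t)^T *m (y t *m K t)) i j); last first.
  by apply/funext => t; rewrite !mxE.
apply: measurable_funB => //; apply: measurable_funM => //.
apply: measurable_funV; last by move=> t; exact: qform_proj_ge0.
by apply: measurable_qform => //; exact: my.
Qed.

Lemma measurable_row_of_comp (y : T -> n.-tuple (measurableTypeR R)) :
  measurable_fun setT y -> measurable_mx (fun t => row_of (y t)).
Proof.
move=> my i j; rewrite ord1.
exact: (measurableT_comp (@measurable_row_of R n j) my).
Qed.

(** The projection K varies with the point as well, because after one sample it is itself a function
    of that sample. *)
Lemma measurable_gsseq N (K : T -> 'M[R]_n) (Y : T -> sample R n N) :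
  (forall t, proj (K t)) -> measurable_mx K -> measurable_fun setT Y ->
  measurable_mx (fun t => gsseq (K t) (Y t)).
Proof.
elim: N K Y => [|N IH] K Y pK mK mY.
  by rewrite (_ : (fun t => _) = K) //; apply/funext => t; rewrite (tuple0 (Y t)).
have m0 : measurable_fun setT (fun t => tnth (Y t) ord0).
  exact: (measurableT_comp (@measurable_tnth _ _ N.+1 ord0) mY).
rewrite (_ : (fun t => _) = fun t =>
  gsseq (gs (K t) (row_of (tnth (Y t) ord0))) [tuple of behead (Y t)]).
  apply: IH.
  - by move=> t; exact: gs_proj.
  - by apply: measurable_gs => //; exact: measurable_row_of_comp.
  - apply: (@measurableT_comp _ _ _ _ _ _
      (fun x : sample R n N.+1 => [tuple of behead x])) => //.
    exact: measurable_behead.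
by apply/funext => t; rewrite {1}(tuple_eta (Y t)).
Qed.

End Measurability.

End GramSchmidt.

(** * Events and moments along the sequence of samples *)

Section Sequential.
Variables (R : realType) (n : nat).
Notation tup := (n.-tuple (measurableTypeR R)).
Variable G : nat -> 'M[R]_n -> tup -> bool.
Notation stdg := (std_gaussian R n).

(* [G i] holds for each sample relative to the projection orthogonal to the
   samples before it. *)
Fixpoint allg i (K : 'M[R]_n) (Y : seq tup) : bool :=
  if Y is y :: Y' then G i K y && allg i.+1 (gs K (row_of y)) Y' else true.

Hypothesis mG : forall d (T : measurableType d) i (K : T -> 'M[R]_n)
  (y : T -> tup), (forall t, proj (K t)) -> measurable_mx K ->
  measurable_fun setT y -> measurable_fun setT (fun t => G i (K t) (y t)).

Hypothesis G_neq0 : forall i K y, G i K y -> qform K (row_of y) != 0.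

Lemma measurable_allg d (T : measurableType d) N i (K : T -> 'M[R]_n)
    (Y : T -> sample R n N) : (forall t, proj (K t)) -> measurable_mx K ->
  measurable_fun setT Y -> measurable_fun setT (fun t => allg i (K t) (Y t)).
Proof.
elim: N i K Y => [|N IH] i K Y pK mK mY.
  rewrite (_ : (fun t => _) = cst true) //.
  by apply/funext => t; rewrite (tuple0 (Y t)).
have m0 : measurable_fun setT (fun t => tnth (Y t) ord0).
  exact: (measurableT_comp (@measurable_tnth _ _ N.+1 ord0) mY).
rewrite (_ : (fun t => _) = fun t => G i (K t) (tnth (Y t) ord0) &&
  allg i.+1 (gs (K t) (row_of (tnth (Y t) ord0))) [tuple of behead (Y t)]).
  apply: measurable_and; first exact: mG.
  apply: IH.
  - by move=> t; exact: gs_proj.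
  - by apply: measurable_gs => //; exact: measurable_row_of_comp.
  - apply: (@measurableT_comp _ _ _ _ _ _
      (fun x : sample R n N.+1 => [tuple of behead x])) => //.
    exact: measurable_behead.
by apply/funext => t; rewrite {1}(tuple_eta (Y t)).
Qed.

Lemma measurable_const_mx d (T : measurableType d) p q (K : 'M[R]_(p, q)) :
  measurable_mx (fun _ : T => K).
Proof. by move=> i j; exact: measurable_cst. Qed.

Lemma measurable_allg_set N i K : proj K ->
  measurable [set Y : sample R n N | allg i K Y].
Proof.
move=> pK; rewrite -[X in measurable X]setTI.
apply: (@measurable_allg _ _ N i (fun=> K) id _ _ _ _ [set true]) => //.
Qed.

Lemma measurable_G_set i K : proj K -> measurable [set y | G i K y].
Proof.
move=> pK; rewrite -[X in measurable X]setTI.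
apply: (@mG _ _ i (fun=> K) id _ _ _ _ [set true]) => //.
Qed.

(** Accepted samples have nonzero norm, so each lowers the rank by one and the projection met at
    step j has rank n - j. A bound valid for every projection of that rank therefore applies
    conditionally at step j, and the N factors multiply. *)
Lemma allg_prob N i K (e : R) : 0 <= e <= 1 ->
  (forall j K', proj K' -> (\rank K' + j)%N = n -> (i <= j < i + N)%N ->
    (1 - e)%:E <= stdg [set y | G j K' y])%E ->
  proj K -> (\rank K + i)%N = n ->
  (((1 - e) ^+ N)%:E <= iid_law stdg N [set Y : sample R n N | allg i K Y])%E.
Proof.
move=> e01; have e0 : 0 <= 1 - e by lra.
elim: N i K => [|N IH] i K H pK rK.
  by rewrite iid_law0 indicE mem_set //= expr0.
rewrite iid_lawS /=.
apply: (@le_trans _ _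
    (\int[stdg]_y (((1 - e) ^+ N)%:E * (\1_[set y | G i K y] y)%:E))%E).
  rewrite ge0_integralZl_EFin //; last 2 first.
  - by apply/measurable_EFinP; apply: measurable_indic; exact: measurable_G_set.
  - exact: exprn_ge0.
  rewrite integral_indic //; last exact: measurable_G_set.
  rewrite setIT exprSr EFinM lee_pmul // ?lee_fin ?exprn_ge0 //.
  by apply: H => //; rewrite leqnn /= addnS ltnS leq_addr.
apply: ge0_le_lower_integral => y.
  by rewrite mule_ge0 // lee_fin ?exprn_ge0.
rewrite indicE; case: (boolP (y \in _)) => [|_]; last by rewrite mule0.
rewrite inE /= mule1 => Gy; rewrite Gy /=.
apply: IH => //; first last.
- by rewrite addnS -addSn -rank_gs //; exact: G_neq0 Gy.
- exact: gs_proj.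
- move=> j K' pK' rK' /andP[ij jN]; apply: H => //.
  by rewrite ltnW //= addnS -addSn.
Qed.

Variables (Psi : 'M[R]_n -> R) (rho : nat -> R).
Hypothesis mPsi : forall d (T : measurableType d) (K : T -> 'M[R]_n),
  (forall t, proj (K t)) -> measurable_mx K ->
  measurable_fun setT (fun t => Psi (K t)).
Hypothesis Psi0 : forall K, proj K -> 0 <= Psi K.
Hypothesis rho0 : forall i, 0 <= rho i.

Lemma measurable_allg_Psi N i K : proj K -> measurable_fun setT
  (fun Y : sample R n N => ((allg i K Y)%:R * Psi (gsseq K Y))%:E).
Proof.
move=> pK; apply/measurable_EFinP/measurable_funM; last first.
  apply: mPsi; first by move=> Y; exact: gsseq_proj.
  by apply: measurable_gsseq => //; exact: measurable_const_mx.
rewrite (_ : (fun Y => _) = \1_[set Y : sample R n N | allg i K Y]).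
  by apply: measurable_indic; exact: measurable_allg_set.
apply/funext => Y; rewrite indicE; congr (nat_of_bool _)%:R.
by apply/idP/idP; rewrite inE.
Qed.

Lemma measurable_step i K : proj K -> measurable_fun setT
  (fun y : tup => ((G i K y)%:R * Psi (gs K (row_of y)))%:E).
Proof.
move=> pK; apply/measurable_EFinP/measurable_funM; last first.
  apply: mPsi; first by move=> Y; exact: gs_proj.
  apply: measurable_gs => //.
  exact: measurable_row_of_comp.
rewrite (_ : (fun Y => _) = \1_[set y | G i K y]).
  by apply: measurable_indic; exact: measurable_G_set.
apply/funext => Y; rewrite indicE; congr (nat_of_bool _)%:R.
by apply/idP/idP; rewrite inE.
Qed.

(* [Psi] evaluated along Gram-Schmidt is a supermartingale up to the factors
   [rho j], because the next sample is independent of the current projection. *)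
Lemma allg_integral N i K :
  (forall j K', proj K' -> (\rank K' + j)%N = n -> (i <= j < i + N)%N ->
    \int[stdg]_y ((G j K' y)%:R * Psi (gs K' (row_of y)))%:E <=
      (rho j * Psi K')%:E)%E ->
  proj K -> (\rank K + i)%N = n ->
  (\int[iid_law stdg N]_Y ((allg i K Y)%:R * Psi (gsseq K Y))%:E <=
   ((\prod_(j < N) rho (i + j)%N) * Psi K)%:E)%E.
Proof.
elim: N i K => [|N IH] i K H pK rK.
  rewrite big_ord0 mul1r integral_dirac //; first by rewrite diracT mul1e mul1r.
  exact: measurable_allg_Psi.
rewrite integral_iid_lawS; first last.
- by move=> Y; rewrite lee_fin mulr_ge0 // Psi0 //; exact: gsseq_proj.
- exact: measurable_allg_Psi.
set p := \prod_(j < N) rho (i.+1 + j)%N.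
have p0 : 0 <= p by apply: prodr_ge0.
apply: (@le_trans _ _ (\int[stdg]_y
  (p%:E * ((G i K y)%:R * Psi (gs K (row_of y)))%:E))%E).
  apply: ge0_le_lower_integral => y.
    apply: integral_ge0 => Y _.
    rewrite lee_fin mulr_ge0 // Psi0 //; exact: gsseq_proj.
  have [Gy|Gy] := boolP (G i K y); last first.
    rewrite integral0_eq; first by rewrite mul0r mule0.
    by move=> Y _ /=; rewrite (negbTE Gy) mul0r.
  rewrite mul1r -EFinM /= Gy /=; apply: IH; first last.
  - by rewrite addnS -addSn -rank_gs //; exact: G_neq0 Gy.
  - exact: gs_proj.
  - move=> j K' pK' rK' /andP[ij jN]; apply: H => //.
    by rewrite ltnW //= addnS -addSn.
rewrite ge0_integralZl_EFin //; last 2 first.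
- by move=> y _; rewrite lee_fin mulr_ge0 // Psi0 //; exact: gs_proj.
- exact: measurable_step.
apply: (@le_trans _ _ (p%:E * (rho i * Psi K)%:E)%E).
  apply: lee_wpmul2l; first by rewrite lee_fin.
  by apply: H => //; rewrite leqnn /= addnS ltnS leq_addr.
rewrite -EFinM lee_fin big_ord_recl addn0 (eq_bigr (fun j : 'I_N => rho (i.+1 + j)%N)).
  by rewrite -/p mulrCA mulrA.
by move=> j _; rewrite /= /bump /= addnA addn1.
Qed.
End Sequential.

(** * Markov's inequality and elementary bounds *)

Section Markov.
Context d (T : measurableType d) (R : realType) (P : probability T R).
Local Open Scope ereal_scope.

Lemma le_prob_integral (A : set T) (f : T -> \bar R) : measurable A ->
  (forall x, 0 <= f x) -> (forall x, A x -> 1 <= f x) -> P A <= \int[P]_x f x.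
Proof.
move=> mA f0 f1; rewrite -[A in leLHS]setIT -integral_indic //.
apply: ge0_le_lower_integral => x; first by rewrite lee_fin.
rewrite indicE; case: (boolP (x \in A)) => [|_]; last exact: f0.
by rewrite inE => /f1.
Qed.

Lemma prob_ge_of_setC (A : set T) (e : R) : measurable A ->
  P (~` A) <= e%:E -> (1 - e)%:E <= P A.
Proof.
move=> mA; have := probability_setC P mA => ->.
have /fineK <- := fin_num_measure P _ mA.
rewrite -EFinB !lee_fin; lra.
Qed.

End Markov.

Lemma measurable_bool_set d (T : measurableType d) (f : T -> bool) :
  measurable_fun setT f -> measurable [set x | f x].
Proof.
by move=> mf; rewrite -[X in measurable X]setTI; exact: (mf measurableT [set true]).
Qed.

Section RealBounds.
Variable R : realType.

(** With y = x + x^2, the bound exp y >= 1 + y is too weak, as (1 - x) (1 + y) = 1 - x^3. The bound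
    exp y >= (1 + y / 2)^2 leaves a margin of order x^2. *)
Lemma expRN_sqr_le (x : R) : 0 <= x <= 4^-1 -> expR (- (x + x ^+ 2)) <= 1 - x.
Proof.
move=> /andP[x0 x1].
have h : (1 + (x + x ^+ 2) / 2) ^+ 2 <= expR (x + x ^+ 2).
  rewrite -[leRHS](_ : expR ((x + x ^+ 2) / 2) ^+ 2 = _); last first.
    by rewrite -expRM_natl; congr expR; field.
  rewrite ler_sqr ?nnegrE ?expR_ge0 ?expR_ge1Dx //.
  by rewrite addr_ge0 // divr_ge0 // addr_ge0 // sqr_ge0.
have e0 := expR_gt0 (x + x ^+ 2).
rewrite expRN -[leLHS]mul1r ler_pdivrMr //.
apply: (@le_trans _ _ ((1 - x) * (1 + (x + x ^+ 2) / 2) ^+ 2)); last first.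
  by rewrite ler_pM2l //; lra.
have -> : (1 - x) * (1 + (x + x ^+ 2) / 2) ^+ 2 =
  1 + x ^+ 2 / 4 * (1 - 3 * x - x ^+ 2 - x ^+ 3) by field.
rewrite lerDl mulr_ge0 //; first by rewrite divr_ge0 // sqr_ge0.
have : x ^+ 2 <= 4^-1 * x by rewrite expr2 ler_wpM2r.
have : x ^+ 3 <= 4^-1 * x ^+ 2 by rewrite exprS ler_wpM2r // sqr_ge0.
nra.
Qed.

Lemma expRN2_le (x : R) : 0 <= x <= 2^-1 -> expR (- (2 * x)) <= 1 - x.
Proof.
move=> /andP[x0 x1]; rewrite expRN.
apply: (@le_trans _ _ (1 + 2 * x)^-1).
  by rewrite lef_pV2 ?posrE ?expR_gt0 ?expR_ge1Dx //; lra.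
rewrite -[leLHS]mul1r ler_pdivrMr; nra.
Qed.

End RealBounds.

(** * Tail bounds for one Gaussian sample against a projection *)

Section OneStep.
Variables (R : realType) (n : nat).
Notation tup := (n.-tuple (measurableTypeR R)).
Notation stdg := (std_gaussian R n).
Implicit Types (K : 'M[R]_n) (u : 'rV[R]_n).

Definition ip K u (y : tup) : R := (row_of y *m K *m u^T) 0 0.

Lemma measurable_qform_row K :
  measurable_fun setT (fun y : tup => qform K (row_of y)).
Proof. by apply: measurable_qform => // i; exact: measurable_row_of. Qed.

(** Chernoff bound with exp(s q), whose mean is (1 - 2 s)^(- rank / 2). The condition s <= 1/8 puts
    2 s in the range of [expRN_sqr_le]. *)
Lemma tail_upper K (M s : R) : proj K -> 0 <= s <= 8^-1 ->
  (stdg [set y | (M < qform K (row_of y))%R] <=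
   (expR ((\rank K)%:R * (s + 2 * s ^+ 2) - s * M))%:E)%E.
Proof.
move=> pK /andP[s0 s8].
have s1 : 0 < 1 + 2 * - s by lra.
apply: (@le_trans _ _
    (\int[stdg]_y ((expR (- s * M))%:E * (expR (- - s * qform K (row_of y)))%:E))%E).
  apply: le_prob_integral => //.
  - apply: measurable_bool_set; apply: measurable_fun_ltr => //.
    exact: measurable_qform_row.
  - move=> y /= My; rewrite -EFinM lee_fin -expRD -[leLHS]expR0 ler_expR.
    have : s * M <= s * qform K (row_of y) by rewrite ler_wpM2l // ltW.
    lra.
rewrite ge0_integralZl_EFin ?expR_ge0 //; last first.
- apply/measurable_EFinP/measurableT_comp => //; apply: measurable_funM => //.
  exact: measurable_qform_row.
rewrite std_gaussian_proj // -EFinM lee_fin.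
have -> : expR ((\rank K)%:R * (s + 2 * s ^+ 2) - s * M) =
    expR (- s * M) * expR ((\rank K)%:R * (s + 2 * s ^+ 2)).
  by rewrite -expRD; congr expR; ring.
rewrite ler_pM2l ?expR_gt0 //.
rewrite -[leRHS]invrK lef_pV2 ?posrE ?invr_gt0 ?expR_gt0 ?sqrtr_gt0 ?exprn_gt0 //.
rewrite -expRN -[leLHS]ger0_norm ?expR_ge0 // -sqrtr_sqr ler_sqrt ?exprn_ge0 //; last exact: ltW.
have -> : expR (- ((\rank K)%:R * (s + 2 * s ^+ 2))) ^+ 2 =
    expR (- (2 * s + (2 * s) ^+ 2)) ^+ \rank K.
  by rewrite -!expRM_natl; congr expR; ring.
rewrite lerXn2r ?nnegrE ?expR_ge0 ?(ltW s1) //.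
rewrite mulrN; apply: expRN_sqr_le; lra.
Qed.

(* Chernoff with exp(-s q), whose mean is exp(- rank K) at s = (e^2 - 1) / 2. *)
Lemma tail_lower K (c : R) : proj K ->
  (stdg [set y | (qform K (row_of y) < c)%R] <=
   (expR (c * ((expR 2 - 1) / 2) - (\rank K)%:R))%:E)%E.
Proof.
move=> pK; set s := (expR 2 - 1) / 2.
have s0 : 0 < s by rewrite divr_gt0 // subr_gt0 expR_gt1.
have s1 : 1 + 2 * s = expR 2 by rewrite /s; field.
apply: (@le_trans _ _
    (\int[stdg]_y ((expR (c * s))%:E * (expR (- s * qform K (row_of y)))%:E))%E).
  apply: le_prob_integral => //.
  - apply: measurable_bool_set; apply: measurable_fun_ltr => //.
    exact: measurable_qform_row.
  - move=> y /= My; rewrite -EFinM lee_fin -expRD -[leLHS]expR0 ler_expR.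
    have : s * qform K (row_of y) <= s * c by rewrite ler_wpM2l // ltW.
    lra.
rewrite ge0_integralZl_EFin ?expR_ge0 //; last first.
- apply/measurable_EFinP/measurableT_comp => //; apply: measurable_funM => //.
  exact: measurable_qform_row.
rewrite std_gaussian_proj // ?s1 ?expR_gt0 // -EFinM lee_fin (expRD (c * s)).
rewrite ler_pM2l ?expR_gt0 // -expRM_natl.
have -> : (\rank K)%:R * 2 = 2%:R * (\rank K)%:R :> R by rewrite mulrC.
by rewrite expRM_natl sqrtr_sqr ger0_norm ?expR_ge0 // expRN.
Qed.

Lemma measurable_ip K u : measurable_fun setT (ip K u).
Proof.
have mr : measurable_mx (fun y : tup => row_of y).
  exact: measurable_row_of_comp.
have mK : measurable_mx (fun _ : tup => K) by exact: measurable_const_mx.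
have mu : measurable_mx (fun _ : tup => u^T) by exact: measurable_const_mx.
exact: (measurable_mulmx (measurable_mulmx mr mK) mu 0 0).
Qed.

Lemma proj_line (w : 'rV[R]_n) (k : R) : k != 0 -> qform 1%:M w = k ->
  proj (k^-1 *: (w^T *m w)) /\ \rank (k^-1 *: (w^T *m w)) = 1%N.
Proof.
move=> k0 wk; have ww : w *m w^T = k%:M by rewrite -wk /qform mulmx1 -mx11E.
have pL : proj (k^-1 *: (w^T *m w)).
  split; first by rewrite linearZ /= trmx_mul trmxK.
  rewrite -scalemxAl -scalemxAr scalerA mulmxA -(mulmxA w^T) ww mul_mx_scalar.
  by rewrite -scalemxAl scalerA -mulrA mulVf // mulr1.
split=> //; apply/eqP; rewrite -(@eqr_nat R) -proj_trace //.
by rewrite mxtraceZ mxtrace_mulC ww mxtrace_scalar mulr1n mulVf.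
Qed.

Lemma qform_line (w v : 'rV[R]_n) (k : R) :
  qform (k^-1 *: (w^T *m w)) v = k^-1 * (v *m w^T) 0 0 ^+ 2.
Proof.
have := qform_schur k w 0 v; rewrite sub0r qformN.
rewrite {2}/qform mulmx0 mul0mx mxE sub0r => /oppr_inj ->.
congr (_ * _ ^+ 2).
by rewrite -[w in LHS]trmxK -trmx_mul mxE.
Qed.

(** [ip K u y] is the inner product of y with u K, whose squared length is [qform K u]; the quotient
    is a chi-squared variable with one degree of freedom. *)
Lemma gauss_ip K u (s : R) : proj K -> qform K u != 0 -> 0 < 1 + 2 * s ->
  (\int[stdg]_y (expR (- s * (ip K u y ^+ 2 / qform K u)))%:E =
   ((Num.sqrt (1 + 2 * s))^-1)%:E)%E.
Proof.
move=> pK k0 s1; have ku : qform 1%:M (u *m K) = qform K u by rewrite -qform_proj.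
have [pL rL] := proj_line k0 ku.
have := std_gaussian_proj pL s1; rewrite rL expr1 => <-.
apply: eq_integral => y _; congr (expR (_ * _))%:E.
by rewrite qform_line trmx_mul pK.1 mulmxA mulrC.
Qed.

Lemma measurable_gauss_ip K u (s : R) : measurable_fun setT
  (fun y => (expR (- s * (ip K u y ^+ 2 / qform K u)))%:E).
Proof.
apply/measurable_EFinP/measurableT_comp => //; apply: measurable_funM => //.
apply: measurable_funM => //; apply: measurable_funX; exact: measurable_ip.
Qed.

(** Chernoff bound from [gauss_ip] at s = -1/4, where the integral equals sqrt 2. If [qform K u] is
    zero, Cauchy-Schwarz makes the event empty. *)
Lemma tail_ip K u (c : R) : proj K ->
  (stdg [set y | (c * qform K u < ip K u y ^+ 2)%R] <=
   (Num.sqrt 2 * expR (- c / 4))%:E)%E.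
Proof.
move=> pK; have k0 := qform_proj_ge0 u pK.
have mA : measurable [set y | c * qform K u < ip K u y ^+ 2].
  apply: measurable_bool_set; apply: measurable_fun_ltr => //.
  by apply: measurable_funX; exact: measurable_ip.
have [k00|kn0] := eqVneq (qform K u) 0.
  rewrite (_ : [set y | _] = set0) ?measure0 ?lee_fin ?mulr_ge0 ?expR_ge0 //.
  apply/seteqP; split => y //=; have := cauchy_proj (row_of y) u pK.
  by rewrite k00 !mulr0 -/(ip K u y) leNgt => /negP.
have s1 : 0 < 1 + 2 * - 4^-1 :> R by lra.
apply: (@le_trans _ _ (\int[stdg]_y
    ((expR (- c / 4))%:E * (expR (- - 4^-1 * (ip K u y ^+ 2 / qform K u)))%:E))%E).
  apply: le_prob_integral => //.
  - move=> y /= My; rewrite -EFinM lee_fin -expRD -[leLHS]expR0 ler_expR.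
    have : c <= ip K u y ^+ 2 / qform K u by rewrite ler_pdivlMr ?ltW // lt_def kn0.
    lra.
rewrite ge0_integralZl_EFin ?expR_ge0 //; last first.
- exact: measurable_gauss_ip.
rewrite gauss_ip // -EFinM lee_fin mulrC ler_pM2r ?expR_gt0 //.
rewrite -sqrtrV ?(ltW s1) // ler_sqrt //.
by rewrite (_ : 1 + 2 * - 4^-1 = 2^-1 :> R) ?invrK //; field.
Qed.

End OneStep.

(** * Moments across one Gram-Schmidt step *)

Section Steps.
Variables (R : realType) (n : nat).
Notation tup := (n.-tuple (measurableTypeR R)).
Notation stdg := (std_gaussian R n).
Implicit Types (K : 'M[R]_n) (u : 'rV[R]_n).

(** The step multiplies the form at u by 1 - z, where z is the squared [ip K u y] over the product
    of the forms at y and u. Replacing 1 - z by exp(- z) turns its powers into Gaussian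
    integrals. *)
Lemma qform_gs_le K u (y : tup) (M : R) : proj K -> qform K u != 0 ->
  0 < qform K (row_of y) <= M ->
  qform (gs K (row_of y)) u <=
  qform K u * expR (- M^-1 * (ip K u y ^+ 2 / qform K u)).
Proof.
move=> pK k0 /andP[q0 qM]; rewrite qform_gs // -/(ip K u y).
have kp : 0 < qform K u by rewrite lt_def k0 qform_proj_ge0.
have MV : M^-1 <= (qform K (row_of y))^-1 by rewrite lef_pV2 ?posrE //; lra.
apply: (@le_trans _ _ (qform K u * (1 + - M^-1 * (ip K u y ^+ 2 / qform K u)))).
  have -> : qform K u * (1 + - M^-1 * (ip K u y ^+ 2 / qform K u)) =
    qform K u - M^-1 * ip K u y ^+ 2 by field; lra.
  by rewrite lerD2l lerN2 ler_wpM2r // sqr_ge0.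
by rewrite ler_pM2l // expR_ge1Dx.
Qed.

(** The factor 1 - z is bounded below by exp(- 2 z), which needs z <= 1/2; this is the origin of c /
    2 in the angle condition. *)
Lemma qform_gs_ge K u (y : tup) (c : R) : proj K -> 0 < qform K u ->
  0 < c <= qform K (row_of y) -> ip K u y ^+ 2 <= c / 2 * qform K u ->
  qform K u * expR (- (2 * (c^-1 * (ip K u y ^+ 2 / qform K u)))) <=
  qform (gs K (row_of y)) u.
Proof.
move=> pK kp /andP[c0 qc] gk; rewrite qform_gs // -/(ip K u y).
have MV : (qform K (row_of y))^-1 <= c^-1 by rewrite lef_pV2 ?posrE //; lra.
apply: (@le_trans _ _ (qform K u * (1 - c^-1 * (ip K u y ^+ 2 / qform K u)))).
  rewrite ler_pM2l // expRN2_le // mulr_ge0 ?divr_ge0 ?sqr_ge0 ?invr_ge0 ?(ltW c0) ?(ltW kp) //=.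
  by rewrite ler_pdivrMl // ler_pdivrMr //.
have -> : qform K u * (1 - c^-1 * (ip K u y ^+ 2 / qform K u)) =
  qform K u - c^-1 * ip K u y ^+ 2 by field; rewrite !gt_eqF.
by rewrite lerD2l lerN2 ler_wpM2r // sqr_ge0.
Qed.

Lemma qform_gs_eq0 K u (y : tup) : proj K -> qform K u = 0 ->
  qform (gs K (row_of y)) u = 0.
Proof.
move=> pK k0; apply/eqP; rewrite eq_le qform_proj_ge0 ?andbT; last exact: gs_proj.
by rewrite qform_gs // k0 sub0r oppr_le0 mulr_ge0 ?sqr_ge0 // invr_ge0 qform_proj_ge0.
Qed.

(** The upper bound M yields the contraction of positive moments; the lower bound keeps the norm
    away from zero, so that the rank drops. *)
Definition good_norm (c : R) (M : nat -> R) (i : nat) K (y : tup) : bool :=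
  (c <= qform K (row_of y)) && (qform K (row_of y) <= M i).

Definition good_angle (c : R) u (i : nat) K (y : tup) : bool :=
  (c <= qform K (row_of y)) && (ip K u y ^+ 2 <= c / 2 * qform K u).

Lemma integral_le1 (A : tup -> bool) :
  (\int[stdg]_y ((A y)%:R)%:E <= 1)%E.
Proof.
rewrite -[leRHS](@probability_setT _ _ _ stdg) -[leRHS]mul1e -integral_cst //=.
by apply: ge0_le_lower_integral => y; rewrite lee_fin ?ler0n // lern1 leq_b1.
Qed.

(** The p-th power of the bound in [qform_gs_le] is integrated by [gauss_ip] at s = p / M i. *)
Lemma step_moment K u (c : R) (M : nat -> R) i (p : nat) : proj K ->
  0 < c -> 0 < M i ->
  (\int[stdg]_y ((good_norm c M i K y)%:R * qform (gs K (row_of y)) u ^+ p)%:E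
   <= ((Num.sqrt (1 + 2 * (p%:R / M i)))^-1 * qform K u ^+ p)%:E)%E.
Proof.
move=> pK c0 M0; have [k0|k0] := eqVneq (qform K u) 0.
  case: p => [|p].
    rewrite mul0r mulr0 addr0 sqrtr1 invr1 !expr0 mulr1.
    by under eq_integral do rewrite expr0 mulr1; exact: integral_le1.
  rewrite integral0_eq ?lee_fin ?mulr_ge0 ?invr_ge0 ?sqrtr_ge0 ?k0 ?exprn_ge0 //.
  by move=> y _; rewrite qform_gs_eq0 // expr0n mulr0.
have kp : 0 < qform K u by rewrite lt_def k0 qform_proj_ge0.
have p0 : 0 <= p%:R / M i by rewrite divr_ge0 // ltW.
have s1 : 0 < 1 + 2 * (p%:R / M i) by lra.
rewrite EFinM -(gauss_ip pK k0 s1) muleC -ge0_integralZl_EFin //; last 2 first.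
- exact: measurable_gauss_ip.
- by rewrite exprn_ge0 // ltW.
apply: ge0_le_lower_integral => y.
  rewrite lee_fin mulr_ge0 // exprn_ge0 // qform_proj_ge0 //; exact: gs_proj.
have [/andP[cq qM]|_] := boolP (good_norm c M i K y); last first.
  by rewrite mul0r mule_ge0 // lee_fin ?expR_ge0 // exprn_ge0 // ltW.
rewrite mul1r -EFinM lee_fin.
have -> : - (p%:R / M i) * (ip K u y ^+ 2 / qform K u) =
    p%:R * (- (M i)^-1 * (ip K u y ^+ 2 / qform K u)) by rewrite !mulNr mulrN mulrA.
rewrite expRM_natl -exprMn lerXn2r ?nnegrE //.
- by apply: qform_proj_ge0; exact: gs_proj.
- by rewrite mulr_ge0 ?expR_ge0 // ltW.
- by apply: qform_gs_le => //; rewrite qM andbT (lt_le_trans c0).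
Qed.

(** The a-th power of the inverse form grows by a factor of at most exp(2 a x / c), where x is
    chi-squared with one degree of freedom. As 8 a <= c, the exponent is at most x / 4, and
    [gauss_ip] at s = -1/4 gives sqrt 2. *)
Lemma step_negmoment K u (c : R) i (a : nat) : proj K -> 0 < c ->
  8 * a%:R <= c ->
  (\int[stdg]_y ((good_angle c u i K y)%:R * (qform (gs K (row_of y)) u)^-1 ^+ a)%:E
   <= (Num.sqrt 2 * (qform K u)^-1 ^+ a)%:E)%E.
Proof.
move=> pK c0 ac; have [k0|k0] := eqVneq (qform K u) 0.
  case: a ac => [|a] ac.
    rewrite !expr0 mulr1.
    under eq_integral do rewrite expr0 mulr1.
    apply: (le_trans (integral_le1 _)); rewrite lee_fin -[leLHS]sqrtr1 ler_sqrt //; lra.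
  (* A form that vanishes at u keeps vanishing, and its inverse is 0 by convention, so both sides
     are 0. *)
  rewrite integral0_eq ?k0 ?lee_fin ?mulr_ge0 ?sqrtr_ge0 ?exprn_ge0 ?invr0 //.
  by move=> y _; rewrite qform_gs_eq0 // invr0 expr0n mulr0.
have kp : 0 < qform K u by rewrite lt_def k0 qform_proj_ge0.
have s1 : 0 < 1 + 2 * - 4^-1 :> R by lra.
have -> : Num.sqrt 2 = (Num.sqrt (1 + 2 * - 4^-1))^-1 :> R.
  by rewrite -sqrtrV ?(ltW s1) //; congr Num.sqrt; field.
rewrite EFinM -(gauss_ip pK k0 s1) muleC -ge0_integralZl_EFin //; last 2 first.
- exact: measurable_gauss_ip.
- by rewrite exprn_ge0 // invr_ge0 ltW.
apply: ge0_le_lower_integral => y.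
  rewrite lee_fin mulr_ge0 // exprn_ge0 // invr_ge0 qform_proj_ge0 //; exact: gs_proj.
have [/andP[cq gk]|_] := boolP (good_angle c u i K y); last first.
  by rewrite mul0r mule_ge0 // lee_fin ?expR_ge0 // exprn_ge0 // invr_ge0 ltW.
rewrite mul1r -EFinM lee_fin.
have cc : 0 < c <= qform K (row_of y) by rewrite c0.
have h := qform_gs_ge pK kp cc gk.
set x := ip K u y ^+ 2 / qform K u in h *.
have x0 : 0 <= x by rewrite divr_ge0 ?sqr_ge0 // ltW.
have e0 : 0 < qform K u * expR (- (2 * (c^-1 * x))) by rewrite mulr_gt0 ?expR_gt0.
apply: (@le_trans _ _ ((qform K u * expR (- (2 * (c^-1 * x))))^-1 ^+ a)).
  rewrite lerXn2r ?nnegrE ?invr_ge0 ?(ltW e0) //.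
    by apply: le_trans h; exact: ltW.
  by rewrite lef_pV2 ?posrE // (lt_le_trans e0).
rewrite invfM exprMn ler_pM2l ?exprn_gt0 ?invr_gt0 // -expRN opprK opprK.
rewrite -expRM_natl ler_expR mulrCA mulrA [X in X <= _]mulrA ler_wpM2r //.
by rewrite ler_pdivrMr // mulrC; lra.
Qed.

End Steps.

(** * Norm and angle estimates under the null law *)

Section Null.
Variables (R : realType) (n : nat).
Notation tup := (n.-tuple (measurableTypeR R)).
Notation stdg := (std_gaussian R n).
Implicit Types (K : 'M[R]_n) (u : 'rV[R]_n) (c : R).

Lemma measurable_qform_comp d (T : measurableType d) (K : T -> 'M[R]_n)
    (y : T -> tup) : measurable_mx K -> measurable_fun setT y ->
  measurable_fun setT (fun t => qform (K t) (row_of (y t))).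
Proof.
move=> mK my; apply: measurable_qform => // i.
exact: measurable_row_of_comp.
Qed.

Lemma measurable_good_norm c M d (T : measurableType d) i (K : T -> 'M[R]_n)
    (y : T -> tup) : (forall t, proj (K t)) -> measurable_mx K ->
  measurable_fun setT y ->
  measurable_fun setT (fun t => good_norm c M i (K t) (y t)).
Proof.
move=> _ mK my; apply: measurable_and; apply: measurable_fun_ler => //;
  exact: measurable_qform_comp.
Qed.

Lemma measurable_good_angle c u d (T : measurableType d) i (K : T -> 'M[R]_n)
    (y : T -> tup) : (forall t, proj (K t)) -> measurable_mx K ->
  measurable_fun setT y ->
  measurable_fun setT (fun t => good_angle c u i (K t) (y t)).
Proof.
move=> _ mK my; apply: measurable_and; apply: measurable_fun_ler => //.
- exact: measurable_qform_comp.
- have mu : measurable_mx (fun _ : T => u^T) by exact: measurable_const_mx.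
  apply: measurable_funX.
  exact: (measurable_mulmx (measurable_mulmx (measurable_row_of_comp my) mK) mu 0 0).
- by apply: measurable_funM => //; apply: measurable_qform.
Qed.

Lemma good_norm_neq0 c M i K (y : tup) : 0 < c -> good_norm c M i K y ->
  qform K (row_of y) != 0.
Proof. by move=> c0 /andP[cq _]; rewrite gt_eqF // (lt_le_trans c0). Qed.

Lemma good_angle_neq0 c u i K (y : tup) : 0 < c -> good_angle c u i K y ->
  qform K (row_of y) != 0.
Proof. by move=> c0 /andP[cq _]; rewrite gt_eqF // (lt_le_trans c0). Qed.

Lemma proj1 : proj (1%:M : 'M[R]_n).
Proof. by split; rewrite ?trmx1 ?mulmx1. Qed.

(** The Chernoff bound of [tail_lower] at threshold c and rank m. *)
Definition low_rate c (m : nat) : R := expR (c * ((expR 2 - 1) / 2) - m%:R).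

Lemma low_rate_le c m m' : (m' <= m)%N -> low_rate c m <= low_rate c m'.
Proof. by move=> mm; rewrite ler_expR lerD2l lerN2 ler_nat. Qed.

Lemma tail_lower_le K c m : proj K -> (m <= \rank K)%N ->
  (stdg [set y | (qform K (row_of y) < c)%R] <= (low_rate c m)%:E)%E.
Proof.
move=> pK mK; apply: (le_trans (tail_lower c pK)).
by rewrite lee_fin; exact: low_rate_le.
Qed.

Lemma allg_norm_prob N c (M : nat -> R) (s e : R) : (N <= n)%N -> 0 < c ->
  0 <= s <= 8^-1 -> 0 <= e <= 1 ->
  (forall j, (j < N)%N -> low_rate c (n - N) +
     expR ((n - j)%:R * (s + 2 * s ^+ 2) - s * M j) <= e) ->
  (((1 - e) ^+ N)%:E <= iid_law stdg N
     [set Y : sample R n N | allg (good_norm c M) 0 1%:M Y])%E.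
Proof.
move=> Nn c0 s01 e01 He; apply: allg_prob => //.
- exact: measurable_good_norm.
- by move=> i K y; exact: good_norm_neq0.
- move=> j K pK rK /andP[_ jN]; rewrite add0n in jN.
  have rKE : \rank K = (n - j)%N.
      by apply/eqP; rewrite -(eqn_add2r j) rK subnK // ltnW // (leq_trans jN).
  have mG : measurable [set y : tup | good_norm c M j K y].
    by apply: measurable_G_set => //; exact: measurable_good_norm.
  apply: prob_ge_of_setC => //.
  apply: (@le_trans _ _ (stdg ([set y | (qform K (row_of y) < c)%R] `|`
     [set y | (M j < qform K (row_of y))%R]))).
    apply: le_iid_law => y /= /negP; rewrite negb_and -!ltNge => /orP[h|h];
      by [left|right].
  apply: (le_trans (measureU2 _ _ _)).
  - apply: measurable_bool_set; apply: measurable_fun_ltr => //.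
    exact: measurable_qform_row.
  - apply: measurable_bool_set; apply: measurable_fun_ltr => //.
    exact: measurable_qform_row.
  apply: (@le_trans _ _ ((low_rate c (n - N))%:E +
     (expR ((n - j)%:R * (s + 2 * s ^+ 2) - s * M j))%:E)%E).
    apply: leeD; first by apply: tail_lower_le => //; rewrite rKE leq_sub2l // ltnW.
    by rewrite -rKE; exact: tail_upper.
  by rewrite -EFinD lee_fin He.
- exact: proj1.
- by rewrite mxrank1 addn0.
Qed.

Lemma allg_norm_moment N c (M : nat -> R) u (p : nat) : (N <= n)%N -> 0 < c ->
  (forall j, (j < N)%N -> 0 < M j) ->
  (\int[iid_law stdg N]_Y ((allg (good_norm c M) 0 1%:M Y)%:R *
     qform (gsseq 1%:M Y) u ^+ p)%:E <=
   ((\prod_(j < N) (Num.sqrt (1 + 2 * (p%:R / M j)))^-1) *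
     qform 1%:M u ^+ p)%:E)%E.
Proof.
move=> Nn c0 M0.
apply: (@allg_integral R n (good_norm c M) _ _ (fun K => qform K u ^+ p)
  (fun j => (Num.sqrt (1 + 2 * (p%:R / M j)))^-1)).
- exact: measurable_good_norm.
- by move=> i K y; exact: good_norm_neq0.
- move=> d T K pK mK; apply: measurable_funX; exact: measurable_qform.
- by move=> K pK; rewrite exprn_ge0 // qform_proj_ge0.
- by move=> i; rewrite invr_ge0 sqrtr_ge0.
- by move=> j K pK rK /andP[_ jN]; apply: step_moment => //; exact: M0.
- exact: proj1.
- by rewrite mxrank1 addn0.
Qed.

Lemma allg_angle_gt0 c u i K (Y : seq tup) : proj K -> 0 < c ->
  0 < qform K u -> allg (good_angle c u) i K Y -> 0 < qform (gsseq K Y) u.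
Proof.
elim: Y i K => [//|y Y IH] i K pK c0 k0 /= /andP[/andP[cq gk] aY].
apply: IH aY => //; first exact: gs_proj.
have cc : 0 < c <= qform K (row_of y) by rewrite c0.
by apply: lt_le_trans (qform_gs_ge pK k0 cc gk); rewrite mulr_gt0 ?expR_gt0.
Qed.

Lemma measurable_gsseq_qform N u (K : 'M[R]_n) : proj K ->
  measurable_fun setT (fun Y : sample R n N => qform (gsseq K Y) u).
Proof.
move=> pK; apply: measurable_qform => //.
by apply: measurable_gsseq => //; exact: measurable_const_mx.
Qed.

(** Markov's inequality for the a-th power of the inverse form: N steps cost sqrt 2 ^ N, and kap ^ a
    beats this when a is proportional to n and kap is a small constant. *)
Lemma null_kernel_lower N c (a : nat) u (kap e : R) : (N <= n)%N -> 0 < c ->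
  8 * a%:R <= c -> 0 < kap -> 0 <= e <= 1 ->
  low_rate c (n - N) + Num.sqrt 2 * expR (- c / 8) <= e ->
  0 < qform 1%:M u ->
  (((1 - e) ^+ N - kap ^+ a * Num.sqrt 2 ^+ N)%:E <= iid_law stdg N
     [set Y : sample R n N | (kap * qform 1%:M u <= qform (gsseq 1%:M Y) u)%R])%E.
Proof.
move=> Nn c0 ac kap0 e01 He k0.
pose A := [set Y : sample R n N | allg (good_angle c u) 0 1%:M Y].
pose B := [set Y : sample R n N | (kap * qform 1%:M u <= qform (gsseq 1%:M Y) u)%R].
have mA : measurable A.
  apply: measurable_allg_set; first exact: measurable_good_angle.
  exact: proj1.
have mB : measurable B.
  apply: measurable_bool_set; apply: measurable_fun_ler => //.
  exact: (measurable_gsseq_qform _ proj1).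
have PA : (((1 - e) ^+ N)%:E <= iid_law stdg N A)%E.
  apply: allg_prob => //.
  - exact: measurable_good_angle.
  - by move=> i K y; exact: good_angle_neq0.
  - move=> j K pK rK /andP[_ jN]; rewrite add0n in jN.
    have rKE : \rank K = (n - j)%N.
      by apply/eqP; rewrite -(eqn_add2r j) rK subnK // ltnW // (leq_trans jN).
    have mG : measurable [set y : tup | good_angle c u j K y].
      by apply: measurable_G_set => //; exact: measurable_good_angle.
    apply: prob_ge_of_setC => //.
    apply: (@le_trans _ _ (stdg ([set y | (qform K (row_of y) < c)%R] `|`
       [set y | (c / 2 * qform K u < ip K u y ^+ 2)%R]))).
      apply: le_iid_law => y /= /negP; rewrite negb_and -!ltNge => /orP[h|h];
        by [left|right].
    apply: (le_trans (measureU2 _ _ _)).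
    + apply: measurable_bool_set; apply: measurable_fun_ltr => //.
      exact: measurable_qform_row.
    + apply: measurable_bool_set; apply: measurable_fun_ltr => //.
      by apply: measurable_funX; exact: measurable_ip.
    apply: (@le_trans _ _ ((low_rate c (n - N))%:E +
       (Num.sqrt 2 * expR (- c / 8))%:E)%E).
      apply: leeD; first by apply: tail_lower_le => //; rewrite rKE leq_sub2l // ltnW.
      apply: (le_trans (tail_ip _ _ pK)); rewrite lee_fin.
      by rewrite (_ : - (c / 2) / 4 = - c / 8) //; field.
    by rewrite -EFinD lee_fin He.
  - exact: proj1.
  - by rewrite mxrank1 addn0.
have PAB : (iid_law stdg N (A `\` B) <= (kap ^+ a * Num.sqrt 2 ^+ N)%:E)%E.
  pose f (Y : sample R n N) : R := (allg (good_angle c u) 0 1%:M Y)%:R *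
     (qform (gsseq 1%:M Y) u)^-1 ^+ a.
  have Hf : (\int[iid_law stdg N]_Y (f Y)%:E <=
      (Num.sqrt 2 ^+ N * (qform 1%:M u)^-1 ^+ a)%:E)%E.
    rewrite -[X in Num.sqrt 2 ^+ X]card_ord -prodr_const.
    apply: (@allg_integral R n (good_angle c u) _ _
      (fun K => (qform K u)^-1 ^+ a) (fun=> Num.sqrt 2)).
    - exact: measurable_good_angle.
    - by move=> i K y; exact: good_angle_neq0.
    - move=> d T K pK mK; apply: measurable_funX; apply: measurable_funV.
        exact: measurable_qform.
      by move=> t; exact: qform_proj_ge0.
    - by move=> K pK; rewrite exprn_ge0 // invr_ge0 qform_proj_ge0.
    - by move=> i; rewrite sqrtr_ge0.
    - by move=> j K pK rK _; exact: step_negmoment.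
    - exact: proj1.
    - by rewrite mxrank1 addn0.
  have f0 Y : 0 <= f Y.
    rewrite mulr_ge0 // exprn_ge0 // invr_ge0 qform_proj_ge0 //.
    exact/gsseq_proj/proj1.
  have kk : 0 < kap * qform 1%:M u by rewrite mulr_gt0.
  apply: (@le_trans _ _ (\int[iid_law stdg N]_Y
     (((kap * qform 1%:M u) ^+ a)%:E * (f Y)%:E))%E).
    apply: le_prob_integral.
    - exact: measurableD.
    - by move=> Y; rewrite -EFinM lee_fin mulr_ge0 // exprn_ge0 // ltW.
    - move=> Y [AY /= /negP]; rewrite -ltNge => BY.
      (* Positivity rules out the default value of the inverse, so the negative moment really is
         large off B. *)
      have kN := allg_angle_gt0 proj1 c0 k0 AY.
      rewrite -EFinM lee_fin /f AY mul1r -exprMn exprn_ege1 //.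
      by rewrite ler_pdivlMr // mul1r ltW.
  rewrite ge0_integralZl_EFin ?exprn_ge0 ?(ltW kk) //; last 2 first.
  - by move=> Y _; rewrite lee_fin.
  - apply: (@measurable_allg_Psi _ _ (good_angle c u) _ (fun K => (qform K u)^-1 ^+ a)); last exact: proj1.
      exact: measurable_good_angle.
    move=> d T K pK mK; apply: measurable_funX; apply: measurable_funV.
      exact: measurable_qform.
    by move=> t; exact: qform_proj_ge0.
  apply: (le_trans (lee_wpmul2l _ Hf)).
    by rewrite lee_fin exprn_ge0 // ltW.
  rewrite -EFinM lee_fin exprMn mulrACA [X in _ * X]mulrC.
  by rewrite -exprMn mulVf ?gt_eqF // expr1n mulr1.
rewrite EFinB leeBlDr //.
apply: (le_trans PA); apply: (@le_trans _ _ (iid_law stdg N (B `|` A `\` B))).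
  by apply: le_iid_law => Y AY; have [BY|BY] := pselect (B Y); [left|right].
apply: (le_trans (measureU2 _ _ _)) => //; first exact: measurableD.
by apply: leeD.
Qed.
End Null.

(** * Series and products behind the null moments *)

Section Series.
Variable R : realType.

Lemma expR_nneseries (x : R) : 0 <= x ->
  (\sum_(0 <= p <oo) (x ^+ p / p`!%:R)%:E = (expR x)%:E)%E.
Proof.
move=> x0; rewrite /expR -EFin_lim; last exact: is_cvg_series_exp_coeff.
by congr (limn _); apply/funext => m /=; rewrite sumEFin.
Qed.

Lemma expR_partial_le (x : R) m : 0 <= x ->
  \sum_(0 <= p < m) x ^+ p / p`!%:R <= expR x.
Proof.
move=> x0; rewrite -lee_fin -expR_nneseries // -sumEFin.
by apply: nneseries_lim_ge => p _ _; rewrite lee_fin divr_ge0 // exprn_ge0.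
Qed.

Lemma expR_tail_le (x : R) m b : 0 <= x ->
  \sum_(0 <= p < m) x ^+ (b + p) / (b + p)`!%:R <= expR x.
Proof.
move=> x0; apply: le_trans (expR_partial_le (b + m) x0).
rewrite [leRHS](big_cat_nat (n := b)) //= ?leq_addr //.
have -> : \sum_(b <= p < b + m) x ^+ p / p`!%:R =
    \sum_(0 <= p < m) x ^+ (b + p) / (b + p)`!%:R.
  rewrite -{1}[b]add0n big_addn addKn.
  by apply: eq_bigr => p _; rewrite addnC.
by rewrite lerDr sumr_ge0 // => p _; rewrite divr_ge0 // exprn_ge0.
Qed.

(** The left side times t^p (1 - t)^D is one term of the expansion of (1 - t + t)^(D + p) = 1. *)
Lemma binomial_term_le (t : R) (D p : nat) : 0 < t < 1 ->
  'C(D + p, p)%:R <= t^-1 ^+ p * (1 - t)^-1 ^+ D.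
Proof.
move=> /andP[t0 t1]; have s0 : 0 < 1 - t by rewrite subr_gt0.
rewrite !exprVn -invfM -[leRHS]mul1r ler_pdivlMr ?mulr_gt0 ?exprn_gt0 //.
have E : (1 - t + t) ^+ (D + p) = 1 by rewrite subrK expr1n.
rewrite -[leRHS]E [in leRHS]exprDn.
have pD : (p < (D + p).+1)%N by rewrite ltnS leq_addl.
rewrite (bigD1 (Ordinal pD)) //= addnK.
rewrite -[X in _ <= X + _]mulr_natl [(1 - t) ^+ D * _]mulrC lerDl.
by rewrite sumr_ge0 // => i _; rewrite mulrn_wge0 //;
   apply: mulr_ge0; apply: exprn_ge0; exact: ltW.
Qed.

Lemma prod_ratio (b N2 p : nat) : (N2 <= b)%N ->
  (\prod_(l < N2) ((b - l)%:R / (b - l + p)%:R)) * ((b - N2)`! * (b + p)`!)%:R =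
  (b`! * (b - N2 + p)`!)%:R :> R.
Proof.
elim: N2 => [|N2 IH] Nb; first by rewrite big_ord0 mul1r subn0.
rewrite big_ord_recr /=.
have e : (b - N2 = (b - N2.+1).+1)%N by lia.
have := IH (ltnW Nb); rewrite e addSn !factS => IH'.
have nz : ((b - N2.+1 + p).+1)%:R != 0 :> R by rewrite pnatr_eq0.
apply: (mulIf nz); rewrite -!natrM.
move: IH'; rewrite !natrM => IH'.
rewrite [RHS](_ : _ = b`!%:R * (((b - N2.+1 + p).+1)%:R * (b - N2.+1 + p)`!%:R)); last by ring.
rewrite -IH'.
by field.
Qed.

(** The bounds built on [j./2] agree at j = 2 l and j = 2 l + 1, so two square roots combine into
    one rational factor; an unpaired last factor is at most 1. *)
Lemma prod_sqrt_le (b N p : nat) : (N <= 2 * b)%N ->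
  \prod_(j < N) (Num.sqrt (1 + 2 * (p%:R / (2 * (b - j./2)%:R))))^-1 <=
  \prod_(l < N./2) ((b - l)%:R / (b - l + p)%:R) :> R.
Proof.
pose F j : R := (Num.sqrt (1 + 2 * (p%:R / (2 * (b - j./2)%:R))))^-1.
have F01 j : 0 <= F j <= 1.
  rewrite invr_ge0 sqrtr_ge0 /= invf_le1 ?sqrtr_gt0; last first.
    by rewrite ltr_wpDr // mulr_ge0 // divr_ge0 // mulr_ge0.
  by rewrite -[leLHS]sqrtr1 ler_sqrt ?lerDl ?addr_ge0 // mulr_ge0 // divr_ge0 // mulr_ge0.
have F0 j : 0 <= F j by case/andP: (F01 j).
have pairs M : (M < b)%N -> F M.*2 * F M.*2.+1 = (b - M)%:R / (b - M + p)%:R.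
  move=> Mb; rewrite /F doubleK -[M.*2.+1./2]/(uphalf M.*2) uphalf_double.
  have bM : (b - M)%:R != 0 :> R by rewrite pnatr_eq0; lia.
  have bM0 : 0 < (b - M)%:R :> R by rewrite ltr0n; lia.
  rewrite -invfM -expr2 sqr_sqrtr; last by rewrite addr_ge0 // mulr_ge0 // divr_ge0 // mulr_ge0.
  rewrite natrD; field.
  rewrite bM /= gt_eqF //; have : 0 <= p%:R :> R by []. lra.
have even M : (M <= b)%N ->
    \prod_(j < M.*2) F j = \prod_(l < M) ((b - l)%:R / (b - l + p)%:R).
  elim: M => [|M IH] Mb; first by rewrite !big_ord0.
  by rewrite doubleS !big_ord_recr /= IH 1?ltnW // -mulrA pairs.
move=> Nb; rewrite -even; last by lia.
rewrite -[N in leLHS]odd_double_half addnC -(big_mkord xpredT F).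
rewrite -[leRHS](big_mkord xpredT F) (big_cat_nat (n := N./2.*2)) //= ?leq_addr //.
by rewrite ler_piMr ?prodr_ge0 // prodr_ile1.
Qed.

End Series.

(** * Exponential moment under the null law *)

Section NullUpper.
Variables (R : realType) (n : nat).
Notation tup := (n.-tuple (measurableTypeR R)).
Notation stdg := (std_gaussian R n).

(** With D = b - N2 the product equals b! (D + p)! / (D! (b + p)!). Dividing by p! produces a
    binomial coefficient, bounded by [binomial_term_le], over (b + p)!, which leaves terms of the
    exponential series at th / t, shifted by b. *)
Lemma term_bound (th t : R) (b N2 p : nat) : 0 < t < 1 -> 0 < th ->
  (N2 <= b)%N ->
  th ^+ p / p`!%:R * \prod_(l < N2) ((b - l)%:R / (b - l + p)%:R) <=
  (b`!%:R * (1 - t)^-1 ^+ (b - N2) * (t / th) ^+ b) *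
    ((th / t) ^+ (b + p) / (b + p)`!%:R).
Proof.
move=> t01 th0 Nb; have [t0 t1] := andP t01.
set D := (b - N2)%N; set P := \prod_(l < N2) _.
have nzf m : (m`!)%:R != 0 :> R by rewrite pnatr_eq0 -lt0n fact_gt0.
have PE : P = b`!%:R * (D + p)`!%:R / (D`!%:R * (b + p)`!%:R).
  have := prod_ratio R p Nb; rewrite -/P -/D !natrM => <-.
  by field; rewrite !nzf.
have CE : (D + p)`!%:R = 'C(D + p, p)%:R * (p`!%:R * D`!%:R) :> R.
  by rewrite -(bin_fact (leq_addl D p)) addnK !natrM.
have -> : th ^+ p / p`!%:R * P =
    b`!%:R * th ^+ p / (b + p)`!%:R * 'C(D + p, p)%:R.
  by rewrite PE CE; field; rewrite !nzf.
have -> : b`!%:R * (1 - t)^-1 ^+ D * (t / th) ^+ b *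
    ((th / t) ^+ (b + p) / (b + p)`!%:R) =
  b`!%:R * th ^+ p / (b + p)`!%:R * (t^-1 ^+ p * (1 - t)^-1 ^+ D).
  rewrite exprD [(th / t) ^+ p]exprMn.
  have -> : (t / th) ^+ b = ((th / t) ^+ b)^-1.
    by rewrite -exprVn invf_div.
  have h : (th / t) ^+ b != 0 by rewrite expf_neq0 // gt_eqF // divr_gt0.
  move: ((th / t) ^+ b) h (t^-1 ^+ p) ((1 - t)^-1 ^+ D) => x h y z.
  by field; rewrite h nzf.
apply: ler_wpM2l; last exact: binomial_term_le.
by rewrite divr_ge0 // mulr_ge0 // exprn_ge0 // ltW.
Qed.

(* Summing the moment bounds over the exponential series; the truncated product
   of chi-squared factors is a ratio of factorials, which absorbs 1 / p!. *)
Lemma null_exp_moment N c (b : nat) (t lam : R) u :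
  (N <= n)%N -> (N <= 2 * b)%N -> 0 < c -> 0 < t < 1 -> 0 < lam -> (0 < n)%N ->
  qform 1%:M u = n%:R ->
  (\int[iid_law stdg N]_Y
     ((allg (good_norm c (fun j => 2 * (b - j./2)%:R)) 0 1%:M Y)%:R *
       expR (lam / 2 * qform (gsseq 1%:M Y) u))%:E <=
   (b`!%:R * (1 - t)^-1 ^+ (b - N./2) * (2 * t / (lam * n%:R)) ^+ b *
     expR (lam * n%:R / 2 / t))%:E)%E.
Proof.
move=> Nn Nb c0 t01 lam0 n0 u2; have [t0 t1] := andP t01.
set M := (fun j => 2 * (b - j./2)%:R).
set th := lam * n%:R / 2.
have th0 : 0 < th by rewrite /th divr_gt0 // mulr_gt0 // ltr0n.
have -> : 2 * t / (lam * n%:R) = t / th.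
  by rewrite /th; field; rewrite pnatr_eq0 -lt0n n0 gt_eqF.
pose H (Y : sample R n N) : R := (allg (good_norm c M) 0 1%:M Y)%:R.
pose q (Y : sample R n N) : R := qform (gsseq 1%:M Y) u.
have H0 Y : 0 <= H Y by [].
have q0 Y : 0 <= q Y by rewrite qform_proj_ge0 //; apply: gsseq_proj; exact: proj1.
have mHq p : measurable_fun setT (fun Y => (H Y * q Y ^+ p)%:E).
  apply: (@measurable_allg_Psi _ _ (good_norm c M) _ (fun K => qform K u ^+ p)).
  - exact: measurable_good_norm.
  - by move=> d T K pK mK; apply: measurable_funX; exact: measurable_qform.
  - exact: proj1.
have cp0 p : 0 <= (lam / 2) ^+ p / p`!%:R.
  by rewrite divr_ge0 // exprn_ge0 // divr_ge0 // ltW.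
rewrite (eq_integral (fun Y => (\sum_(0 <= p <oo)
   ((((lam / 2) ^+ p / p`!%:R)%:E * (H Y * q Y ^+ p)%:E)))%E)); last first.
  move=> Y _; rewrite -/(H Y) -/(q Y) EFinM -expR_nneseries; last first.
    by rewrite mulr_ge0 // divr_ge0 // ltW.
  rewrite -nneseriesZl; last first.
    by move=> p _; rewrite lee_fin divr_ge0 // exprn_ge0 // mulr_ge0 // divr_ge0 // ltW.
  by apply: eq_eseriesr => p _; rewrite -!EFinM exprMn; congr EFin;
    move: (p`!%:R^-1) (q Y) => x z; ring.
rewrite integral_nneseries //; last 2 first.
- move=> p; apply: emeasurable_funM => //.
- by move=> p Y _; rewrite -EFinM lee_fin; apply: mulr_ge0 => //;
    apply: mulr_ge0 => //; exact: exprn_ge0.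
set B := b`!%:R * (1 - t)^-1 ^+ (b - N./2) * (t / th) ^+ b.
have B0 : 0 <= B.
  have h1 : 0 <= (1 - t)^-1 by rewrite invr_ge0 subr_ge0 ltW.
  have h2 : 0 <= t / th by rewrite divr_ge0 // ltW.
  by apply: mulr_ge0; [apply: mulr_ge0 => //|]; exact: exprn_ge0.
apply: (@le_trans _ _ (\sum_(0 <= p <oo)
    (B * ((th / t) ^+ (b + p) / (b + p)`!%:R))%:E)%E).
  apply: lee_nneseries.
    move=> p _ _; apply: integral_ge0 => Y _.
    by rewrite -EFinM lee_fin; apply: mulr_ge0 => //;
    apply: mulr_ge0 => //; exact: exprn_ge0.
  move=> p _; rewrite ge0_integralZl_EFin //; last first.
    by move=> Y _; rewrite lee_fin mulr_ge0 // exprn_ge0.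
  have M0 j : (j < N)%N -> 0 < M j by move=> jN; rewrite /M mulr_gt0 // ltr0n; lia.
  have := allg_norm_moment u p Nn c0 M0.
  move/(lee_wpmul2l (_ : (0 <= ((lam / 2) ^+ p / p`!%:R)%:E)%E)) => h.
  apply: (le_trans (h _)); first by rewrite lee_fin.
  rewrite -EFinM lee_fin u2.
  have Nb2 : (N./2 <= b)%N by lia.
  apply: le_trans (term_bound p t01 th0 Nb2).
  rewrite (_ : (lam / 2) ^+ p / p`!%:R * _ = th ^+ p / p`!%:R *
    \prod_(j < N) (Num.sqrt (1 + 2 * (p%:R / M j)))^-1); last first.
    have -> : th ^+ p = (lam / 2) ^+ p * n%:R ^+ p.
      by rewrite -exprMn; congr (_ ^+ p); rewrite /th; ring.
    move: (p`!%:R^-1) (\prod_(j < N) _) => x z; ring.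
  apply: ler_wpM2l; last exact: prod_sqrt_le.
  by rewrite divr_ge0 // exprn_ge0 // ltW.
apply: lime_le.
  apply: is_cvg_nneseries => p _ _; rewrite lee_fin mulr_ge0 //.
  by rewrite divr_ge0 // exprn_ge0 // divr_ge0 // ltW.
apply: nearW => m; rewrite sumEFin lee_fin -mulr_sumr ler_wpM2l //.
by apply: expR_tail_le; rewrite divr_ge0 // ltW.
Qed.

End NullUpper.

(** * The partition function under the null law *)

Section Partition.
Variables (R : realType) (n : nat).
Notation tup := (n.-tuple (measurableTypeR R)).
Notation stdg := (std_gaussian R n).

Lemma partition_functionE (lam : R) (K : 'M[R]_n) :
  partition_function (lam *: K) =
  \sum_(s : {ffun 'I_n -> bool}) expR (lam / 2 * qform K (spin R s)).
Proof.
apply: eq_bigr => s _; congr expR.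
by rewrite -/(qform (lam *: K) (spin R s)) qformZ; ring.
Qed.

Lemma partition_function_gt0 (J : 'M[R]_n) : 0 < partition_function J.
Proof.
rewrite /partition_function (bigD1 [ffun=> false]) //=.
by rewrite ltr_wpDr ?expR_gt0 // sumr_ge0 // => s _; exact: expR_ge0.
Qed.

Lemma spin_qform1 (s : {ffun 'I_n -> bool}) : qform 1%:M (spin R s) = n%:R.
Proof. by rewrite /qform mulmx1 spin_norm mxE eqxx mulr1n. Qed.

Lemma measurable_partition N (lam : R) : measurable_fun setT
  (fun Y : sample R n N => partition_function (lam *: gsseq 1%:M Y)).
Proof.
rewrite (_ : (fun Y => _) = fun Y : sample R n N =>
  \sum_(s : {ffun 'I_n -> bool}) expR (lam / 2 * qform (gsseq 1%:M Y) (spin R s))).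
  apply: measurable_sum => s; apply: measurableT_comp => //.
  apply: measurable_funM => //; apply: measurable_gsseq_qform; exact: proj1.
by apply/funext => Y; rewrite partition_functionE.
Qed.

Lemma prob_le_setD d (T : measurableType d) (P : probability T R) A B (a e : R) :
  measurable A -> measurable B -> (a%:E <= P A)%E ->
  (P (A `\` B) <= e%:E)%E -> ((a - e)%:E <= P B)%E.
Proof.
move=> mA mB PA PAB; rewrite EFinB leeBlDr //.
apply: (le_trans PA); apply: (@le_trans _ _ (P (B `|` A `\` B))).
  apply: le_measure; rewrite ?inE //.
    by apply: measurableU => //; exact: measurableD.
  by move=> Y AY; have [BY|BY] := pselect (B Y); [left|right].
apply: (le_trans (measureU2 _ _ _)) => //; first exact: measurableD.
by apply: leeD.
Qed.

(** First-moment method on the event of good norms: where ln Z > U the weight exp(- U) Z is at least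
    1, and the mean of Z splits into 2^n equal bounds because every spin has squared length n. *)
Lemma null_partition_upper N c (b : nat) (t lam s e U : R) :
  (N <= n)%N -> (N <= 2 * b)%N -> 0 < c -> 0 < t < 1 -> 0 < lam -> (0 < n)%N ->
  0 <= s <= 8^-1 -> 0 <= e <= 1 ->
  (forall j, (j < N)%N -> low_rate c (n - N) +
     expR ((n - j)%:R * (s + 2 * s ^+ 2) - s * (2 * (b - j./2)%:R)) <= e) ->
  (((1 - e) ^+ N - expR (- U) * (2 ^+ n * (b`!%:R * (1 - t)^-1 ^+ (b - N./2) *
      (2 * t / (lam * n%:R)) ^+ b * expR (lam * n%:R / 2 / t))))%:E <=
   iid_law stdg N [set Y : sample R n N |
     (ln (partition_function (lam *: gsseq 1%:M Y)) <= U)%R])%E.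
Proof.
move=> Nn Nb c0 t01 lam0 n0 s01 e01 He.
pose M := fun j => (2:R) * (b - j./2)%:R.
set Bd := b`!%:R * _ * _ * _.
pose A := [set Y : sample R n N | allg (good_norm c M) 0 1%:M Y].
have mA : measurable A.
  apply: measurable_allg_set; first exact: measurable_good_norm.
  exact: proj1.
have mlnZ := measurableT_comp (@measurable_ln R) (measurable_partition (N := N) lam).
apply: (@prob_le_setD _ _ _ A).
- exact: mA.
- by apply: measurable_bool_set; apply: measurable_fun_ler.
- exact: (@allg_norm_prob R n N c M s e).
pose H (Y : sample R n N) : R := (allg (good_norm c M) 0 1%:M Y)%:R.
pose g s' (Y : sample R n N) : R :=
  expR (lam / 2 * qform (gsseq 1%:M Y) (spin R s')).
have mH : measurable_fun setT H.
  rewrite (_ : H = \1_A); first exact: measurable_indic.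
  apply/funext => Y; rewrite indicE; congr (nat_of_bool _)%:R.
  by apply/idP/idP; rewrite inE.
have mg s' : measurable_fun setT (g s').
  apply: measurableT_comp => //; apply: measurable_funM => //.
  apply: measurable_gsseq_qform; exact: proj1.
apply: (@le_trans _ _ (\int[iid_law stdg N]_Y ((expR (- U))%:E *
   (\sum_(s' : {ffun 'I_n -> bool}) (H Y * g s' Y)%:E)))%E).
  apply: le_prob_integral.
  - by apply: measurableD => //; apply: measurable_bool_set; apply: measurable_fun_ler.
  - move=> Y; rewrite mule_ge0 ?lee_fin ?expR_ge0 // sume_ge0 // => s' _.
    by rewrite lee_fin mulr_ge0 // expR_ge0.
  - move=> Y [AY /= /negP]; rewrite -ltNge => UZ.
    rewrite sumEFin -EFinM lee_fin -mulr_sumr /H AY mul1r -partition_functionE.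
    rewrite -[X in _ <= _ * X]lnK ?posrE ?partition_function_gt0 //.
    by rewrite -expRD -[leLHS]expR0 ler_expR addrC subr_ge0 ltW.
rewrite ge0_integralZl_EFin ?expR_ge0 //; last 2 first.
- move=> Y _; rewrite sume_ge0 // => s' _.
  by rewrite lee_fin mulr_ge0 // expR_ge0.
- apply: emeasurable_sum => s'; apply/measurable_EFinP; exact: measurable_funM.
rewrite [leRHS]EFinM lee_wpmul2l ?lee_fin ?expR_ge0 //.
rewrite ge0_integral_sum //; last 2 first.
- by move=> s'; apply/measurable_EFinP; exact: measurable_funM.
- by move=> s' Y _; rewrite lee_fin mulr_ge0 // expR_ge0.
apply: (@le_trans _ _ (\sum_(s' : {ffun 'I_n -> bool}) Bd%:E)%E).
  apply: lee_sum => s' _; apply: null_exp_moment => //.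
  exact: spin_qform1.
by rewrite sumEFin sumr_const card_ffun card_bool card_ord -natrX mulr_natl.
Qed.

End Partition.

(** * Geometry of the planted samples *)

Section Planted.
Variables (R : realType) (n : nat).
Notation tup := (n.-tuple (measurableTypeR R)).

Definition dotp (v w : 'rV[R]_n) : R := (v *m w^T) 0 0.

Lemma dotpC v w : dotp v w = dotp w v.
Proof.
have E : v *m w^T = (w *m v^T)^T by rewrite trmx_mul trmxK.
by rewrite /dotp E mxE.
Qed.

Lemma dotpDl v v' w : dotp (v + v') w = dotp v w + dotp v' w.
Proof. by rewrite /dotp mulmxDl mxE. Qed.

Lemma dotpZl a v w : dotp (a *: v) w = a * dotp v w.
Proof. by rewrite /dotp -scalemxAl mxE. Qed.

Lemma qform1E v : qform 1%:M v = dotp v v.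
Proof. by rewrite /qform mulmx1. Qed.

(** With r = sqrt(1 + beta) and a spin x this is the square root of the spiked covariance, so
    planted samples are null samples multiplied by it. *)
Definition spike (r : R) (x : 'rV[R]_n) : 'M[R]_n :=
  1%:M + ((r - 1) / n%:R) *: (x^T *m x).

Lemma mulmx_spike r x b : b *m spike r x = b + ((r - 1) / n%:R * dotp b x) *: x.
Proof.
rewrite /spike mulmxDr mulmx1 -scalemxAr mulmxA [b *m x^T]mx11E mul_scalar_mx.
by rewrite scalerA.
Qed.

Lemma row_of_lin (A : 'M[R]_n) (t : tup) : row_of (lin_tuple A t) = row_of t *m A.
Proof. by apply/rowP => j; rewrite mxE tnth_map tnth_ord_tuple. Qed.

Lemma row_sample_mx N (Y : sample R n N) i : row i (sample_mx Y) = row_of (tnth Y i).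
Proof. by apply/rowP => j; rewrite !mxE. Qed.

Lemma sample_mx_lin N (A : 'M[R]_n) (Y : sample R n N) :
  sample_mx ([the sample R n N of map (lin_tuple A) Y]) = sample_mx Y *m A.
Proof.
apply/row_matrixP => i; rewrite row_mul !row_sample_mx tnth_map.
exact: row_of_lin.
Qed.

Lemma gsseq_sample_kill N (Y : sample R n N) : sample_mx Y *m gsseq 1%:M Y = 0.
Proof.
apply/row_matrixP => i; rewrite row_mul row_sample_mx row0.
by apply: gsseq_kill; [exact: proj1|exact: mem_tnth].
Qed.

Lemma gsseq_sample_span N (Y : sample R n N) :
  (1%:M - gsseq 1%:M Y <= sample_mx Y)%MS.
Proof.
apply: gsseq_span; first by rewrite subrr sub0mx.
by move=> t /tnthP[i ->]; rewrite -row_sample_mx row_sub.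
Qed.

(* If z = b + (r-1) <b,x>/n x is the projection of x on the span of the
   planted samples, with b in the span of the null samples, then
   |z|^2 = <z,x> = r <b,x>, while n |z|^2 >= kap <b,x>^2. *)
Lemma planted_kernel N (Y : sample R n N) (x : 'rV[R]_n) (r kap : R) :
  (0 < n)%N -> 0 < kap -> dotp x x = n%:R ->
  kap * n%:R <= qform (gsseq 1%:M Y) x ->
  n%:R - r ^+ 2 * n%:R / kap <=
    qform (gsseq 1%:M [the sample R n N of map (lin_tuple (spike r x)) Y]) x.
Proof.
move=> n0 kap0 xx Hk; pose Y' := [the sample R n N of map (lin_tuple (spike r x)) Y].
rewrite -/Y'.
have nR : 0 < n%:R :> R by rewrite ltr0n.
set K := gsseq 1%:M Y; set K' := gsseq 1%:M Y'.
have pK : proj K by apply: gsseq_proj; exact: proj1.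
have pK' : proj K' by apply: gsseq_proj; exact: proj1.
have [a Ea] : exists a, x *m (1%:M - K') = a *m sample_mx Y *m spike r x.
  have /submxP [a Ea] : (x *m (1%:M - K') <= sample_mx Y')%MS.
    exact: submx_trans (submxMl _ _) (gsseq_sample_span _).
  by exists a; rewrite Ea sample_mx_lin mulmxA.
set b := a *m sample_mx Y in Ea.
have bK : b *m K = 0 by rewrite /b -mulmxA gsseq_sample_kill mulmx0.
set z := x *m (1%:M - K') in Ea.
have zz : dotp z z = dotp z x.
  have [tP PP] := proj_compl pK'.
  by rewrite /dotp /z trmx_mul tP mulmxA -[in LHS](mulmxA x) PP.
have zE : z = b + ((r - 1) / n%:R * dotp b x) *: x by rewrite Ea mulmx_spike.
set be := dotp b x in zE.
have zx : dotp z x = r * be.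
  by rewrite zE dotpDl dotpZl xx -/be; field; rewrite gt_eqF.
have zz2 : dotp z z = dotp b b + (r ^+ 2 - 1) * be ^+ 2 / n%:R.
  rewrite [in X in dotp X]zE dotpDl dotpZl dotpC zE dotpDl dotpZl.
  rewrite (dotpC x b) -/be (dotpC x (b + _)) dotpDl dotpZl xx -/be.
  by field; rewrite gt_eqF.
have cs : be ^+ 2 <= dotp b b * (n%:R - qform K x).
  have pC := proj_compl pK; have := cauchy_proj b x pC.
  have -> : qform (1%:M - K) b = dotp b b.
    by rewrite qformD qformN qform1E /qform bK mul0mx mxE subr0.
  have -> : qform (1%:M - K) x = n%:R - qform K x.
    by rewrite qformD qformN qform1E xx.
  by rewrite mulmxBr mulmx1 bK subr0.
have qK' : qform K' x = n%:R - dotp z z.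
  by rewrite zz /dotp -/(qform _ _) /z -/(qform (1%:M - K') x) qformD qformN qform1E xx opprB addrC subrK.
rewrite qK' lerD2l lerN2.
have bb0 : 0 <= dotp b b by rewrite -qform1E qform1_ge0.
set w := dotp z z in zz zz2 *.
have w0 : 0 <= w by rewrite /w -qform1E qform1_ge0.
(* Here n w = n |b|^2 - be^2 + r^2 be^2, and [cs] gives be^2 <= (1 - kap) n |b|^2, so that n |b|^2 -
   be^2 >= kap n |b|^2 >= kap be^2. *)
have nw : kap * be ^+ 2 <= n%:R * w.
  have -> : n%:R * w = n%:R * dotp b b + (r ^+ 2 - 1) * be ^+ 2.
    by rewrite zz2; field; rewrite gt_eqF.
  have h1 : be ^+ 2 <= dotp b b * n%:R * (1 - kap).
    apply: (le_trans cs); rewrite -mulrA ler_wpM2l //; lra.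
  have h0 : 0 <= dotp b b * n%:R by rewrite mulr_ge0 // ltW.
  have h2 : be ^+ 2 <= dotp b b * n%:R.
    by apply: (le_trans h1); rewrite ler_piMr //; lra.
  have : kap * be ^+ 2 <= kap * (dotp b b * n%:R) by rewrite ler_wpM2l // ltW.
  have : 0 <= r ^+ 2 * be ^+ 2 by rewrite mulr_ge0 // sqr_ge0.
  lra.
have wr : w = r * be by rewrite zz zx.
have [w00|wn0] := eqVneq w 0.
  by rewrite w00; apply: divr_ge0; [apply: mulr_ge0 => //; exact: sqr_ge0|exact: ltW].
have wp : 0 < w by rewrite lt_def wn0.
(* As w = r be, kap w^2 = r^2 kap be^2 <= r^2 n w, and w > 0 cancels. *)
rewrite ler_pdivlMr // -(ler_pM2r wp).
have : r ^+ 2 * (kap * be ^+ 2) <= r ^+ 2 * (n%:R * w) by rewrite ler_wpM2l // sqr_ge0.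
have -> : w * kap * w = r ^+ 2 * (kap * be ^+ 2) by rewrite wr; ring.
by rewrite (_ : r ^+ 2 * n%:R * w = r ^+ 2 * (n%:R * w)) //; ring.
Qed.

End Planted.

(** * The mean-field lower bound *)

Section MeanField.
Variables (R : realType) (n : nat).

(** Entropy, in natural logarithms, of a random sign of mean rho. *)
Definition entropy (rho : R) : R :=
  - ((1 + rho) / 2 * ln ((1 + rho) / 2) + (1 - rho) / 2 * ln ((1 - rho) / 2)).

Variables (s : {ffun 'I_n -> bool}) (rho : R).
Hypothesis rho1 : -1 < rho < 1.

(** Law of one coordinate of the product measure; b records whether it disagrees with s. *)
Let w (b : bool) : R := if b then (1 - rho) / 2 else (1 + rho) / 2.
Let mu (t : {ffun 'I_n -> bool}) : R := \prod_i w (t i (+) s i).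

Let w_gt0 b : 0 < w b.
Proof. by have /andP[r1 r2] := rho1; rewrite /w; case: b; lra. Qed.

Let mean_prod (f : 'I_n -> bool -> R) :
  \sum_t mu t * \prod_i f i (t i) = \prod_i \sum_b w (b (+) s i) * f i b.
Proof.
rewrite bigA_distr_bigA /=; apply: eq_bigr => t _.
by rewrite -big_split.
Qed.

Let w_sum i : \sum_b w (b (+) s i) = 1.
Proof. by rewrite big_bool /w; case: (s i) => /=; field. Qed.

Let mu_sum : \sum_t mu t = 1.
Proof.
transitivity (\sum_t mu t * \prod_i (fun _ _ => 1) i (t i)).
  by apply: eq_bigr => t _; rewrite big1 ?mulr1.
rewrite (mean_prod (fun _ _ => 1)) big1 // => i _.
by rewrite -[RHS](w_sum i); apply: eq_bigr => b _; rewrite mulr1.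
Qed.

Let mean1 i (g : bool -> R) :
  \sum_t mu t * g (t i) = \sum_b w (b (+) s i) * g b.
Proof.
pose f j b := if j == i then g b else 1.
transitivity (\sum_t mu t * \prod_j f j (t j)).
  apply: eq_bigr => t _; congr (_ * _).
  rewrite (bigD1 i) //= {1}/f eqxx big1 ?mulr1 // => j /negbTE ji.
  by rewrite /f ji.
rewrite mean_prod (bigD1 i) //= [X in _ * X]big1 ?mulr1.
  by apply: eq_bigr => b _; rewrite /f eqxx.
move=> j /negbTE ji; rewrite -[RHS](w_sum j).
by apply: eq_bigr => b _; rewrite /f ji mulr1.
Qed.

Let mean2 i j (g h : bool -> R) : i != j ->
  \sum_t mu t * (g (t i) * h (t j)) =
  (\sum_b w (b (+) s i) * g b) * (\sum_b w (b (+) s j) * h b).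
Proof.
move=> ij; have ji : (j == i) = false by rewrite eq_sym (negbTE ij).
pose f k b := if k == i then g b else if k == j then h b else 1.
transitivity (\sum_t mu t * \prod_k f k (t k)).
  apply: eq_bigr => t _; congr (_ * _).
  rewrite (bigD1 i) //= (bigD1 j) ?ji //= [X in _ * (_ * X)]big1 ?mulr1.
    by rewrite /f eqxx ji eqxx.
  by move=> k /andP[/negbTE ki /negbTE kj]; rewrite /f ki kj.
rewrite mean_prod (bigD1 i) //= (bigD1 j) ?ji //= [X in _ * (_ * X)]big1 ?mulr1.
  by congr (_ * _); apply: eq_bigr => b _; rewrite /f ?ji eqxx.
move=> k /andP[/negbTE ki /negbTE kj]; rewrite -[RHS](w_sum k).
by apply: eq_bigr => b _; rewrite /f ki kj mulr1.
Qed.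

Let mean_spin i : \sum_b w (b (+) s i) * (-1) ^+ b = rho * (-1) ^+ s i.
Proof. by rewrite big_bool /w; case: (s i) => /=; rewrite ?expr0 ?expr1; field. Qed.

(** Distinct coordinates are independent signs of mean rho times that of s; on the diagonal the
    square of a sign is 1, whence the trace term. *)
Let mean_qform (K : 'M[R]_n) :
  \sum_t mu t * qform K (spin R t) =
  rho ^+ 2 * qform K (spin R s) + (1 - rho ^+ 2) * \tr K.
Proof.
have qE t : qform K (spin R t) =
    \sum_i \sum_j K i j * ((-1) ^+ t i * (-1) ^+ t j).
  rewrite /qform mxE exchange_big /=; apply: eq_bigr => j _.
  rewrite !mxE mulr_suml; apply: eq_bigr => i _.
  by rewrite !mxE; ring.
under eq_bigr do rewrite qE mulr_sumr.
rewrite exchange_big /= qE mulr_sumr mulr_sumr -big_split /=.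
apply: eq_bigr => i _.
under eq_bigr do rewrite mulr_sumr.
rewrite exchange_big /= (bigD1 i) //= [in RHS](bigD1 i) //=.
have -> : \sum_t mu t * (K i i * ((-1) ^+ t i * (-1) ^+ t i)) = K i i.
  under eq_bigr do rewrite -expr2 sqrr_sign mulr1.
  by rewrite -mulr_suml mu_sum mul1r.
rewrite -expr2 sqrr_sign mulr1 mulrDr mulr_sumr.
rewrite (eq_bigr (fun j => rho ^+ 2 * (K i j * ((-1) ^+ s i * (-1) ^+ s j)))).
  by ring.
move=> j ji; under eq_bigr do rewrite mulrCA.
rewrite -mulr_sumr (mean2 (fun b => (-1) ^+ b) (fun b => (-1) ^+ b)) 1?eq_sym //.
by rewrite !mean_spin; ring.
Qed.

Let mean_ln : \sum_t mu t * ln (mu t) = - n%:R * entropy rho.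
Proof.
have lnE t : ln (mu t) = \sum_i ln (w (t i (+) s i)).
  rewrite -[RHS]expRK expR_sum; congr ln; apply: eq_bigr => i _.
  by rewrite lnK // posrE w_gt0.
under eq_bigr do rewrite lnE mulr_sumr.
rewrite exchange_big /=.
under eq_bigr => i _.
  rewrite (mean1 i (fun b => ln (w (b (+) s i)))).
  rewrite (_ : \sum_b _ = - entropy rho); last first.
    by rewrite big_bool /entropy /w; case: (s i) => /=; ring.
  over.
by rewrite sumr_const card_ord -[LHS]mulr_natl mulNr mulrN.
Qed.

(* Gibbs variational principle for the product measure of mean [rho * s]. *)
Lemma mean_field (lam : R) (K : 'M[R]_n) : 0 <= lam -> proj K ->
  n%:R * entropy rho + lam / 2 * rho ^+ 2 * qform K (spin R s) <=
  ln (partition_function (lam *: K)).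
Proof.
move=> lam0 pK; rewrite partition_functionE.
have mu_gt0 t : 0 < mu t by apply: prodr_gt0.
pose G t := lam / 2 * qform K (spin R t) - ln (mu t).
pose c := \sum_t mu t * G t.
have cE : c = lam / 2 * (rho ^+ 2 * qform K (spin R s) + (1 - rho ^+ 2) * \tr K) +
    n%:R * entropy rho.
  rewrite /c -mean_qform mulr_sumr -[X in _ + X]opprK -mulNr -mean_ln -sumrB.
  by apply: eq_bigr => t _; rewrite /G; ring.
(* Jensen's inequality through the tangent line exp G >= exp c (1 + G - c), whose mean under mu is
   exp c. *)
have Zc : expR c <= \sum_t expR (lam / 2 * qform K (spin R t)).
  apply: (@le_trans _ _ (\sum_t mu t * (expR c * (1 + (G t - c))))).
    under eq_bigr do rewrite mulrCA mulrDr mulr1 mulrBr.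
    rewrite -mulr_sumr big_split /= sumrB -mulr_suml mu_sum mul1r.
    by rewrite -/c subrr addr0 mulr1.
  apply: ler_sum => t _.
  have -> : expR (lam / 2 * qform K (spin R t)) = mu t * expR (G t).
    by rewrite -[mu t in RHS]lnK ?posrE // -expRD /G addrC subrK.
  have -> : expR (G t) = expR c * expR (G t - c).
    by rewrite -expRD; congr expR; ring.
  by rewrite !ler_pM2l ?expR_gt0 // expR_ge1Dx.
have Z0 : 0 < \sum_t expR (lam / 2 * qform K (spin R t)).
  exact: lt_le_trans (expR_gt0 _) Zc.
apply: (@le_trans _ _ c); last by rewrite -[leLHS]expRK ler_ln ?posrE ?expR_gt0.
rewrite cE addrC lerD2r -mulrA ler_wpM2l //; first by rewrite divr_ge0.
rewrite lerDl proj_trace //; apply: mulr_ge0 => //.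
by have /andP[r1 r2] := rho1; nra.
Qed.
End MeanField.

(** * Transfer to the Wishart laws *)

Section Laws.
Variables (R : realType) (n : nat).
Notation stdg := (std_gaussian R n).

Lemma wishart_null_std N (A : set (sample R n N)) : measurable A ->
  wishart_null R n N A = iid_law stdg N A.
Proof.
move=> mA; rewrite /wishart_null /gaussian iid_law_distribution //.
have -> : psd_sqrt 1%:M = 1%:M :> 'M[R]_n.
  apply: psd_sqrtE; last by rewrite mulmx1.
  by split=> [|v]; [rewrite trmx1|rewrite mulmx1 rv_norm_ge0].
congr (iid_law stdg N _); apply/funext => Y; congr (A _); apply/val_inj => /=.
rewrite -[RHS]map_id; apply: eq_map => t.
apply: eq_from_tnth => j; rewrite tnth_map tnth_ord_tuple mulmx1.
by rewrite mxE.
Qed.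

Lemma wishart_given_std N (beta : R) s (A : set (sample R n N)) :
  measurable A -> -1 <= beta ->
  wishart_given N beta s A = iid_law stdg N [set Y : sample R n N | A
    [the sample R n N of
     map (lin_tuple (spike (Num.sqrt (1 + beta)) (spin R s))) Y]].
Proof.
move=> mA b1; rewrite /wishart_given /gaussian iid_law_distribution //.
by rewrite (psd_sqrt_spiked_cov s b1).1.
Qed.

(** The bound holds for each hidden spin, hence for the average. For a given spin,
    [null_kernel_lower] feeds [planted_kernel] with r^2 = 1 + beta, and the resulting value of x K
    x^T feeds [mean_field]. *)
Lemma planted_partition_lower N (beta lam rho U c kap e : R) (a : nat) :
  (N <= n)%N -> (0 < n)%N -> 0 < c -> 8 * a%:R <= c -> 0 < kap -> 0 <= e <= 1 ->
  low_rate c (n - N) + Num.sqrt 2 * expR (- c / 8) <= e ->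
  -1 <= beta -> 0 <= lam -> -1 < rho < 1 ->
  U <= n%:R * entropy rho +
       lam / 2 * rho ^+ 2 * (n%:R - (1 + beta) * n%:R / kap) ->
  (((1 - e) ^+ N - kap ^+ a * Num.sqrt 2 ^+ N)%:E <=
   wishart_planted beta [set Y : sample R n N |
     (U <= ln (partition_function (lam *: gsseq 1%:M Y)))%R])%E.
Proof.
move=> Nn n0 c0 ac kap0 e01 He b1 lam0 rho1 HU.
have mlnZ := measurableT_comp (@measurable_ln R) (measurable_partition (N := N) lam).
set p := (_ - _); set A := [set Y | _].
have mA : measurable A.
  by apply: measurable_bool_set; apply: measurable_fun_ler.
have PA s : (p%:E <= wishart_given N beta s A)%E.
  rewrite wishart_given_std //.
  have k0 : 0 < qform 1%:M (spin R s) by rewrite spin_qform1 ltr0n.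
  apply: (le_trans (null_kernel_lower Nn c0 ac kap0 e01 He k0)).
  apply: le_iid_law => Y /=; rewrite spin_qform1 => HY.
  apply: (le_trans HU); rewrite /A /=.
  apply: le_trans (mean_field s rho1 lam0 _); last first.
    by apply: gsseq_proj; exact: proj1.
  have h : 0 <= lam / 2 * rho ^+ 2 by rewrite mulr_ge0 ?sqr_ge0 // divr_ge0.
  rewrite lerD2l ler_wpM2l //.
  have r2 : 1 + beta = Num.sqrt (1 + beta) ^+ 2 by rewrite sqr_sqrtr //; lra.
  rewrite {1}r2; apply: planted_kernel => //.
  by rewrite -qform1E spin_qform1.
rewrite /wishart_planted.
apply: (@le_trans _ _ (((2 ^+ n)^-1)%:E *
    \sum_(s : {ffun 'I_n -> bool}) p%:E)%E).
  rewrite sumEFin sumr_const card_ffun card_bool card_ord -EFinM lee_fin.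
  by rewrite -[p *+ _]mulr_natl natrX mulrA mulVf ?mul1r // expf_neq0.
apply: lee_wpmul2l; first by rewrite lee_fin invr_ge0 exprn_ge0.
by apply: lee_sum => s _.
Qed.
End Laws.

(** * Timed correctness of programs *)

Section Exec.
Variable R : realType.
Implicit Types (s : state R) (c : cmd) (K : seq cmd).
Variable w : nat -> R.

(* The cost [t] is an upper bound. *)
Definition exec c s s' (t : nat) :=
  exists2 t0, (t0 <= t)%N &
    forall K, iter t0 (step w) (c :: K, s) = (K, s').

(** Total correctness with a time budget, on the fixed tape w. *)
Definition triple (P : state R -> Prop) c t (Q : state R -> Prop) :=
  forall s, P s -> exists2 s', Q s' & exec c s s' t.

Lemma iter_add (T : Type) (f : T -> T) m k x : iter (m + k) f x = iter k f (iter m f x).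
Proof. by rewrite addnC iterD. Qed.

Lemma triple_weaken P c t Q P' t' Q' : triple P c t Q ->
  (forall s, P' s -> P s) -> (t <= t')%N -> (forall s, Q s -> Q' s) ->
  triple P' c t' Q'.
Proof.
move=> H PP tt QQ s /PP /H [s' /QQ Qs [t0 t0t E]].
by exists s' => //; exists t0 => //; exact: leq_trans tt.
Qed.

Lemma triple_nset P Q i e : (forall s, P s -> Q (nset s i (neval s e))) ->
  triple P (NSet i e) 1 Q.
Proof. by move=> PQ s /PQ Qs; eexists; first exact: Qs; exists 1%N. Qed.

Lemma triple_rset P Q a i j e :
  (forall s, P s -> Q (rset s a (neval s i) (neval s j) (reval s e))) ->
  triple P (RSet a i j e) 1 Q.
Proof. by move=> PQ s /PQ Qs; eexists; first exact: Qs; exists 1%N. Qed.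

Lemma triple_pre P c t Q P' : triple P c t Q -> (forall s, P' s -> P s) ->
  triple P' c t Q.
Proof. by move=> H PP s /PP /H. Qed.

Lemma triple_seq P Q S c1 c2 t1 t2 : triple P c1 t1 Q -> triple Q c2 t2 S ->
  triple P (Seq c1 c2) (t1 + t2).+1 S.
Proof.
move=> H1 H2 s /H1 [s1 /H2 [s2 Ss [u2 u2t E2]] [u1 u1t E1]].
exists s2 => //; exists (u1 + u2).+1; first by rewrite ltnS leq_add.
by move=> K; rewrite iterSr /= iter_add E1 E2.
Qed.

Lemma triple_if P Q b c1 c2 t : triple (fun s => P s /\ beval s b) c1 t Q ->
  triple (fun s => P s /\ ~~ beval s b) c2 t Q -> triple P (If b c1 c2) t.+1 Q.
Proof.
move=> H1 H2 s Ps; case: (boolP (beval s b)) => bs.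
  have [s' Qs [u ut E]] := H1 s (conj Ps bs).
  by exists s' => //; exists u.+1 => // K; rewrite iterSr /= bs E.
have [s' Qs [u ut E]] := H2 s (conj Ps bs).
by exists s' => //; exists u.+1 => // K; rewrite iterSr /= (negbTE bs) E.
Qed.

Definition for_loop i (b : nexp) c :=
  Seq (NSet i (NCst 0))
    (While (BNlt (NVar i) b) (Seq c (NSet i (NAdd (NVar i) (NCst 1))))).

Definition for_time m t := (m * t.+3).+3.

(** The body leaves the counter at j but establishes the invariant as it will read after the
    increment. A round adds 3 steps to the body: the test, the unfolding of [Seq], the increment.
    The outer [Seq], the initialization and the failing test make up the final 3. *)
Lemma triple_for (Inv : nat -> state R -> Prop) i b c m t :
  (forall j s, Inv j s -> neval s b = m /\ nvar s i = j) ->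
  (forall j, (j < m)%N -> triple (Inv j) c t
     (fun s => nvar s i = j /\ Inv j.+1 (nset s i j.+1))) ->
  triple (fun s => Inv 0%N (nset s i 0)) (for_loop i b c) (for_time m t) (Inv m).
Proof.
move=> Hb Hc; rewrite -[for_time m t]/(1 + (m * t.+3).+1).+1.
apply: (@triple_seq _ (Inv 0%N)); first exact: triple_nset.
suff H k : (k <= m)%N -> triple (Inv (m - k)%N)
    (While (BNlt (NVar i) b) (Seq c (NSet i (NAdd (NVar i) (NCst 1)))))
    (k * t.+3).+1 (Inv m).
  by have := H m (leqnn m); rewrite subnn.
elim: k => [_|k IH km] s Is.
  rewrite subn0 in Is; exists s => //; exists 1%N => // K.
  by rewrite /= (Hb _ _ Is).1 (Hb _ _ Is).2 ltnn.
have jm : (m - k.+1 < m)%N by lia.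
have [s1 [s1i Is1] [u1 u1t E1]] := Hc _ jm s Is.
have e : ((m - k.+1).+1 = m - k)%N by lia.
rewrite e in Is1; have [s2 Is2 [u2 u2t E2]] := IH (ltnW km) _ Is1.
exists s2 => //; exists (u1 + u2.+1).+2; first by rewrite mulSn; lia.
move=> K; rewrite 2!iterSr /= (Hb _ _ Is).1 (Hb _ _ Is).2 jm /=.
rewrite iter_add E1 iterSr /= s1i addn1 e; exact: E2.
Qed.

(** An empty stack idles, so the budget t may exceed the halting time; with a continuation K the run
    has to be cut at the halting time t0. *)
Lemma run_append K1 s t : (iter t (step w) (K1, s)).1 = [::] ->
  exists2 t0, (t0 <= t)%N &
    forall K, iter t0 (step w) (K1 ++ K, s) = (K, (iter t (step w) (K1, s)).2).
Proof.
elim: t K1 s => [|t IH] K1 s; first by move=> /= ->; exists 0%N.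
case: K1 => [_|c K1].
  exists 0%N => // K /=; congr (_, _).
  have -> : iter t (step w) ([::], s) = ([::], s) by elim: t {IH} => //= t ->.
  by [].
rewrite iterSr; case E : (step w (c :: K1, s)) => [K2 s2] /IH [t0 t0t E0].
exists t0.+1 => // K; rewrite iterSr -E0; congr iter.
have : step w (c :: K1 ++ K, s) =
    ((step w (c :: K1, s)).1 ++ K, (step w (c :: K1, s)).2).
  by case: c {E} => //= b c; case: ifP.
by rewrite E.
Qed.

Lemma exec_run c s s' t : exec c s s' t ->
  run c w s t = ([::], s').
Proof.
move=> [t0 t0t E]; rewrite /run -(subnKC t0t) iter_add E.
by elim: (t - t0)%N => //= k ->.
Qed.

End Exec.

(** * Memory footprint of a command *)

Fixpoint nexp_bound (e : nexp) : nat :=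
  match e with
  | NCst _ => 0
  | NVar i => i.+1
  | NAdd e1 e2 | NSub e1 e2 => maxn (nexp_bound e1) (nexp_bound e2)
  end.

Fixpoint rexp_bound (e : rexp) : nat :=
  match e with
  | RCst _ => 0
  | RNat m => nexp_bound m
  | RGet a i j => maxn a.+1 (maxn (nexp_bound i) (nexp_bound j))
  | RAdd e1 e2 | RSub e1 e2 | RMul e1 e2 | RDiv e1 e2 =>
      maxn (rexp_bound e1) (rexp_bound e2)
  | RSqrt e1 | RExp e1 | RLn e1 => rexp_bound e1
  end.

Fixpoint bexp_bound (e : bexp) : nat :=
  match e with
  | BNlt e1 e2 => maxn (nexp_bound e1) (nexp_bound e2)
  | BRlt e1 e2 => maxn (rexp_bound e1) (rexp_bound e2)
  | BNot e1 => bexp_bound e1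
  | BAnd e1 e2 => maxn (bexp_bound e1) (bexp_bound e2)
  end.

(** One bound for variable and array indices alike: neither reaches it, so the test can keep its own
    data from there on. *)
Fixpoint cmd_bound (c : cmd) : nat :=
  match c with
  | Skip => 0
  | NSet i e => maxn i.+1 (nexp_bound e)
  | RSet a i j e =>
      maxn a.+1 (maxn (nexp_bound i) (maxn (nexp_bound j) (rexp_bound e)))
  | Draw a i j => maxn a.+1 (maxn (nexp_bound i) (nexp_bound j))
  | Seq c1 c2 => maxn (cmd_bound c1) (cmd_bound c2)
  | If b c1 c2 => maxn (bexp_bound b) (maxn (cmd_bound c1) (cmd_bound c2))
  | While b c1 => maxn (bexp_bound b) (cmd_bound c1)
  end.

Section Frame.
Variables (R : realType) (B : nat) (w : nat -> R).
Implicit Types (s : state R).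

Definition sim s s' :=
  [/\ forall x, (x < B)%N -> nvar s x = nvar s' x,
      forall a, (a < B)%N -> rarr s a = rarr s' a & drawn s = drawn s'].

Lemma neval_sim e s s' : sim s s' -> (nexp_bound e <= B)%N -> neval s e = neval s' e.
Proof.
move=> [Hn _ _]; elim: e => [//|i|e1 IH1 e2 IH2|e1 IH1 e2 IH2] /=.
- by move=> iB; exact: Hn.
- by rewrite geq_max => /andP[/IH1 -> /IH2 ->].
- by rewrite geq_max => /andP[/IH1 -> /IH2 ->].
Qed.

Lemma reval_sim e s s' : sim s s' -> (rexp_bound e <= B)%N -> reval s e = reval s' e.
Proof.
move=> S; have [_ Ha _] := S; elim: e => //=.
- by move=> m mB; rewrite (neval_sim S).
- move=> a i j; rewrite !geq_max => /and3P[aB iB jB].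
  by rewrite Ha // !(neval_sim S).
- by move=> e1 IH1 e2 IH2; rewrite geq_max => /andP[/IH1 -> /IH2 ->].
- by move=> e1 IH1 e2 IH2; rewrite geq_max => /andP[/IH1 -> /IH2 ->].
- by move=> e1 IH1 e2 IH2; rewrite geq_max => /andP[/IH1 -> /IH2 ->].
- by move=> e1 IH1 e2 IH2; rewrite geq_max => /andP[/IH1 -> /IH2 ->].
- by move=> e IH /IH ->.
- by move=> e IH /IH ->.
- by move=> e IH /IH ->.
Qed.

Lemma beval_sim e s s' : sim s s' -> (bexp_bound e <= B)%N -> beval s e = beval s' e.
Proof.
move=> S; elim: e => /=.
- by move=> e1 e2; rewrite geq_max => /andP[h1 h2]; rewrite !(neval_sim S).
- by move=> e1 e2; rewrite geq_max => /andP[h1 h2]; rewrite !(reval_sim S).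
- by move=> e IH /IH ->.
- by move=> e1 IH1 e2 IH2; rewrite geq_max => /andP[/IH1 -> /IH2 ->].
Qed.

Lemma sim_nset s s' i v : sim s s' -> sim (nset s i v) (nset s' i v).
Proof. by move=> [Hn Ha Hd]; split=> //= x xB; case: eqP => // _; exact: Hn. Qed.

Lemma sim_rset s s' a i j v : (a < B)%N -> sim s s' ->
  sim (rset s a i j v) (rset s' a i j v).
Proof.
move=> aB [Hn Ha Hd]; split=> //= a' a'B.
by apply/funext => i'; apply/funext => j'; rewrite Ha.
Qed.

Lemma sim_step K s s' : sim s s' -> all (fun c => cmd_bound c <= B)%N K ->
  [/\ (step w (K, s)).1 = (step w (K, s')).1,
      sim (step w (K, s)).2 (step w (K, s')).2,
      all (fun c => cmd_bound c <= B)%N (step w (K, s)).1 &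
      forall x, (B <= x)%N -> nvar (step w (K, s)).2 x = nvar s x].
Proof.
move=> S; case: K => [//|c K] /= /andP[].
case: c => [|i e|a i j e|a i j|c1 c2|b c1 c2|b c1] /=.
- by [].
- rewrite geq_max => /andP[iB eB] KB; rewrite (neval_sim S eB); split=> //.
    exact: sim_nset.
  by move=> x Bx /=; case: eqP => // xi; lia.
- rewrite !geq_max => /and4P[aB iB jB eB] KB.
  rewrite !(neval_sim S) // (reval_sim S eB); split=> //.
  exact: sim_rset.
- rewrite !geq_max => /and3P[aB iB jB] KB.
  rewrite !(neval_sim S) //; have [_ _ d] := S; rewrite d; split=> //.
  by have [H1 H2 H3] := sim_rset (neval s' i) (neval s' j) (w (drawn s')) aB S;
     split=> //=; rewrite d.
- by rewrite geq_max => /andP[c1B c2B] KB; split=> //=; rewrite c1B c2B.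
- rewrite !geq_max => /and3P[bB c1B c2B] KB; rewrite (beval_sim S bB).
  by split=> //=; case: ifP; rewrite KB ?c1B ?c2B.
- rewrite geq_max => /andP[bB cB] KB; rewrite (beval_sim S bB).
  by case: ifP => _; split=> //=; rewrite ?geq_max ?cB ?bB.
Qed.

Lemma sim_iter t K s s' : sim s s' -> all (fun c => cmd_bound c <= B)%N K ->
  [/\ (iter t (step w) (K, s)).1 = (iter t (step w) (K, s')).1,
      sim (iter t (step w) (K, s)).2 (iter t (step w) (K, s')).2 &
      forall x, (B <= x)%N -> nvar (iter t (step w) (K, s)).2 x = nvar s x].
Proof.
elim: t K s s' => [//|t IH] K s s' S KB.
have [E1 S1 A1 N1] := sim_step S KB; rewrite !iterSr.
case: (step w (K, s)) E1 S1 A1 N1 => K1 s1 E1 S1 A1 N1.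
case: (step w (K, s')) E1 S1 => K2 s2 /= <- S1.
have [E2 S2 N2] := IH K1 s1 s2 S1 A1; split=> // x Bx.
by rewrite N2 // N1.
Qed.

(** The approximator runs as a subroutine in a memory that holds the data of the test. Below B it
    cannot tell this memory from a fresh [load], and it leaves the variables from B on alone. *)
Lemma exec_sim c s s' t : sim s s' -> (cmd_bound c <= B)%N ->
  (run c w s' t).1 = [::] ->
  exists s1, [/\ exec w c s s1 t, sim s1 (run c w s' t).2 &
    forall x, (B <= x)%N -> nvar s1 x = nvar s x].
Proof.
move=> S cB; rewrite /run => H.
have cB' : all (fun c => cmd_bound c <= B)%N [:: c] by rewrite /= cB.
have [E1 S1 N1] := sim_iter t S cB'; rewrite H in E1.
have [t0 t0t E] := run_append E1.
by exists (iter t (step w) ([:: c], s)).2; split=> //; exists t0.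
Qed.

End Frame.

(** * The Gram-Schmidt program and its correctness *)

Section Program.
(* Indices from [B] on are not used by the approximator. [vn] keeps n, [aK] holds
   the current projection K, [aV] the row y_l K and [aS] the number y_l K y_l^T. *)
Variable B : nat.
Notation vn := B. Notation vi := B.+1. Notation vj := B.+2. Notation vl := B.+3.
Notation aK := B. Notation aV := B.+1. Notation aS := B.+2.
Notation dim := (NVar 1).

(** Writing the diagonal is enough, as [load] leaves this array zero. *)
Definition gs_init : cmd :=
  for_loop vi dim (RSet aK (NVar vi) (NVar vi) (RCst 1)).

Definition gs_row : cmd :=
  for_loop vj dim
    (Seq (RSet aV (NCst 0) (NVar vj) (RCst 0))
      (for_loop vi dim
        (RSet aV (NCst 0) (NVar vj)
          (RAdd (RGet aV (NCst 0) (NVar vj))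
             (RMul (RGet 0 (NVar vl) (NVar vi)) (RGet aK (NVar vi) (NVar vj))))))).

Definition gs_norm : cmd :=
  Seq (RSet aS (NCst 0) (NCst 0) (RCst 0))
    (for_loop vj dim
      (RSet aS (NCst 0) (NCst 0)
        (RAdd (RGet aS (NCst 0) (NCst 0))
          (RMul (RGet aV (NCst 0) (NVar vj)) (RGet 0 (NVar vl) (NVar vj)))))).

Definition gs_update : cmd :=
  for_loop vi dim (for_loop vj dim
    (RSet aK (NVar vi) (NVar vj)
      (RSub (RGet aK (NVar vi) (NVar vj))
        (RDiv (RMul (RGet aV (NCst 0) (NVar vi)) (RGet aV (NCst 0) (NVar vj)))
              (RGet aS (NCst 0) (NCst 0)))))).

Definition gs_main : cmd :=
  for_loop vl (NVar 0) (Seq gs_row (Seq gs_norm gs_update)).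

Definition gs_out (q : rat) : cmd :=
  for_loop vi dim (for_loop vj dim
    (RSet 0 (NVar vi) (NVar vj)
      (RMul (RCst q) (RGet aK (NVar vi) (NVar vj))))).

(** For a square matrix [load] has n in variable 0, which still holds N and is therefore reset at
    the end; n is copied to [vn], out of reach of the approximator. *)
Definition prepare (q : rat) : cmd :=
  Seq (NSet vn dim) (Seq gs_init (Seq gs_main (Seq (gs_out q) (NSet 0 dim)))).

Definition decide (q : rat) : cmd :=
  If (BRlt (RMul (RCst q) (RNat (NVar vn))) (RGet 0 (NCst 0) (NCst 0)))
    (NSet 0 (NCst 1)) (NSet 0 (NCst 0)).

Definition test_prog (approx : cmd) (q q' : rat) : cmd :=
  Seq (prepare q) (Seq approx (decide q')).

Hypothesis B2 : (2 <= B)%N.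
Variables (R : realType) (N n : nat) (Y : 'M[R]_(N, n)) (w : nat -> R).
Implicit Types (s : state R) (K : 'M[R]_n).

(** What has to survive the preparation for the memory below B to look freshly loaded, apart from
    variable 0 and array 0; in particular no random number is drawn. *)
Definition base s :=
  [/\ nvar s 1 = n, nvar s vn = n, drawn s = 0%N,
      forall x, (2 <= x < B)%N -> nvar s x = 0%N &
      forall a, (0 < a < B)%N -> rarr s a = fun _ _ => 0].

Definition input s := nvar s 0 = N /\ rarr s 0 = rarr (load Y) 0.

Definition holds s K := forall i j : 'I_n, rarr s aK i j = K i j.

Lemma base_nset s i v : (B < i)%N -> base s -> base (nset s i v).
Proof.
move=> Bi [h1 h2 h3 h4 h5]; split=> //=.
- by rewrite ltn_eqF //; lia.
- by rewrite ltn_eqF //; lia.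
- by move=> x xB; rewrite ltn_eqF ?h4 //; lia.
Qed.

Lemma base_rset s a i j v : (a == 0)%N || (B <= a)%N -> base s ->
  base (rset s a i j v).
Proof.
move=> aB [h1 h2 h3 h4 h5]; split=> //= a' a'B.
apply/funext => i'; apply/funext => j'; rewrite h5 //.
by rewrite (_ : (a' == a) = false) //; lia.
Qed.

Lemma input_nset s i v : (0 < i)%N -> input s -> input (nset s i v).
Proof. by move=> i0 [h1 h2]; split=> //=; rewrite ltn_eqF. Qed.

Lemma input_rset s a i j v : (0 < a)%N -> input s -> input (rset s a i j v).
Proof.
move=> a0 [h1 h2]; split=> //=; apply/funext => i'; apply/funext => j'.
by rewrite ltn_eqF //= h2.
Qed.

Lemma loadE (i : 'I_N) (j : 'I_n) : rarr (load Y) 0 i j = Y i j.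
Proof. by rewrite /= !valK. Qed.

Lemma input_get s (i : 'I_N) (j : 'I_n) : input s -> rarr s 0 i j = Y i j.
Proof. by move=> [_ ->]; exact: loadE. Qed.

Lemma eqSn m : (m.+1 == m) = false. Proof. lia. Qed.
Lemma eqSSn m : (m.+2 == m) = false. Proof. lia. Qed.
Lemma eqSSSn m : (m.+3 == m) = false. Proof. lia. Qed.
Lemma eqnS m : (m == m.+1) = false. Proof. lia. Qed.
Lemma eqnSS m : (m == m.+2) = false. Proof. lia. Qed.
Lemma eqnSSS m : (m == m.+3) = false. Proof. lia. Qed.
Lemma eqB1 : (1 == B)%N = false. Proof. lia. Qed.
Lemma eqB0 : (0 == B)%N = false. Proof. lia. Qed.
Lemma eqBn0 : (B == 0)%N = false. Proof. lia. Qed.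
Lemma eqBn1 : (B == 1)%N = false. Proof. lia. Qed.
Definition eqB := (eqSn, eqSSn, eqSSSn, eqnS, eqnSS, eqnSSS, eqB1, eqB0, eqBn0,
  eqBn1, eqSS).

Lemma sum_ltS (V : nmodType) (F : 'I_n -> V) k (kn : (k < n)%N) :
  \sum_(i < n | (i < k.+1)%N) F i = \sum_(i < n | (i < k)%N) F i + F (Ordinal kn).
Proof.
rewrite (bigD1 (Ordinal kn)) ?ltnSn //= addrC; congr (_ + _).
apply: eq_bigl => i; rewrite ltnS -val_eqE /=; lia.
Qed.

Lemma sum_lt0 (V : nmodType) (F : 'I_n -> V) : \sum_(i < n | (i < 0)%N) F i = 0.
Proof. by rewrite big1. Qed.

Lemma sum_ltn (V : nmodType) (F : 'I_n -> V) :
  \sum_(i < n | (i < n)%N) F i = \sum_(i < n) F i.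
Proof. by apply: eq_bigl => i; rewrite ltn_ord. Qed.

Lemma gs_row_triple (l : 'I_N) K :
  triple w (fun s => [/\ base s, input s, nvar s vl = l & holds s K]) gs_row
    (for_time n (1 + for_time n 1).+1)
    (fun s => [/\ base s, input s, nvar s vl = l, holds s K &
       forall j : 'I_n, rarr s aV 0 j = (row l Y *m K) 0 j]).
Proof.
pose v := row l Y *m K.
pose Inv j s := [/\ base s, input s, nvar s vl = l, holds s K &
  nvar s vj = j /\ forall j' : 'I_n, (j' < j)%N -> rarr s aV 0 j' = v 0 j'].
apply: (triple_weaken (P := fun s => Inv 0%N (nset s vj 0)) (Q := Inv n) _ _ (leqnn _)).
- apply: triple_for => [j s [[b1 _ _ _ _] _ _ _ []] //|j jn].
  pose oj := Ordinal jn.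
  pose Inv2 k s := [/\ base s, input s, nvar s vl = l, holds s K &
    [/\ nvar s vj = j, nvar s vi = k,
      forall j' : 'I_n, (j' < j)%N -> rarr s aV 0 j' = v 0 j' &
      rarr s aV 0 j = \sum_(i < n | (i < k)%N) Y l i * K i oj]].
  apply: (triple_seq (Q := fun s => Inv2 0%N (nset s vi 0))).
    apply: triple_rset.
    move=> s [b i hl hK [hj hv]]; split.
    + by apply: base_nset => //; apply: base_rset => //; lia.
    + by apply: input_nset => //; exact: input_rset.
    + by rewrite /= !eqB.
    + by move=> i' j'; rewrite /= !eqB /= hK.
    + split=> /=; rewrite ?eqB ?eqxx //=.
      * by move=> j' j'j; rewrite hj ltn_eqF // hv.
      * by rewrite hj eqxx sum_lt0 rmorph0.
  apply: (triple_weaken (P := fun s => Inv2 0%N (nset s vi 0)) (Q := Inv2 n) _ _ (leqnn _)) => //.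
  + apply: triple_for => [k s [[b1 _ _ _ _] _ _ _ []] //|k kn].
    apply: triple_rset.
    move=> s [b i hl hK [hj hi hv hs]]; split; first by rewrite /= hi.
    split.
    * by apply: base_nset => //; apply: base_rset => //; lia.
    * by apply: input_nset => //; exact: input_rset.
    * by rewrite /= !eqB.
    * by move=> i' j'; rewrite /= !eqB /= hK.
    * split=> /=; rewrite ?eqB ?eqxx //=.
      -- by move=> j' j'j; rewrite hj ltn_eqF // hv.
      -- rewrite hj eqxx hs (sum_ltS _ kn) hl hi.
         by rewrite (input_get l (Ordinal kn) i) (hK (Ordinal kn) oj).
  + move=> s [b i hl hK [hj hi hv hs]]; split; first by [].
    split.
    * exact: base_nset.
    * exact: input_nset.
    * by rewrite /= !eqB.
    * by move=> i' j'; rewrite /= hK.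
    * split=> /=; rewrite ?eqxx // => j'.
      rewrite ltnS leq_eqVlt => /orP[/eqP j'j|]; last exact: hv.
      rewrite j'j hs sum_ltn /v mxE; apply: eq_bigr => i' _.
      by rewrite mxE; congr (_ * K _ _); exact/val_inj.
- move=> s [b i hl hK]; split.
  + exact: base_nset.
  + exact: input_nset.
  + by rewrite /= !eqB.
  + by move=> i' j'; rewrite /= hK.
  + by split=> //=; rewrite ?eqxx.
- by move=> s [b i hl hK [hj hv]]; split=> // j; exact: hv.
Qed.

Lemma gs_norm_triple (l : 'I_N) K :
  triple w (fun s => [/\ base s, input s, nvar s vl = l, holds s K &
       forall j : 'I_n, rarr s aV 0 j = (row l Y *m K) 0 j]) gs_norm
    (1 + for_time n 1).+1
    (fun s => [/\ base s, input s, nvar s vl = l, holds s K &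
       (forall j : 'I_n, rarr s aV 0 j = (row l Y *m K) 0 j) /\
       rarr s aS 0 0 = qform K (row l Y)]).
Proof.
set v := row l Y *m K.
pose Inv j s := [/\ base s, input s, nvar s vl = l, holds s K &
  [/\ nvar s vj = j, forall j : 'I_n, rarr s aV 0 j = v 0 j &
   rarr s aS 0 0 = \sum_(j' < n | (j' < j)%N) v 0 j' * Y l j']].
apply: (triple_seq (Q := fun s => Inv 0%N (nset s vj 0))).
  apply: triple_rset => s [b i hl hK hv]; split.
  - by apply: base_nset => //; apply: base_rset => //; lia.
  - by apply: input_nset => //; exact: input_rset.
  - by rewrite /= !eqB.
  - by move=> i' j'; rewrite /= !eqB /= hK.
  - split=> /=; rewrite ?eqB ?eqxx //=; first by rewrite sum_lt0 rmorph0.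
apply: (triple_weaken (P := fun s => Inv 0%N (nset s vj 0)) (Q := Inv n) _ _ (leqnn _)) => //.
- apply: triple_for => [j s [[b1 _ _ _ _] _ _ _ []] //|j jn].
  apply: triple_rset => s [b i hl hK [hj hv hs]]; split; first by rewrite /= hj.
  split.
  + by apply: base_nset => //; apply: base_rset => //; lia.
  + by apply: input_nset => //; exact: input_rset.
  + by rewrite /= !eqB.
  + by move=> i' j'; rewrite /= !eqB /= hK.
  + split=> /=; rewrite ?eqB ?eqxx //=.
    rewrite hs (sum_ltS _ jn) hl hj.
    by rewrite (input_get l (Ordinal jn) i) (hv (Ordinal jn)).
- move=> s [b i hl hK [hj hv hs]]; split=> //; split=> //.
  rewrite hs sum_ltn /qform -/v mxE; apply: eq_bigr => j _.
  by rewrite !mxE.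
Qed.

Definition grid a (e : rexp) : cmd :=
  for_loop vi dim (for_loop vj dim (RSet a (NVar vi) (NVar vj) e)).

(** Overwriting in place is safe: the new entry at (i, j) is determined by P, which is stable under
    writing to the array, and by the old entry at (i, j). *)
Lemma grid_triple a e (P : state R -> Prop) (o g : 'I_n -> 'I_n -> R) :
  (forall s, P s -> nvar s 1 = n) ->
  (forall s x, P s -> P (nset s vi x)) -> (forall s x, P s -> P (nset s vj x)) ->
  (forall s (i j : 'I_n) x, P s -> P (rset s a i j x)) ->
  (forall s (i j : 'I_n), P s -> nvar s vi = i -> nvar s vj = j ->
     rarr s a i j = o i j -> reval s e = g i j) ->
  triple w (fun s => P s /\ forall i j : 'I_n, rarr s a i j = o i j) (grid a e)
    (for_time n (for_time n 1))
    (fun s => P s /\ forall i j : 'I_n, rarr s a i j = g i j).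
Proof.
move=> Pn Pi Pj Pa Pe.
pose Inv k s := [/\ P s, nvar s vi = k &
  forall i j : 'I_n, rarr s a i j = if (i < k)%N then g i j else o i j].
apply: (triple_weaken (P := fun s => Inv 0%N (nset s vi 0)) (Q := Inv n) _ _ (leqnn _)).
- apply: triple_for => [k s [/Pn b1 hi _] //|k kn].
  pose ok := Ordinal kn.
  pose Inv2 m s := [/\ P s, nvar s vi = k, nvar s vj = m &
    forall i j : 'I_n, rarr s a i j =
      if (i < k)%N || (i == k :> nat) && (j < m)%N then g i j else o i j].
  apply: (triple_weaken (P := fun s => Inv2 0%N (nset s vj 0)) (Q := Inv2 n) _ _ (leqnn _)).
  + apply: triple_for => [m s [/Pn b1 _ hj _] //|m mn].
    pose om := Ordinal mn.
    apply: triple_rset => s [Ps hi hj ha]; split; first by rewrite /= hj.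
    have e1 : reval s e = g ok om.
      apply: Pe => //; rewrite ha; case: ifP => // /orP[|/andP[_]] /=; lia.
    split.
    * by apply: Pj; rewrite /= hi hj; exact: (Pa _ ok om).
    * by rewrite /= !eqB.
    * by rewrite /= eqxx.
    * move=> i j /=; rewrite eqxx /= hi hj e1.
      case: ifP => [/andP[/eqP ik /eqP jm]|ij].
        have -> : ok = i by apply/val_inj.
        have -> : om = j by apply/val_inj.
        by rewrite ik jm eqxx ltnSn orbT.
      rewrite ha; move: ij; case: eqP => ik /=; rewrite ?orbF // => /negbT jm.
      by have -> : (j < m.+1)%N = (j < m)%N by move: jm; lia.
  + move=> s [Ps hi ha]; split.
    * exact: Pj.
    * by rewrite /= !eqB.
    * by rewrite /= eqxx.
    * by move=> i j; rewrite /= ha ltn0 andbF orbF.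
  + move=> s [Ps hi hj ha]; split; first by [].
    split; [exact: Pi|by rewrite /= eqxx|].
    move=> i j; rewrite /= ha ltn_ord andbT.
    by have -> : (i < k.+1)%N = (i < k)%N || (i == k :> nat) by lia.
- move=> s [Ps ha]; split; [exact: Pi|by rewrite /= eqxx|].
  by move=> i j; rewrite /= ha.
- by move=> s [Ps hi ha]; split=> // i j; rewrite ha ltn_ord.
Qed.

(** The division in the program and the inverse in [gs] have the same value at zero, so a vanishing
    norm needs no separate case. *)
Lemma gs_update_triple (l : 'I_N) K :
  triple w (fun s => [/\ base s, input s, nvar s vl = l, holds s K &
       (forall j : 'I_n, rarr s aV 0 j = (row l Y *m K) 0 j) /\
       rarr s aS 0 0 = qform K (row l Y)]) gs_update
    (for_time n (for_time n 1))
    (fun s => [/\ base s, input s, nvar s vl = l & holds s (gs K (row l Y))]).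
Proof.
set v := row l Y *m K.
pose P s := [/\ base s, input s, nvar s vl = l &
  (forall j : 'I_n, rarr s aV 0 j = v 0 j) /\ rarr s aS 0 0 = qform K (row l Y)].
apply: (triple_weaken (P := fun s => P s /\ holds s K)
  (Q := fun s => P s /\ holds s (gs K (row l Y))) _ _ (leqnn _)).
- apply: grid_triple.
  + by move=> s [[]].
  + move=> s x [b i hl hv]; split=> //; first exact: base_nset.
    by rewrite /= !eqB.
  + move=> s x [b i hl hv]; split=> //; first exact: base_nset.
    by rewrite /= !eqB.
  + move=> s i j x [b i' hl [hv hs]]; split=> //.
    * by apply: base_rset => //; lia.
    * by apply: input_rset => //; lia.
    * by split=> [j'|]; rewrite /= !eqB ?hv ?hs.
  + move=> s i j [b i' hl [hv hs]] hi hj hK; rewrite /= hi hj hK !hv hs.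
    by rewrite /gs !mxE big_ord1 !mxE [X in _ = _ - X]mulrC.
- by move=> s [b i hl hK [hv hs]]; split.
- by move=> s [[b i hl hv] hK]; split.
Qed.

Lemma gs_init_triple :
  triple w (fun s => [/\ base s, input s & holds s 0]) gs_init (for_time n 1)
    (fun s => [/\ base s, input s & holds s 1%:M]).
Proof.
pose Inv k s := [/\ base s, input s, nvar s vi = k &
  forall i j : 'I_n, rarr s aK i j = ((i == j) && (i < k)%N)%:R].
apply: (triple_weaken (P := fun s => Inv 0%N (nset s vi 0)) (Q := Inv n) _ _ (leqnn _)).
- apply: triple_for => [k s [[b1 _ _ _ _] _ hi _] //|k kn].
  apply: triple_rset => s [b i hi ha]; split; first by rewrite /= hi.
  split.
  + by apply: base_nset => //; apply: base_rset => //; lia.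
  + by apply: input_nset => //; apply: input_rset => //; lia.
  + by rewrite /= eqxx.
  + move=> i' j' /=; rewrite eqxx /= hi rmorph1.
    case: ifP => [/andP[/eqP ik /eqP jk]|ij].
      have -> : i' = j' by apply/val_inj; rewrite /= ik jk.
      by rewrite eqxx jk ltnSn.
    rewrite ha; congr (nat_of_bool _)%:R; case: eqP => // ij'.
    move: ij; rewrite -ij' andbb => /negbT ik.
    by move: ik; rewrite /=; lia.
- move=> s [b i hK]; split; [exact: base_nset|exact: input_nset|by rewrite /= eqxx|].
  by move=> i' j'; rewrite /= hK mxE andbF.
- move=> s [b i hi ha]; split=> // i' j'.
  by rewrite ha mxE ltn_ord andbT.
Qed.

Definition body_time := (((for_time n (1 + for_time n 1).+1) +
  ((1 + for_time n 1).+1 + for_time n (for_time n 1)).+1).+1)%N.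

Fixpoint gsmx K (m : nat) : 'M[R]_n :=
  if m is m'.+1 then
    if insub m' is Some l then gs (gsmx K m') (row l Y) else gsmx K m'
  else K.

Lemma gs_main_triple :
  triple w (fun s => [/\ base s, input s & holds s 1%:M]) gs_main
    (for_time N body_time)
    (fun s => [/\ base s, input s & holds s (gsmx 1%:M N)]).
Proof.
pose Inv l s := [/\ base s, input s, nvar s vl = l & holds s (gsmx 1%:M l)].
apply: (triple_weaken (P := fun s => Inv 0%N (nset s vl 0)) (Q := Inv N) _ _ (leqnn _)).
- apply: triple_for => [l s [_ [i _] hl _] //|l lN].
  pose ol := Ordinal lN.
  apply: (triple_weaken (P := fun s => [/\ base s, input s, nvar s vl = ol &
    holds s (gsmx 1%:M l)]) (Q := fun s => [/\ base s, input s,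
    nvar s vl = ol & holds s (gs (gsmx 1%:M l) (row ol Y))]) _ _ (leqnn _)) => //.
  + rewrite /body_time.
    apply: triple_seq; first exact: gs_row_triple.
    apply: triple_seq; first exact: gs_norm_triple.
    exact: gs_update_triple.
  + move=> s [b i hl hK]; split; first by [].
    split; [by apply: base_nset => //; lia|exact: input_nset|by rewrite /= eqxx|].
    by move=> i' j'; rewrite /= (_ : insub l = Some ol) ?insubT //= hK.
- move=> s [b i hK]; split; [by apply: base_nset => //; lia|exact: input_nset|by rewrite /= eqxx|].
  by move=> i' j'; rewrite /= hK.
- by move=> s [b i hl hK]; split.
Qed.

(** Entries outside the n by n block are tracked because the outcome has to match the whole array of
    a fresh [load]. *)
Lemma gs_out_triple (q : rat) K :
  triple w (fun s => [/\ base s, holds s K & rarr s 0 = rarr (load Y) 0]) (gs_out q)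
    (for_time n (for_time n 1))
    (fun s => [/\ base s,
       forall i j, (n <= maxn i j)%N -> rarr s 0 i j = rarr (load Y) 0 i j &
       forall i j : 'I_n, rarr s 0 i j = ratr q * K i j]).
Proof.
pose P s := [/\ base s, holds s K &
  forall i j, (n <= maxn i j)%N -> rarr s 0 i j = rarr (load Y) 0 i j].
apply: (triple_weaken (P := fun s => P s /\
    forall i j : 'I_n, rarr s 0 i j = rarr (load Y) 0 i j)
  (Q := fun s => P s /\ forall i j : 'I_n, rarr s 0 i j = ratr q * K i j) _ _ (leqnn _)).
- apply: grid_triple.
  + by move=> s [[]].
  + by move=> s x [b hK h0]; split=> //; exact: base_nset.
  + by move=> s x [b hK h0]; split=> //; exact: base_nset.
  + move=> s i j x [b hK h0]; split.
    * exact: base_rset.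
    * by move=> i' j'; rewrite /= !eqB /= hK.
    * move=> i' j' nij; rewrite /= h0 // ifN // negb_and.
      by move: nij (ltn_ord i) (ltn_ord j); rewrite leq_max; lia.
  + by move=> s i j [b hK h0] hi hj _; rewrite /= hi hj hK.
- by move=> s [b hK h0]; split; [split=> // i j _; rewrite h0|move=> i j; rewrite h0].
- by move=> s [[b hK h0] hq]; split.
Qed.

Lemma base_load : base (nset (load Y) vn n) /\ holds (nset (load Y) vn n) 0.
Proof.
split; first split=> //=.
- by rewrite !eqB.
- by rewrite eqxx.
- by move=> [//|[//|x]] /andP[x2 xB]; rewrite ltn_eqF.
- by move=> [|a] // _; apply/funext => i; apply/funext.
- by move=> i j; rewrite mxE /=; case: (B) B2.
Qed.

(** By N <= n the n by n block written by [gs_out] covers all sample rows, so no entry of the sample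
    survives in array 0. *)
Lemma prepare_triple (q : rat) : (N <= n)%N ->
  triple w (fun s => s = load Y) (prepare q)
   (1 + (for_time n 1 + (for_time N body_time +
     (for_time n (for_time n 1) + 1).+1).+1).+1).+1
   (fun s => sim B s (load (ratr q *: gsmx 1%:M N)) /\ nvar s vn = n).
Proof.
move=> Nn.
apply: (triple_seq (Q := fun s => [/\ base s, input s & holds s 0])).
  apply: triple_nset => s ->; have [b hK] := base_load; split=> //.
  by apply: input_nset; first lia.
apply: triple_seq; first exact: gs_init_triple.
apply: triple_seq; first exact: gs_main_triple.
apply: triple_seq.
  apply: (triple_pre (gs_out_triple (K := gsmx 1%:M N) q)).
  by move=> s [b [_ i0] hK]; split.
apply: triple_nset => s [[b1 b2 b3 b4 b5] h0 hq]; split; last by rewrite /= eqBn0.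
split=> //=.
- by move=> [|[|x]] //= xB; rewrite b4.
- move=> [|a] aB; last by rewrite b5.
  apply/funext => i; apply/funext => j.
  case: insubP => [i' _ <-|]; last first.
    rewrite -leqNgt => ni; rewrite h0 ?leq_max ?ni //=.
    by rewrite insubN // -leqNgt (leq_trans Nn).
  case: insubP => [j' _ <-|]; first by rewrite hq mxE.
  rewrite -leqNgt => nj; rewrite h0 ?leq_max ?nj ?orbT //=.
  by case: insub => // a; rewrite insubN // -leqNgt.
Qed.

Definition test_time (T : nat) : nat :=
  ((1 + (for_time n 1 + (for_time N body_time +
     (for_time n (for_time n 1) + 1).+1).+1).+1).+1 + (T + 2).+1).+1.

Lemma test_prog_exec (approx : cmd) (q q' : rat) (T : nat) : (N <= n)%N ->
  (cmd_bound approx <= B)%N ->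
  (run approx w (load (ratr q *: gsmx 1%:M N)) T).1 = [::] ->
  exists2 s', nvar s' 0 =
      (ratr q' * n%:R < real_output (run approx w (load (ratr q *: gsmx 1%:M N)) T).2) &
    exec w (test_prog approx q q') (load Y) s' (test_time T).
Proof.
move=> Nn aB halt; set J := ratr q *: _ in halt *.
set F := real_output _.
suff : triple w (fun s => s = load Y) (test_prog approx q q') (test_time T)
    (fun s' => nvar s' 0 = (ratr q' * n%:R < F)).
  by move=> /(_ _ erefl) [s' h1 h2]; exists s'.
apply: triple_seq; first exact: (prepare_triple q Nn).
apply: (triple_seq (Q := fun s => sim B s (run approx w (load J) T).2 /\ nvar s vn = n)).
  move=> s [S sn]; have [s1 [E S1 N1]] := exec_sim S aB halt.
  by exists s1 => //; split=> //; rewrite N1.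
have cond s : sim B s (run approx w (load J) T).2 -> nvar s vn = n ->
    beval s (BRlt (RMul (RCst q') (RNat (NVar vn))) (RGet 0 (NCst 0) (NCst 0))) =
    (ratr q' * n%:R < F).
  move=> [_ Sa _] sn; rewrite /= sn Sa //; lia.
apply: triple_if; apply: triple_nset => s [[S sn]]; rewrite (cond s) //.
  by move=> ->.
by move=> /negbTE ->.
Qed.

End Program.

Lemma gsmx_gsseq (R : realType) (N n : nat) (Y : sample R n N) :
  gsmx (sample_mx Y) 1%:M N = gsseq 1%:M Y.
Proof.
suff H m : (m <= N)%N -> gsmx (sample_mx Y) 1%:M m = gsseq 1%:M (take m Y).
  by rewrite H // take_oversize // size_tuple.
elim: m => [|m IH] mN; first by rewrite take0.
have t0 : n.-tuple (measurableTypeR R) := tnth Y (Ordinal mN).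
rewrite /= insubT IH 1?ltnW // (take_nth t0) ?size_tuple //.
rewrite /gsseq -cats1 foldl_cat /=; congr gs.
by apply/rowP => j; rewrite !mxE (tnth_nth t0).
Qed.

(** * From the approximator to the test *)

Section TestProb.
Variable R : realType.

(** A step draws at most one number, so t steps read the tape only below position [drawn s + t]. *)
Lemma iter_step_ext (w w' : nat -> R) t K (s : state R) :
  (forall i, (i < drawn s + t)%N -> w i = w' i) ->
  iter t (step w) (K, s) = iter t (step w') (K, s).
Proof.
elim: t K s => [//|t IH] K s ww; rewrite !iterSr.
have E : step w (K, s) = step w' (K, s).
  by case: K => // -[] //= a i j K; rewrite ww // addnS ltnS leq_addr.
have D : (drawn (step w (K, s)).2 <= (drawn s).+1)%N.
  case: K {E} => [|[]] //= *; try exact: leqnSn.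
  by case: ifP => _ /=; exact: leqnSn.
rewrite -E; case: (step w (K, s)) D => K1 s1 /= D.
by apply: IH => i it; apply: ww; lia.
Qed.

(** For n >= 2 the larger exponent absorbs everything. At n = 1 powers are constant and the additive
    part must absorb 100 * 2^3 = 800, hence 1000. *)
Lemma poly_boundP C k n : (100 * n.+1 ^ 3 + poly_bound k n + C <=
  poly_bound (k + C + 1000) n)%N.
Proof.
rewrite /poly_bound; case: n => [|[|n]].
- have : (0 ^ k <= 1)%N by case: k => [|k] //; rewrite exp0n.
  by rewrite exp1n; lia.
- rewrite !exp1n; have -> : (2 ^ 3 = 8)%N by []; lia.
set m := n.+2.
have m2 : (2 <= m)%N by [].
have h1 : (m.+1 ^ 3 <= m ^ 6)%N.
  rewrite (expnM m 2 3) leq_exp2r //; rewrite expnS expn1; nia.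
have h2 : (100 <= m ^ 7)%N by apply: (@leq_trans (2 ^ 7)); rewrite // leq_exp2r.
have h3 : (100 * m.+1 ^ 3 <= m ^ 13)%N by rewrite (expnD m 7 6) leq_mul.
have m0 : (0 < m)%N by [].
have le a b : (a <= b)%N -> (m ^ a <= m ^ b)%N by move=> ab; rewrite leq_pexp2l.
have e1 : (m ^ 13 <= m ^ (k + C + 13))%N by apply: le; lia.
have e2 : (m ^ k <= m ^ (k + C + 13))%N by apply: le; lia.
have e3 : (2 * m ^ (k + C + 13) <= m ^ (k + C + 1000))%N.
  apply: (@leq_trans (m * m ^ (k + C + 13))%N); first by rewrite leq_mul2r m2 orbT.
  by rewrite -expnS; apply: le; lia.
lia.
Qed.

Lemma test_time_le N n k : (N <= n)%N ->
  (test_time N n (poly_bound k n) <= poly_bound (k + 1000) n)%N.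
Proof.
move=> Nn; apply: leq_trans (_ : _ <= 100 * n.+1 ^ 3 + poly_bound k n + 0)%N _; last first.
  by have := poly_boundP 0 k n; rewrite !addn0.
rewrite /test_time /body_time /for_time addn0.
set X := (X in (N * X)%N); set A := (n * (n * 1.+3).+3.+3).+3.
have hX : (X <= 8 * (n * n) + 18 * n + 21)%N by rewrite /X; nia.
have hN : (N * X <= n * (8 * (n * n) + 18 * n + 21))%N by rewrite leq_mul.
rewrite !expnS expn0 muln1; move: (poly_bound k n) X hX hN => T X hX hN.
nia.
Qed.

Lemma uniform01_conull : uniform01 R (~` `[0, 1]%classic) = 0%E.
Proof.
rewrite /uniform01 /= /uniform_prob integral_uniform_pdf.
by rewrite setICl integral_set0.
Qed.

Lemma test_verdictE (approx : cmd) (q q' : rat) k n N (Y : sample R n N) w :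
  (N <= n)%N -> polytime_approximator R approx k -> (forall i, 0 <= w i <= 1) ->
  let J := ratr q *: gsseq 1%:M Y in
  let c := test_prog (maxn 2 (cmd_bound approx)) approx q q' in
  let T := poly_bound (k + 1000) n in
  (run c w (load (sample_mx Y)) T).1 = [::] /\
  verdict_output (run c w (load (sample_mx Y)) T).2 =
    if ratr q' * n%:R < real_output (run approx w (load J) (poly_bound k n)).2
    then verdict_p else verdict_q.
Proof.
move=> Nn Ha w01 J c T.
have symJ : J^T = J.
  by rewrite /J linearZ /= (gsseq_proj Y (@proj1 R n)).1.
have halt := Ha n J symJ w w01.
(* The lower bound 2 keeps variables 0 and 1, which [load] fills, apart from those of the test. *)
have B2 : (2 <= maxn 2 (cmd_bound approx))%N by rewrite leq_maxl.
have aB : (cmd_bound approx <= maxn 2 (cmd_bound approx))%N by rewrite leq_maxr.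
have := @test_prog_exec _ B2 R N n (sample_mx Y) w approx q q' _ Nn aB.
rewrite gsmx_gsseq => /(_ _ halt) [s' h1 [t0 t0t E]].
have ex : exec w c (load (sample_mx Y)) s' T.
  by exists t0 => //; apply: (leq_trans t0t); exact: test_time_le.
rewrite (exec_run ex) /verdict_output /= h1; split=> //.
by case: (_ < _).
Qed.

Lemma approx_run_prefix (approx : cmd) n (J : 'M[R]_n) t t'
    (u : t.-tuple (measurableTypeR R)) (v : t'.-tuple (measurableTypeR R)) : (t <= t')%N -> take t v = u ->
  run approx (tape u) (load J) t = run approx (tape v) (load J) t.
Proof.
move=> tt' uv; apply: iter_step_ext => i; rewrite add0n => it.
by rewrite /tape -uv nth_take.
Qed.

Lemma tape01 t (v : t.-tuple (measurableTypeR R)) i :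
  (forall i, `[0, 1]%classic (tnth v i)) -> 0 <= tape v i <= 1.
Proof.
move=> Ev; rewrite /tape; have [it|it] := ltnP i t.
  by have := Ev (Ordinal it); rewrite (tnth_nth 0) /= in_itv.
(* Past its end the tape reads 0, which also lies in [0, 1]. *)
by rewrite nth_default ?size_tuple // lexx ler01.
Qed.

Lemma poly_bound_le k n : (poly_bound k n <= poly_bound (k + 1000) n)%N.
Proof.
have := poly_boundP 0 k n; rewrite !addn0; apply: leq_trans.
exact: leq_addl.
Qed.

(** For each Y in G the success event of the approximator is carried to the longer tape of the test.
    The preparation draws nothing, so the approximator reads the initial segment of that tape. *)
Lemma test_prob_ge (approx : cmd) (q q' : rat) k n N (delta eta : R)
    (P : probability (sample R n N) R) (v : verdict) (G : set (sample R n N)) :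
  (N <= n)%N -> polytime_approximator R approx k -> measurable G -> eta <= 1 ->
  (forall Y, G Y -> ((1 - eta)%:E <=
     approx_law approx k (ratr q *: gsseq 1%:M Y)
       [set F : R | (`|ln (partition_function (ratr q *: gsseq 1%:M Y)) - F|
          < delta * n%:R)%R])%E) ->
  (forall Y (F : R), G Y ->
     `|ln (partition_function (ratr q *: gsseq 1%:M Y)) - F| < delta * n%:R ->
     (if ratr q' * n%:R < F then verdict_p else verdict_q) = v) ->
  ((1 - eta)%:E * P G <=
   test_prob (test_prog (maxn 2 (cmd_bound approx)) approx q q') (k + 1000) P v)%E.
Proof.
move=> Nn Ha mG eta1 Happ Hv.
have eta0 : 0 <= 1 - eta by lra.
rewrite /test_prob -[G in leLHS]setIT -integral_indic //.
rewrite -ge0_integralZl_EFin //; last exact/measurable_EFinP/measurable_indic.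
apply: ge0_le_lower_integral => Y; first by rewrite mule_ge0 // lee_fin.
rewrite indicE; case: (boolP (Y \in G)) => [|_]; last by rewrite mule0 measure_ge0.
rewrite inE mule1 => GY.
apply: (le_trans (Happ Y GY)); rewrite /approx_law /pushforward /tape_law.
apply: (@iid_law_prefix _ _ R (uniform01 R) `[0, 1]%classic).
- exact: poly_bound_le.
- exact: measurable_itv.
- exact: uniform01_conull.
move=> u z /= Au uz Ez; rewrite /xsection /= inE /= /test_verdict.
have z01 i := tape01 i Ez.
have [_ ->] := test_verdictE q q' Y Nn Ha z01.
rewrite -(approx_run_prefix approx _ (poly_bound_le k n) uz).
exact: Hv GY Au.
Qed.

Lemma test_prob_le1 c k n N (P : probability (sample R n N) R) v :
  (test_prob c k P v <= 1)%E.
Proof.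
rewrite /test_prob -[leRHS](@probability_setT _ _ _ P) -[leRHS]mul1e -integral_cst //=.
apply: ge0_le_lower_integral => Y; first exact: measure_ge0.
exact: iid_law_le1.
Qed.

Lemma test_polytime (approx : cmd) (q q' : rat) k (gamma : R) :
  (forall n, num_samples gamma n <= n)%N -> polytime_approximator R approx k ->
  polytime_test gamma (test_prog (maxn 2 (cmd_bound approx)) approx q q') (k + 1000).
Proof.
by move=> Nn Ha n Y w w01; have [] := test_verdictE q q' Y (Nn n) Ha w01.
Qed.

(** Idempotence of K gives a (a - lam) = 0 for every eigenvalue a of lam K. *)
Lemma spectral_width n (K : 'M[R]_n) (lam : R) : proj K -> 0 <= lam ->
  lambda_max (lam *: K) - lambda_min (lam *: K) <= lam.
Proof.
move=> [_ KK] lam0; set A := [set a | eigenvalue (lam *: K) a].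
have A01 a : A a -> 0 <= a <= lam.
  move=> /eigenvalueP [v vE v0].
  have vE2 : a *: v *m K = lam *: (v *m K) *m K.
    by rewrite -vE -!scalemxAr -!scalemxAl.
  have : (a * (a - lam)) *: v = 0.
    rewrite mulrBr scalerBl -[in X in X - _]scalerA -vE -scalemxAr scalerA.
    rewrite mulrC -!scalerA (scalemxAl a) vE2 -scalemxAl -mulmxA KK.
    have -> : lam *: (v *m K) = a *: v by rewrite -vE -scalemxAr.
    by rewrite scalerA [lam * a]mulrC subrr.
  move=> /eqP; rewrite scaler_eq0 (negbTE v0) orbF mulf_eq0 subr_eq0.
  by move=> /orP[/eqP ->|/eqP ->]; rewrite lexx ?lam0.
rewrite /lambda_max /lambda_min -/A.
(* Without eigenvalues, as in dimension 0, [sup] and [inf] are both 0. *)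
have [A0|An] := eqVneq A set0; first by rewrite A0 sup0 inf0 subr0.
have /set0P An0 := An.
have h1 : sup A <= lam by apply: ge_sup => // a /A01 /andP[].
have h2 : 0 <= inf A by apply: lb_le_inf => // a /A01 /andP[].
lra.
Qed.

End TestProb.

(** * Explicit bounds for logarithms, entropy and factorials *)

Section RealLemmas.
Variable R : realType.
Implicit Types (x y t e rho : R).

(** Terms of degree p >= 2 are at most t^p / 2 and sum like a geometric series. *)
Lemma expR_le_quad t : 0 <= t < 1 -> expR t <= 1 + t + t ^+ 2 / (2 * (1 - t)).
Proof.
move=> /andP[t0 t1]; have s0 : 0 < 1 - t by lra.
rewrite -lee_fin -expR_nneseries //; apply: lime_le.
  by apply: is_cvg_nneseries => p _ _; rewrite lee_fin divr_ge0 // exprn_ge0.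
apply: nearW => m; rewrite sumEFin lee_fin.
have mono : \sum_(0 <= p < m) t ^+ p / p`!%:R <= \sum_(0 <= p < m.+2) t ^+ p / p`!%:R.
  rewrite !big_nat_recr //= -addrA lerDl addr_ge0 // divr_ge0 // exprn_ge0 //.
apply: (le_trans mono).
(* Subtracting the rest of the geometric series makes the bound inductive. *)
suff : \sum_(0 <= p < m.+2) t ^+ p / p`!%:R <=
    1 + t + t ^+ 2 / (2 * (1 - t)) - t ^+ m.+2 / (2 * (1 - t)).
  move=> h; apply: (le_trans h); rewrite gerBl divr_ge0 ?exprn_ge0 //; lra.
elim: m {mono} => [|m IH].
  rewrite !big_nat_recr //= big_geq // add0r expr0 expr1 fact0 factS fact0 divr1.
  by rewrite addrK divr1.
rewrite big_nat_recr //=.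
have f2 : 2 <= (m.+2)`!%:R :> R.
  by rewrite ler_nat -[2%N]muln1 factS leq_mul // fact_gt0.
have h : t ^+ m.+2 / (m.+2)`!%:R <= t ^+ m.+2 / 2.
  by rewrite ler_wpM2l ?exprn_ge0 // lef_pV2 ?posrE //; lra.
have e : t ^+ m.+2 / 2 = t ^+ m.+2 / (2 * (1 - t)) - t ^+ m.+3 / (2 * (1 - t)).
  by rewrite [t ^+ m.+3]exprSr; field; lra.
lra.
Qed.

Lemma ln1p_ge e : 0 <= e <= 150^-1 -> e - 51 / 100 * e ^+ 2 <= ln (1 + e).
Proof.
move=> /andP[e0 e1]; rewrite -ler_expR lnK ?posrE; last by lra.
set t := e - _.
have e2 : e ^+ 2 <= 150^-1 * e by rewrite expr2 ler_wpM2r.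
have e20 : 0 <= e ^+ 2 by exact: sqr_ge0.
have t0 : 0 <= t by rewrite /t; lra.
have te : t <= e by rewrite /t; lra.
have t1 : t <= 150^-1 by lra.
apply: (le_trans (expR_le_quad _)); first by rewrite t0 /=; lra.
have tt : t ^+ 2 <= e ^+ 2 by rewrite lerXn2r ?nnegrE.
have : t ^+ 2 / (2 * (1 - t)) <= 51 / 100 * e ^+ 2.
  rewrite ler_pdivrMr; last by lra.
  have : 0 <= e ^+ 2 * (150^-1 - t) by rewrite mulr_ge0 // subr_ge0.
  lra.
rewrite /t; lra.
Qed.

Lemma ln1m_le y : 0 <= y <= 100^-1 -> ln (1 - y) <= - (y + 4 / 10 * y ^+ 2).
Proof.
move=> /andP[y0 y1].
rewrite -[leRHS]expRK ler_ln ?posrE ?expR_gt0 //; last by lra.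
set t := y + _; have yy : y ^+ 2 <= 100^-1 * y by rewrite expr2 ler_wpM2r.
have y20 : 0 <= y ^+ 2 by exact: sqr_ge0.
have t0 : 0 <= t by rewrite /t; lra.
have t1 : t <= 101 / 100 * y by rewrite /t; lra.
rewrite expRN -[leLHS]invrK lef_pV2 ?posrE ?invr_gt0 ?expR_gt0 //; last by lra.
apply: (le_trans (expR_le_quad _)); first by rewrite t0 /=; lra.
have tt : t ^+ 2 <= (101 / 100) ^+ 2 * y ^+ 2.
  by rewrite -exprMn lerXn2r ?nnegrE //; lra.
have h1 : t ^+ 2 / (2 * (1 - t)) <= 6 / 10 * y ^+ 2.
  rewrite ler_pdivrMr; last by lra.
  have : 0 <= y ^+ 2 * (100^-1 * (101/100) - t).
    by rewrite mulr_ge0 // subr_ge0; lra.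
  lra.
rewrite -[leRHS]mul1r ler_pdivlMr; last by lra.
apply: (@le_trans _ _ ((1 + y + y ^+ 2) * (1 - y))).
  by rewrite ler_wpM2r //; [lra|rewrite /t in h1 *; lra].
have -> : (1 + y + y ^+ 2) * (1 - y) = 1 - y ^+ 3 by ring.
by rewrite gerBl exprn_ge0.
Qed.

(** The cubic Taylor polynomial of exp suffices: times 1 - rho it exceeds 1 + rho by about rho^3 /
    12, the gap between 3/4 and the Taylor coefficient 2/3. *)
Lemma ln_ratio_le rho : 0 <= rho <= 10^-1 ->
  ln ((1 + rho) / (1 - rho)) <= 2 * rho + 3 / 4 * rho ^+ 3.
Proof.
move=> /andP[r0 r1]; have s0 : 0 < 1 - rho by lra.
rewrite -[leRHS]expRK ler_ln ?posrE ?expR_gt0 //; last by rewrite divr_gt0 //; lra.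
rewrite ler_pdivrMr //; pose z := 2 * rho + 3 / 4 * rho ^+ 3; rewrite -/z.
have r3 : 0 <= rho ^+ 3 by rewrite exprn_ge0.
have z0 : 0 <= z by rewrite /z; lra.
have := expR_partial_le 4 z0.
rewrite !big_nat_recr //= big_geq // add0r expr0 expr1 !factS fact0 !muln1 !divr1.
move=> h.
have p4 : 0 <= rho ^+ 4 by rewrite exprn_ge0.
have p6 : 0 <= rho ^+ 6 by rewrite exprn_ge0.
have p5 : 0 <= rho ^+ 5 by rewrite exprn_ge0.
have p7 : 0 <= rho ^+ 7 by rewrite exprn_ge0.
have p9 : 0 <= rho ^+ 9 by rewrite exprn_ge0.
have z2 : 4 * rho ^+ 2 + 3 * rho ^+ 4 <= z ^+ 2.
  have -> : z ^+ 2 = 4 * rho ^+ 2 + 3 * rho ^+ 4 + 9 / 16 * rho ^+ 6 by rewrite /z; field.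
  lra.
have z3 : 8 * rho ^+ 3 <= z ^+ 3.
  have -> : z ^+ 3 = 8 * rho ^+ 3 + 9 * rho ^+ 5 + 27 / 8 * rho ^+ 7 + 27 / 64 * rho ^+ 9.
    by rewrite /z; field.
  lra.
have h2 : 1 + 2 * rho + 2 * rho ^+ 2 + 25 / 12 * rho ^+ 3 + 3 / 2 * rho ^+ 4 <= expR z.
  apply: le_trans h; rewrite {1}/z; lra.
apply: (@le_trans _ _ ((1 + 2 * rho + 2 * rho ^+ 2 + 25 / 12 * rho ^+ 3 + 3 / 2 * rho ^+ 4) * (1 - rho))); last first.
  by rewrite ler_pM2r.
have -> : (1 + 2 * rho + 2 * rho ^+ 2 + 25 / 12 * rho ^+ 3 + 3 / 2 * rho ^+ 4) * (1 - rho) =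
  1 + rho + rho ^+ 3 * (12^-1 - 7 / 12 * rho - 3 / 2 * rho ^+ 2).
  by field.
rewrite lerDl mulr_ge0 //.
have : rho ^+ 2 <= 10^-1 * rho by rewrite expr2 ler_wpM2r.
lra.
Qed.

(** The entropy equals ln 2 - ln(1 - rho^2) / 2 - (rho / 2) ln((1 + rho) / (1 - rho)); the two
    logarithmic bounds give the quartic coefficient 3/8 - 1/5 = 0.175. *)
Lemma entropy_ge rho : 0 <= rho <= 10^-1 ->
  ln 2 - rho ^+ 2 / 2 - 175 / 1000 * rho ^+ 4 <= entropy rho.
Proof.
move=> r01; have /andP[r0 r1] := r01.
have p1 : 0 < 1 + rho by lra.
have m1 : 0 < 1 - rho by lra.
rewrite /entropy !lnM ?posrE ?invr_gt0 // lnV ?posrE //.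
have y01 : 0 <= rho ^+ 2 <= 100^-1.
  by rewrite sqr_ge0 (_ : 100^-1 = 10^-1 ^+ 2 :> R) ?lerXn2r ?nnegrE //; field.
have h1 := ln1m_le y01.
rewrite (_ : 1 - rho ^+ 2 = (1 + rho) * (1 - rho)) in h1; last by ring.
rewrite lnM ?posrE // in h1.
have h2 := ln_ratio_le r01; rewrite lnM ?posrE ?invr_gt0 // lnV ?posrE // in h2.
have h3 : rho * (ln (1 + rho) - ln (1 - rho)) <= rho * (2 * rho + 3 / 4 * rho ^+ 3).
  by rewrite ler_wpM2l.
have e4 : (rho ^+ 2) ^+ 2 = rho ^+ 4 by rewrite -exprM.
rewrite e4 in h1.
have e3 : rho * (2 * rho + 3 / 4 * rho ^+ 3) = 2 * rho ^+ 2 + 3 / 4 * rho ^+ 4 by ring.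
rewrite e3 in h3; lra.
Qed.

(** Stirling's bound e b (b / e)^b, by induction from ln m <= ln(m + 1) - 1 / (m + 1). *)
Lemma fact_le (b : nat) : (0 < b)%N ->
  b`!%:R <= expR (b%:R * ln b%:R - b%:R + 1 + ln b%:R) :> R.
Proof.
elim: b => [//|[_ _|b IH _]]; first by rewrite ln1 mulr0 add0r addNr add0r expR0.
set m := b.+1 in IH *.
have m0 : 0 < m%:R :> R by rewrite ltr0n.
rewrite factS natrM.
have S0 : 0 < m.+1%:R :> R by rewrite ltr0n.
have lnS : ln m%:R <= ln m.+1%:R - m.+1%:R^-1 :> R.
  have -> : m%:R = m.+1%:R * (1 + - m.+1%:R^-1) :> R.
    by rewrite mulrDr mulr1 mulrN divff ?gt_eqF // -[m.+1]addn1 natrD addrK.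
  have i1 : m.+1%:R^-1 < 1 :> R by rewrite invf_lt1 // ltr1n.
  have q0 : 0 < 1 + - m.+1%:R^-1 :> R by rewrite subr_gt0.
  rewrite lnM ?posrE // lerD2l le_ln1Dx //.
  by move: i1; rewrite ltrN2.
have h : m.+1%:R * ln m%:R <= m.+1%:R * ln m.+1%:R - 1 :> R.
  have := ler_wpM2l (ltW S0) lnS.
  by rewrite mulrBr divff // gt_eqF.
apply: (le_trans (ler_wpM2l (ltW S0) (IH isT))).
rewrite -{1}[m.+1%:R]lnK ?posrE // -expRD ler_expR.
have E : m.+1%:R = m%:R + 1 :> R by rewrite -natr1.
by move: h; move: (ln m.+1%:R) (ln m%:R) => x y; rewrite E; lra.
Qed.
End RealLemmas.

(** * Asymptotics under the null law *)

Section Asymptotics.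
Variable R : realType.
Implicit Types (n b N : nat).

(* At t = 1, a = 0 and b = n / 2 the exponent of the left-hand side is
   ((e - ln (1 + e)) / 2 - 3/10 e^2) n, about - e^2 n / 20. *)
Lemma null_exponent (e a t : R) n b D : 0 < e <= (100^-1 / 2) ->
  0 <= a <= (e ^+ 2 / 100) * (e ^+ 2 / 100 / 10) -> (0 < n)%N ->
  (n%:R : R) <= 2 * b%:R -> 2 * b%:R <= (1 + 3 * a) * n%:R ->
  D%:R <= 2 * a * n%:R ->
  t = 1 - e ^+ 2 / 100 ->
  expR (- ((ln 2 + 3 / 10 * e ^+ 2) * n%:R)) * (2 ^+ n * (b`!%:R * (1 - t)^-1 ^+ D *
    (2 * t / ((1 + e) * n%:R)) ^+ b * expR ((1 + e) * n%:R / 2 / t))) <=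
  b%:R * expR (1 - 3 / 100 * e ^+ 2 * n%:R).
Proof.
move=> /andP[e0 e1] /andP[a0 a1] n0 xl xu Du tE.
have nR : 0 < n%:R :> R by rewrite ltr0n.
have bR : 0 < b%:R :> R by clear -nR xl; lra.
have b0 : (0 < b)%N by rewrite -(@ltr0n R).
have e2 : 0 < e ^+ 2 by rewrite exprn_gt0.
have e2e : e ^+ 2 <= (100^-1 / 2) * e by rewrite expr2 ler_wpM2r // ltW.
have e2s : e ^+ 2 <= (100^-1 / 10) by clear -e1 e2e; lra.
have e2h : e ^+ 2 / 100 <= 1 by clear -e2s; lra.
have e2k : 0 <= e ^+ 2 / 100 / 10 by clear -e2; lra.
have a2 : a <= e ^+ 2 / 100 / 10.
  by apply: (le_trans a1); exact: ler_piMl.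
have t0 : 0 < t by rewrite tE; clear -e2s; lra.
have t1 : t <= 1 by rewrite tE; clear -e2; lra.
have l0 : 0 < 1 + e by clear -e0; lra.
pose x := 2 * b%:R / n%:R : R.
have bx : b%:R = x * n%:R / 2 by rewrite /x; field; rewrite gt_eqF.
have x1 : 1 <= x by rewrite ler_pdivlMr // mul1r.
have xa : x <= 1 + 3 * a by rewrite ler_pdivrMr.
have x0 : 0 < x by clear -x1; lra.
have lnb : ln b%:R = ln x + ln n%:R - ln 2 :> R.
  by rewrite bx !lnM ?lnV ?posrE ?mulr_gt0 ?invr_gt0.
have h2 : 2 ^+ n = expR (n%:R * ln 2) :> R by rewrite expRM_natl lnK ?posrE.
(* The base 100 / e^2 is simply bounded by its exponential; to keep the exponent of order e^2 n, a
   has to be of order e^4. *)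
have h3 : (1 - t)^-1 ^+ D <= expR (2 * a * n%:R * (100 / e ^+ 2)).
  have -> : (1 - t)^-1 = 100 / e ^+ 2 by rewrite tE opprB addrC subrK invf_div.
  have c0 : 0 < 100 / e ^+ 2 by rewrite divr_gt0.
  apply: (@le_trans _ _ (expR (D%:R * (100 / e ^+ 2)))); last first.
    by rewrite ler_expR ler_wpM2r // ltW.
  rewrite expRM_natl lerXn2r ?nnegrE ?expR_ge0 ?(ltW c0) //.
  by apply: le_trans (expR_ge1Dx _); rewrite lerDr.
have h4 : (2 * t / ((1 + e) * n%:R)) ^+ b =
    expR (b%:R * (ln 2 + ln t - (ln (1 + e) + ln n%:R))).
  rewrite expRM_natl; congr (_ ^+ b).
  rewrite -!lnM ?posrE // -ln_div ?posrE ?mulr_gt0 // lnK // posrE.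
  by rewrite divr_gt0 // mulr_gt0.
have h5 := @fact_le R b b0.
have t2 : t ^+ 2 >= 0 by exact: sqr_ge0.
have h6 : (1 + e) * n%:R / 2 / t <= (1 + e + 11 / 100 / 10 * e ^+ 2) * n%:R / 2.
  rewrite ler_pdivrMr // [leLHS](_ : _ = (1 + e) * (n%:R / 2)); last by field.
  rewrite [leRHS](_ : _ = (1 + e + 11 / 100 / 10 * e ^+ 2) * t * (n%:R / 2)); last by field.
  apply: ler_wpM2r; first by clear -nR; lra.
  have : 0 <= e ^+ 2 * ((100^-1 / 10) - 100^-1 * (e + 11 / 100 / 10 * e ^+ 2)).
    by apply: mulr_ge0; [exact: ltW|clear -e1 e2s e0; lra].
  by rewrite tE; clear; lra.
(* From ln x <= x - 1 the left side is at most (x - 1)^2 - 1, so replacing x by 1 costs only a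
   second-order term in a. *)
have h7 : x * (ln x - 1) <= (3 * a) ^+ 2 - 1.
  have lx : ln x <= x - 1.
    have := @le_ln1Dx R (x - 1).
    by rewrite addrCA subrr addr0; apply; clear -x1; lra.
  have : x * (ln x - 1) <= x * (x - 2) by apply: ler_wpM2l; [exact: ltW|clear -lx; lra].
  have : (x - 1) ^+ 2 <= (3 * a) ^+ 2 by rewrite lerXn2r ?nnegrE //; clear -x1 xa a0; lra.
  clear; lra.
have h8 : - (x * ln (1 + e)) <= - (e - 51 / 100 * e ^+ 2).
  have l1 : e - 51 / 100 * e ^+ 2 <= ln (1 + e) by apply: ln1p_ge; clear -e0 e1; lra.
  have l2 : 0 <= ln (1 + e) by rewrite ln_ge0 //; clear -e0; lra.
  rewrite lerN2; apply: (le_trans l1); exact: ler_peMl.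
have h9 : x * ln t <= 0 by apply: mulr_ge0_le0; [exact: ltW|exact: ln_le0].
have h10 : 2 * a * n%:R * (100 / e ^+ 2) <= 2 / 100 / 10 * e ^+ 2 * n%:R.
  have -> : 2 * a * n%:R * (100 / e ^+ 2) = 2 * (a / (e ^+ 2 / 100)) * n%:R.
    by field; rewrite gt_eqF.
  have h : a / (e ^+ 2 / 100) <= e ^+ 2 / 100 / 10.
    by rewrite ler_pdivrMr ?divr_gt0 // mulrC.
  by apply: ler_wpM2r; [exact: ltW|clear -h; lra].
have h11 : (3 * a) ^+ 2 <= 1 / 100 / 10 * e ^+ 2.
  have h : a ^+ 2 <= (e ^+ 2 / 100 / 10) * (e ^+ 2 / 100 / 10) by rewrite expr2 ler_pM.
  have h' : e ^+ 2 * e ^+ 2 <= (100^-1 / 10) * e ^+ 2 by rewrite ler_wpM2r // ltW.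
  by rewrite exprMn; clear -h h' e2; lra.
rewrite h4 h2.
set E2 := expR (n%:R * ln 2); set E4 := expR (b%:R * _).
have -> : b%:R = expR (ln b%:R) :> R by rewrite lnK // posrE.
rewrite -expRD.
apply: (@le_trans _ _ (expR (- ((ln 2 + 3 / 10 * e ^+ 2) * n%:R)) * (E2 *
   (expR (b%:R * ln b%:R - b%:R + 1 + ln b%:R) * expR (2 * a * n%:R * (100 / e ^+ 2)) * E4 *
    expR ((1 + e) * n%:R / 2 / t))))).
  rewrite ler_wpM2l ?expR_ge0 // ler_wpM2l ?expR_ge0 // ler_wpM2r ?expR_ge0 //.
  rewrite ler_wpM2r ?expR_ge0 // ler_pM // exprn_ge0 // invr_ge0; clear -t1; lra.
rewrite /E2 /E4 -!expRD ler_expR lnb.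
move: (ln x) (ln t) (ln (1 + e)) (ln 2) (ln n%:R) h7 h8 h9 => lx lt le l2 ln h7 h8 h9.
pose M := x * (lx - 1) + x * lt - x * le.
have hM : M <= 511 / 100 / 10 * e ^+ 2 - 1 - e.
  by rewrite /M; clear -h7 h8 h9 h11; lra.
have hn : n%:R / 2 * M <= n%:R / 2 * (511 / 100 / 10 * e ^+ 2 - 1 - e).
  by apply: ler_wpM2l => //; clear -nR; lra.
have hb : b%:R * (lx + ln - l2) - b%:R + 1 + (lx + ln - l2) +
    b%:R * (l2 + lt - (le + ln)) = n%:R / 2 * M + 1 + (lx + ln - l2).
  by rewrite bx /M; field.
have hne : 0 <= n%:R * e ^+ 2 by apply: mulr_ge0; exact: ltW.
move: (b%:R * (lx + ln - l2)) (b%:R * (l2 + lt - (le + ln))) hb => u v hb.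
by clear -hb hn h10 h6 hne; lra.
Qed.

Lemma bernoulli (x : R) N : 0 <= x <= 1 -> 1 - N%:R * x <= (1 - x) ^+ N.
Proof.
move=> /andP[x0 x1]; elim: N => [|N IH]; first by rewrite mul0r subr0 expr0.
rewrite exprS; apply: (@le_trans _ _ ((1 - x) * (1 - N%:R * x))); last first.
  by apply: ler_wpM2l => //; rewrite subr_ge0.
have : 0 <= N%:R * (x * x) by rewrite mulr_ge0 // mulr_ge0.
rewrite -[N.+1]addn1 natrD; lra.
Qed.

(** From exp y >= y^2 / 2. Exponentially small errors are thereby all brought to the form D / n. *)
Lemma nat_expRN_le (k : R) n : 0 < k -> (0 < n)%N ->
  n%:R * expR (- (k * n%:R)) <= 2 / k ^+ 2 / n%:R.
Proof.
move=> k0 n0; have nR : 0 < n%:R :> R by rewrite ltr0n.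
have kn : 0 < k * n%:R by rewrite mulr_gt0.
rewrite expRN ler_pdivlMr // mulrC mulrA ler_pdivrMr ?expR_gt0 //.
have h : (k * n%:R) ^+ 2 / 2 <= expR (k * n%:R).
  apply: le_trans (expR_ge1Dxn 1 (ltW kn)).
  by rewrite (_ : 2`!%:R = 2 :> R) // lerDr.
apply: (@le_trans _ _ (2 / k ^+ 2 * ((k * n%:R) ^+ 2 / 2))); last first.
  by rewrite ler_wpM2l // divr_ge0 // sqr_ge0.
by rewrite (_ : 2 / k ^+ 2 * ((k * n%:R) ^+ 2 / 2) = n%:R * n%:R) //; field; rewrite gt_eqF.
Qed.

Lemma num_samplesP (a : R) n : 0 <= a < 1 ->
  let N := num_samples (1 - a)^-1 n in
  [/\ (N <= n)%N, (1 - a) * n%:R <= N%:R & N%:R <= (1 - a) * n%:R + 1].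
Proof.
move=> /andP[a0 a1] N; have x0 : 0 <= n%:R / (1 - a)^-1.
  by rewrite invrK mulr_ge0 // subr_ge0 ltW.
have c0 : 0 <= Num.ceil (n%:R / (1 - a)^-1).
  by rewrite ceil_ge0 (lt_le_trans _ x0) // ltrN10.
have NE : N%:R = (Num.ceil (n%:R / (1 - a)^-1))%:~R :> R.
  by rewrite /N /num_samples natr_absz ger0_norm.
have xE : n%:R / (1 - a)^-1 = (1 - a) * n%:R by rewrite invrK mulrC.
have h1 := ceil_ge (n%:R / (1 - a)^-1); have h2 := ceilB1_lt (n%:R / (1 - a)^-1).
rewrite rmorphB /= -NE xE in h2; rewrite -NE xE in h1.
split; [|exact: h1|by clear -h2; lra].
rewrite -lez_nat gez0_abs // ceil_le_int xE ler_piMl //.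
by clear -a0; lra.
Qed.

Lemma exists_large (x : R) : exists n0, forall n, (n0 <= n)%N -> x <= n%:R.
Proof.
exists (Num.truncn `|x|).+1 => n hn.
apply: (le_trans (ler_norm x)); apply: (@le_trans _ _ (Num.truncn `|x|).+1%:R).
  exact/ltW/truncnS_gt.
by rewrite ler_nat.
Qed.

(** The rank n - N is about a n, and this threshold makes the positive part of the exponent half of
    that. Rounding N up costs the factor exp 1. *)
Lemma low_rate_bound (a h : R) n N : h = (expR 2 - 1) / 2 -> 0 < a < 1 ->
  (N <= n)%N -> N%:R <= (1 - a) * n%:R + 1 ->
  low_rate (n%:R * (a / (2 * h))) (n - N) <= expR 1 * expR (- (a / 2 * n%:R)).
Proof.
move=> hE /andP[a0 a1] Nn NU; rewrite /low_rate -hE natrB // -expRD ler_expR.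
have h0 : 0 < h by rewrite hE divr_gt0 // subr_gt0 expR_gt1.
have -> : n%:R * (a / (2 * h)) * h = a / 2 * n%:R by field; rewrite gt_eqF.
by clear -NU; lra.
Qed.

Lemma null_asymp (e a : R) : 0 < e <= 100^-1 / 2 ->
  0 < a <= (e ^+ 2 / 100) * (e ^+ 2 / 100 / 10) ->
  exists (D : R) (n0 : nat), forall n, (n0 <= n)%N -> (0 < n)%N ->
  ((1 - D / n%:R)%:E <= wishart_null R n (num_samples (1 - a)^-1 n)
    [set Y | (ln (partition_function ((1 + e) *: gsseq 1%:M Y)) <=
      (ln 2 + 3 / 10 * e ^+ 2) * n%:R)%R])%E.
Proof.
move=> e01 /andP[a0 ae]; have /andP[e0 e1] := e01.
have e2 : 0 < e ^+ 2 by rewrite exprn_gt0.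
have a4 : a <= 4^-1.
  have e2e : e ^+ 2 <= (100^-1 / 2) * e by rewrite expr2 ler_wpM2r // ltW.
  have e2s : e ^+ 2 <= 1 by clear -e2e e1; lra.
  apply: (le_trans ae); apply: (@le_trans _ _ (4^-1 * 1)); last by rewrite mulr1.
  by apply: ler_pM; clear -e2 e2s; lra.
pose E1 : R := expR 1; have E10 : 0 < E1 := expR_gt0 1.
pose k : R := a ^+ 2 / 2; have k0 : 0 < k by rewrite /k divr_gt0 // exprn_gt0.
pose k' : R := 3 / 100 * e ^+ 2; have k'0 : 0 < k' by rewrite /k'; clear -e2; lra.
pose D1 := 2 * E1 * (2 / k ^+ 2); pose D2 := E1 * (2 / k' ^+ 2).
have [n1 Hn1] := exists_large (5 / a); have [n2 Hn2] := exists_large D1.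
have [n3 Hn3] := exists_large 10.
exists (D1 + D2), (maxn n1 (maxn n2 n3)) => n; rewrite !geq_max => /and3P[].
move=> /Hn1; rewrite ler_pdivrMr // => an5 /Hn2 nD1 /Hn3 n10 n0.
have nR : 0 < n%:R :> R by rewrite ltr0n.
have a01 : 0 <= a < 1 by rewrite ltW //=; clear -a4; lra.
have [Nn NL NU] := num_samplesP n a01.
set N := num_samples _ _ in Nn NL NU *.
(* With this b the norm bound at step j exceeds the mean n - j by at least 2 a n, so [tail_upper] at
   s = a / 2 decays like exp(- a^2 n / 2), whence k. The term 2 makes up for the two roundings. *)
pose b := (n %/ 2 + Num.truncn (a * n%:R) + 2)%N.
have [d1 d2] : (n%:R - 1 <= 2 * (n %/ 2)%N%:R :> R) /\ (2 * (n %/ 2)%N%:R <= n%:R :> R).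
  have hm : (n %% 2)%N%:R <= 1 :> R by rewrite (ler_nat R _ 1) -ltnS ltn_mod.
  have := divn_eq n 2 => /(congr1 (fun m => m%:R : R)); rewrite natrD natrM.
  have : 0 <= (n %% 2)%N%:R :> R by [].
  by move: hm; clear; lra.
have an0 : 0 <= a * n%:R by rewrite mulr_ge0 // ltW.
have t1 : (Num.truncn (a * n%:R))%:R <= a * n%:R :> R by rewrite truncn_le.
have t2 : a * n%:R - 1 <= (Num.truncn (a * n%:R))%:R :> R.
  by have := truncnS_gt (a * n%:R); rewrite -natr1; clear; lra.
have bE : b%:R = (n %/ 2)%N%:R + (Num.truncn (a * n%:R))%:R + 2 :> R by rewrite !natrD.
have bl : n%:R + 2 * a * n%:R <= 2 * b%:R by rewrite bE; clear -d1 t2; lra.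
have bu : 2 * b%:R <= (1 + 3 * a) * n%:R by rewrite bE; clear -d2 t1 an5; lra.
have bn : b%:R <= n%:R :> R.
  have : a * n%:R <= 4^-1 * n%:R by rewrite ler_wpM2r // ltW.
  by rewrite bE; clear -d2 t1 n10; lra.
have Nb : (N <= 2 * b)%N.
  by rewrite -(ler_nat R) natrM; clear -bl NU an5; lra.
have N2 : N%:R - 1 <= 2 * (N./2)%:R :> R.
  have := odd_double_half N => /(congr1 (fun m => m%:R : R)).
  rewrite natrD -mul2n natrM; have : (odd N)%:R <= 1 :> R by case: odd.
  by clear; lra.
have Du : (b - N./2)%:R <= 2 * a * n%:R.
  rewrite natrB; last by clear -Nb; lia.
  by rewrite bE; clear -d2 t1 N2 NL an5; lra.
pose h : R := (expR 2 - 1) / 2.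
have h0 : 0 < h by rewrite /h divr_gt0 // subr_gt0 expR_gt1.
pose c := n%:R * (a / (2 * h)).
have c0 : 0 < c by rewrite /c mulr_gt0 // divr_gt0 // mulr_gt0.
pose er := 2 * E1 * expR (- (k * n%:R)).
have er_le : n%:R * er <= D1 / n%:R.
  rewrite /er /D1 mulrCA -mulrA ler_wpM2l ?nat_expRN_le //.
  by rewrite mulr_ge0 // ltW.
have er0 : 0 <= er by rewrite /er mulr_ge0 ?expR_ge0 // mulr_ge0 // ltW.
have er1 : er <= 1.
  have : n%:R * er <= 1 by apply: (le_trans er_le); rewrite ler_pdivrMr // mul1r.
  have : 1 * er <= n%:R * er by rewrite ler_wpM2r // (ler_nat R 1).
  by rewrite mul1r => h1 h2; exact: le_trans h1 h2.
have s01 : 0 <= a / 2 <= 8^-1 by clear -a0 a4; lra.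
have t01 : 0 < 1 - e ^+ 2 / 100 < 1.
  have e2e : e ^+ 2 <= (100^-1 / 2) * e by rewrite expr2 ler_wpM2r // ltW.
  by clear -e2e e1 e2; lra.
have l0 : 0 < 1 + e by clear -e0; lra.
rewrite wishart_null_std; last first.
  by apply: measurable_bool_set; apply: measurable_fun_ler => //;
     exact: (measurableT_comp (@measurable_ln R) (measurable_partition (N := N) (1 + e))).
have er01 : 0 <= er <= 1 by rewrite er0.
have Her j : (j < N)%N -> low_rate c (n - N) +
   expR ((n - j)%:R * (a / 2 + 2 * (a / 2) ^+ 2) - a / 2 * (2 * (b - j./2)%:R)) <= er.
  move=> jN.
  have g1 : low_rate c (n - N) <= E1 * expR (- (a / 2 * n%:R)).
    apply: low_rate_bound => //; rewrite a0 /=; clear -a4; lra.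
  have g2 : expR (- (a / 2 * n%:R)) <= expR (- (k * n%:R)).
    rewrite ler_expR lerN2 ler_wpM2r // /k ler_wpM2r // expr2 ler_piMl ?(ltW a0) //.
    by clear -a4; lra.
  have jn : (j <= n)%N by clear -jN Nn; lia.
  have j2b : (j./2 <= b)%N by clear -Nb jN; lia.
  have j2 : 2 * (j./2)%:R <= j%:R :> R.
    have := odd_double_half j => /(congr1 (fun m => m%:R : R)).
    rewrite natrD -mul2n natrM; have : 0 <= (odd j)%:R :> R by [].
    by clear; lra.
  have g3 : expR ((n - j)%:R * (a / 2 + 2 * (a / 2) ^+ 2) - a / 2 * (2 * (b - j./2)%:R))
      <= expR (- (k * n%:R)).
    rewrite ler_expR !natrB //.
    have q1 : a / 2 * (n%:R + 2 * a * n%:R - j%:R) <= a / 2 * (2 * (b%:R - (j./2)%:R)).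
      by rewrite ler_wpM2l //; [clear -a0; lra|clear -bl j2; lra].
    have q2 : (n%:R - j%:R) * (2 * (a / 2) ^+ 2) <= n%:R * (2 * (a / 2) ^+ 2).
      by apply: ler_wpM2r; [rewrite mulr_ge0 ?sqr_ge0|rewrite lerBlDr lerDl].
    by rewrite /k; clear -q1 q2; lra.
  have g4 : expR (- (k * n%:R)) <= E1 * expR (- (k * n%:R)).
    by apply: ler_peMl; [exact: expR_ge0|rewrite /E1 -[leLHS]expR0 ler_expR].
  have g5 : E1 * expR (- (a / 2 * n%:R)) <= E1 * expR (- (k * n%:R)) by rewrite ler_pM2l.
  by rewrite /er; clear -g1 g3 g4 g5; lra.
have := null_partition_upper ((ln 2 + 3 / 10 * e ^+ 2) * n%:R)
  Nn Nb c0 t01 l0 n0 s01 er01 Her.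
apply: le_trans; rewrite lee_fin.
have xl : (n%:R : R) <= 2 * b%:R.
  by have := mulr_ge0 (ltW a0) (ltW nR); clear -bl; lra.
have a0e : 0 <= a <= (e ^+ 2 / 100) * (e ^+ 2 / 100 / 10) by rewrite ltW.
have ne := null_exponent e01 a0e n0 xl bu Du erefl.
have p1 : 1 - D1 / n%:R <= (1 - er) ^+ N.
  apply: le_trans (bernoulli N er01); rewrite lerD2l lerN2.
  by apply: le_trans er_le; rewrite ler_wpM2r // ler_nat.
have p2 : b%:R * expR (1 - 3 / 100 * e ^+ 2 * n%:R) <= D2 / n%:R.
  rewrite expRD -/E1 -/k' /D2 mulrCA -mulrA ler_wpM2l ?(ltW E10) //.
  apply: le_trans (nat_expRN_le k'0 n0).
  by rewrite ler_wpM2r ?expR_ge0.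
by rewrite mulrDl; clear -p1 p2 ne; lra.
Qed.

End Asymptotics.

(** * Asymptotics under the planted law *)

Section PlantedAsymptotics.
Variable R : realType.
Implicit Types (n N : nat).

Lemma planted_asymp (e a : R) : 0 < e <= 100^-1 / 2 -> 0 < a < 1 ->
  exists2 beta : R, -1 < beta < 0 &
  exists (D : R) (n0 : nat), forall n, (n0 <= n)%N -> (0 < n)%N ->
  ((1 - D / n%:R)%:E <= @wishart_planted R n (num_samples (1 - a)^-1 n) beta
    [set Y | ((ln 2 + 34 / 100 * e ^+ 2) * n%:R <=
      ln (partition_function ((1 + e) *: gsseq 1%:M Y)))%R])%E.
Proof.
move=> /andP[e0 e1] /andP[a0 a1].
have e2 : 0 < e ^+ 2 by rewrite exprn_gt0.
pose h : R := (expR 2 - 1) / 2.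
have h0 : 0 < h by rewrite /h divr_gt0 // subr_gt0 expR_gt1.
pose c0 := a / (2 * h); have c00 : 0 < c0 by rewrite /c0 divr_gt0 // mulr_gt0.
(* The power a' below is about n c0 / 8, so kap ^ a' is about exp(- 2 n), which beats sqrt 2 ^ N <=
   exp n. *)
pose kap := expR (- (16 / c0)); have kap0 : 0 < kap := expR_gt0 _.
have kap1 : kap < 1 by rewrite /kap expR_lt1 oppr_lt0 divr_gt0.
(* Chosen so that (1 + beta) / kap = e / 100, the relative loss allowed in x K x^T. *)
pose beta := -1 + kap * (e / 100).
have b0 : 0 < kap * (e / 100) by rewrite mulr_gt0 // divr_gt0.
have b1 : kap * (e / 100) < 1.
  apply: (@lt_le_trans _ _ (1 * (e / 100))); last by clear -e1; lra.
  by rewrite ltr_pM2r // divr_gt0.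
exists beta; first by rewrite /beta; clear -b0 b1; lra.
pose E1 : R := expR 1 + 2; have E10 : 0 < E1 by rewrite addr_gt0 ?expR_gt0.
pose k := Num.min (a / 2) (c0 / 8).
have k0 : 0 < k by rewrite lt_min (divr_gt0 a0) ?(divr_gt0 c00).
pose D1 := E1 * (2 / k ^+ 2); pose D2 : R := expR (16 / c0).
have [n1 Hn1] := exists_large D1.
exists (D1 + D2), n1 => n Hn n0; have nD1 := Hn1 n Hn.
have nR : 0 < n%:R :> R by rewrite ltr0n.
have a01 : 0 <= a < 1 by rewrite ltW.
have [Nn NL NU] := num_samplesP n a01.
set N := num_samples _ _ in Nn NL NU *.
pose c := n%:R * c0; have cp : 0 < c by rewrite mulr_gt0.
pose er := E1 * expR (- (k * n%:R)).
have er_le : n%:R * er <= D1 / n%:R.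
  by rewrite /er /D1 mulrCA -mulrA ler_wpM2l ?nat_expRN_le // ltW.
have er0 : 0 <= er by rewrite /er mulr_ge0 ?expR_ge0 // ltW.
have er1 : er <= 1.
  have : n%:R * er <= 1 by apply: (le_trans er_le); rewrite ler_pdivrMr // mul1r.
  have : 1 * er <= n%:R * er by rewrite ler_wpM2r // (ler_nat R 1).
  by rewrite mul1r => h1 h2; exact: le_trans h1 h2.
have er01 : 0 <= er <= 1 by rewrite er0.
have s2 : Num.sqrt 2 <= 2 :> R.
  by rewrite -(@ler_pXn2r _ 2) ?nnegrE ?sqrtr_ge0 // sqr_sqrtr // expr2; clear; lra.
have Her : low_rate c (n - N) + Num.sqrt 2 * expR (- c / 8) <= er.
  rewrite /er /E1 mulrDl; apply: lerD.
    apply: le_trans (low_rate_bound _ _ Nn NU) _ => //; first by rewrite a0.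
    rewrite ler_pM2l ?expR_gt0 // ler_expR lerN2 ler_wpM2r // ?(ltW nR) //.
    by rewrite ge_min lexx.
  apply: ler_pM => //; rewrite ?sqrtr_ge0 ?expR_ge0 // ler_expR mulNr lerN2.
  rewrite /c (_ : n%:R * c0 / 8 = c0 / 8 * n%:R); last by clear; ring.
  by apply: ler_wpM2r; [exact: ltW|rewrite ge_min lexx orbT].
pose a' := Num.truncn (c / 8).
have a'l : 8 * a'%:R <= c.
  have : a'%:R <= c / 8 by rewrite truncn_le // divr_ge0 // ltW.
  by clear; lra.
have a'u : c / 8 - 1 <= a'%:R.
  by have := truncnS_gt (c / 8); rewrite -/a' -[a'.+1]addn1 natrD; clear; lra.
(* Close to the maximum of e rho^2 / 2 - 0.175 rho^4, which lies at rho^2 = e / 0.7. *)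
pose rho := Num.sqrt (3 / 2 * e).
have r2 : rho ^+ 2 = 3 / 2 * e by rewrite sqr_sqrtr //; clear -e0; lra.
have r0 : 0 <= rho := sqrtr_ge0 _.
have r1 : rho <= 10^-1.
  rewrite -(@ler_pXn2r _ 2) ?nnegrE // r2.
  by rewrite expr2; clear -e1; lra.
have bm1 : -1 <= beta by rewrite /beta; clear -b0; lra.
have l0 : 0 <= 1 + e by clear -e0; lra.
have r11 : -1 < rho < 1 by clear -r0 r1; lra.
have HU : (ln 2 + 34 / 100 * e ^+ 2) * n%:R <= n%:R * entropy rho +
    (1 + e) / 2 * rho ^+ 2 * (n%:R - (1 + beta) * n%:R / kap).
  have -> : (1 + beta) * n%:R / kap = e / 100 * n%:R.
    by rewrite /beta; field; rewrite gt_eqF.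
  have r01 : 0 <= rho <= 10^-1 by rewrite r0.
  have := entropy_ge r01.
  rewrite (_ : rho ^+ 4 = (rho ^+ 2) ^+ 2) ?r2 => [En|]; last by rewrite -r2 -exprM.
  have e3 : e * e ^+ 2 <= (100^-1 / 2) * e ^+ 2 by rewrite ler_wpM2r // ltW.
  have En2 : ln 2 + 34 / 100 * e ^+ 2 <= entropy rho +
      (1 + e) / 2 * (3 / 2 * e) * (1 - e / 100).
    by clear -En e3 e2; lra.
  have := ler_wpM2r (ltW nR) En2; clear; lra.
have := planted_partition_lower Nn n0 cp a'l kap0 er01 Her bm1 l0 r11 HU.
apply: le_trans; rewrite lee_fin.
have p1 : 1 - D1 / n%:R <= (1 - er) ^+ N.
  apply: le_trans (bernoulli N er01); rewrite lerD2l lerN2.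
  by apply: le_trans er_le; rewrite ler_wpM2r // ler_nat.
have p2 : kap ^+ a' * Num.sqrt 2 ^+ N <= D2 / n%:R.
  have s2e : Num.sqrt 2 <= expR 1 :> R.
    by apply: (le_trans s2); have := @expR_ge1Dx R 1; clear; lra.
  have q1 : Num.sqrt 2 ^+ N <= expR n%:R :> R.
    apply: (@le_trans _ _ (expR 1 ^+ N)).
      by rewrite lerXn2r ?nnegrE ?sqrtr_ge0 ?expR_ge0.
    by rewrite -expRM_natl mulr1 ler_expR ler_nat.
  have q2 : kap ^+ a' <= expR (16 / c0 - 2 * n%:R).
    rewrite /kap -expRM_natl ler_expR.
    have -> : 16 / c0 - 2 * n%:R = (c / 8 - 1) * - (16 / c0).
      by rewrite /c; field; rewrite gt_eqF.
    by apply: ler_wnM2r => //; rewrite oppr_le0 divr_ge0 // ltW.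
  have q3 : n%:R <= expR n%:R :> R.
    by have := @expR_ge1Dx R n%:R; clear; lra.
  apply: (@le_trans _ _ (expR (16 / c0 - 2 * n%:R) * expR n%:R)).
    by apply: ler_pM => //; rewrite exprn_ge0 ?sqrtr_ge0 ?expR_ge0 ?(ltW kap0).
  rewrite -expRD (_ : 16 / c0 - 2 * n%:R + n%:R = 16 / c0 - n%:R); last by clear; ring.
  rewrite expRD expRN -/D2 ler_wpM2l ?expR_ge0 // lef_pV2 ?posrE ?expR_gt0 //.
by rewrite mulrDl; clear -p1 p2; lra.
Qed.

End PlantedAsymptotics.

(** * Convergence and choice of the constants *)

Lemma squeeze_one (R : realType) (eta : nat -> R) (D : R) (n0 : nat) (u : nat -> \bar R) :
  eta @ \oo --> 0 -> (forall n, (u n <= 1)%E) ->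
  (forall n, (n0 <= n)%N -> (0 < n)%N -> eta n <= 1 -> 0 <= 1 - D / n%:R ->
     ((1 - eta n)%:E * (1 - D / n%:R)%:E <= u n)%E) ->
  u @ \oo --> 1%E.
Proof.
move=> eta0 u1 Hu.
have Dn : (fun n => D / n%:R) @ \oo --> (0 : R).
  have : (fun n => D * harmonic n) @ \oo --> D * 0.
    by apply: cvgMl_tmp; exact: cvg_harmonic.
  by rewrite mulr0 => h; rewrite -cvg_shiftS; exact: h.
have low : (fun n => (1 - eta n) * (1 - D / n%:R)) @ \oo --> (1 : R).
  have : (fun n => (1 - eta n) * (1 - D / n%:R)) @ \oo --> (1 - 0) * (1 - 0 : R).
    by apply: cvgM; apply: cvgB => //; exact: cvg_cst.
  by rewrite !subr0 mulr1.
apply: (@squeeze_cvge _ _ _ _ (fun n => ((1 - eta n) * (1 - D / n%:R))%:E) u (fun=> 1%E)).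
- near=> n; rewrite u1 andbT EFinM; apply: Hu.
  + by near: n; exact: nbhs_infty_ge.
  + by near: n; exact: nbhs_infty_gt.
  + by near: n; exact: (cvgr_le _ eta0 _ ltr01).
  + by rewrite subr_ge0; near: n; exact: (cvgr_le _ Dn _ ltr01).
- by apply: cvg_EFin => //; near=> n.
- exact: cvg_cst.
Unshelve. all: by end_near. Qed.

Theorem theorem1p7 (R : realType) (eps : R) : 0 < eps ->
  exists2 delta : R, 0 < delta &
    (exists (approx : cmd) (k : nat),
       polytime_approximator R approx k /\
       exists2 eta : nat -> R, eta @ \oo --> 0 &
         forall (n : nat) (J : 'M[R]_n), J^T = J ->
           lambda_max J - lambda_min J <= 1 + eps ->
           ((1 - eta n)%:E <=
            approx_law approx k J
              [set F : R | (`|ln (partition_function J) - F| < delta * n%:R)%R])%E) ->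
    exists beta gamma : R,
      [/\ -1 < beta, 0 < gamma, beta ^+ 2 < gamma &
      exists (f : cmd) (k : nat),
        [/\ polytime_test gamma f k,
            (fun n : nat =>
               test_prob f k (@wishart_planted R n (num_samples gamma n) beta)
                 verdict_p) @ \oo --> 1%E &
            (fun n : nat =>
               test_prob f k (wishart_null R n (num_samples gamma n))
                 verdict_q) @ \oo --> 1%E]].
Proof.
move=> eps0.
(* Program constants are rational, so q comes first and e is defined from it. The cap 1/200 keeps e
   in the range of the explicit bounds. *)
have [q qE] : exists q : rat, ratr q \in `]1, 1 + Num.min eps (100^-1 / 2)[.
  by apply: rat_in_itvoo; rewrite ltrDl lt_min eps0 divr_gt0.
pose e : R := ratr q - 1.
have {qE} [e0 eeps e1] : [/\ 0 < e, e <= eps & e <= 100^-1 / 2].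
  move: qE; rewrite in_itv /= -ltrBlDl -/e -subr_gt0 -/e => /andP[-> /ltW].
  by rewrite le_min => /andP[].
have q1 : ratr q = 1 + e by rewrite /e addrC subrK.
have e01 : 0 < e <= 100^-1 / 2 by rewrite e0.
have e2 : 0 < e ^+ 2 by rewrite exprn_gt0.
exists (e ^+ 2 / 100); first by rewrite divr_gt0.
move=> [approx [k [Ha [eta eta0 Happ]]]].
(* The first factor is 1 - t in the null exponent; the quotient e^2 / 1000 bounds the cost of the
   power of 1 / (1 - t). *)
pose a := (e ^+ 2 / 100) * (e ^+ 2 / 100 / 10).
have a0 : 0 < a by rewrite /a !(mulr_gt0, divr_gt0).
have a1 : a < 1.
  have e2e : e ^+ 2 <= (100^-1 / 2) * e by rewrite expr2 ler_wpM2r // ltW.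
  have e2s : e ^+ 2 / 100 <= 1 by clear -e2e e1; lra.
  have : a <= e ^+ 2 / 100 / 10 by apply: ler_piMl => //; clear -e2; lra.
  by clear -e2s; lra.
have a01 : 0 < a < 1 by rewrite a0.
have aw01 : 0 <= a < 1 by rewrite ltW.
have aE : 0 < a <= (e ^+ 2 / 100) * (e ^+ 2 / 100 / 10) by rewrite a0 /=.
have [beta /andP[b1 b0] [Dp [np Hp]]] := planted_asymp e01 a01.
have [Dq [nq Hq]] := null_asymp e01 aE.
pose gamma := (1 - a)^-1.
have a'0 : 0 < 1 - a by rewrite subr_gt0.
(* The two exponents are separated by 0.30 and 0.34 times e^2; an error of 0.01 on either side
   leaves this window for a rational threshold. *)
have [q' q'E] : exists q' : rat, (ratr q' : R) \in
    `](ln 2 + 31 / 100 * e ^+ 2), (ln 2 + 33 / 100 * e ^+ 2)[.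
  by apply: rat_in_itvoo; clear -e2; lra.
move: q'E; rewrite in_itv /= => /andP[q'l q'u].
have Nn n : (num_samples gamma n <= n)%N by have [] := num_samplesP n aw01.
exists beta, gamma; split => //.
- by rewrite invr_gt0.
- apply: (@lt_le_trans _ _ 1); last by rewrite invf_ge1 // gerBl ltW.
  have : 0 < (1 + beta) * (1 - beta) by apply: mulr_gt0; clear -b0 b1; lra.
  by clear; lra.
have Hgood n (Y : sample R n (num_samples gamma n)) : ((1 - eta n)%:E <=
    approx_law approx k (ratr q *: gsseq 1%:M Y)
      [set F : R | (`|ln (partition_function (ratr q *: gsseq 1%:M Y)) - F|
         < e ^+ 2 / 100 * n%:R)%R])%E.
  have pK : proj (gsseq 1%:M Y) by apply: gsseq_proj; exact: proj1.
  apply: Happ; first by rewrite linearZ /= pK.1.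
  rewrite q1; apply: le_trans (spectral_width pK _) _; last by rewrite lerD2l.
  by rewrite addr_ge0 // ltW.
have mlnZ n : measurable_fun setT (fun Y : sample R n (num_samples gamma n) =>
    ln (partition_function ((1 + e) *: gsseq 1%:M Y))).
  by apply: (measurableT_comp (@measurable_ln R)
    (measurable_partition (N := num_samples gamma n) (1 + e))).
exists (test_prog (maxn 2 (cmd_bound approx)) approx q q'), (k + 1000)%N; split.
- exact: test_polytime.
- apply: (squeeze_one (D := Dp) (n0 := np) eta0); first by move=> n; exact: test_prob_le1.
  move=> n nn n0 en1 _.
  have nR : 0 < n%:R :> R by rewrite ltr0n.
  apply: le_trans (lee_wpmul2l _ (Hp n nn n0)) _; first by rewrite lee_fin subr_ge0.
  pose G := [set Y : sample R n (num_samples gamma n) |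
    (ln 2 + 34 / 100 * e ^+ 2) * n%:R <=
    ln (partition_function ((1 + e) *: gsseq 1%:M Y))].
  have mG : measurable G.
    by apply: measurable_bool_set; apply: measurable_fun_ler => //; exact: mlnZ.
  apply: (test_prob_ge (@wishart_planted R n (num_samples gamma n) beta) (G := G)
    (v := verdict_p) (Nn n) Ha mG en1 (fun Y _ => Hgood n Y) _).
  move=> Y F; rewrite /G /= => YG; rewrite q1 ltr_norml => /andP[h1 h2]; rewrite ifT //.
  have : ratr q' * n%:R < (ln 2 + 33 / 100 * e ^+ 2) * n%:R by rewrite ltr_pM2r.
  by clear -h2 YG; lra.
- apply: (squeeze_one (D := Dq) (n0 := nq) eta0); first by move=> n; exact: test_prob_le1.
  move=> n nn n0 en1 _.
  have nR : 0 < n%:R :> R by rewrite ltr0n.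
  apply: le_trans (lee_wpmul2l _ (Hq n nn n0)) _; first by rewrite lee_fin subr_ge0.
  pose G := [set Y : sample R n (num_samples gamma n) |
    ln (partition_function ((1 + e) *: gsseq 1%:M Y)) <=
    (ln 2 + 3 / 10 * e ^+ 2) * n%:R].
  have mG : measurable G.
    by apply: measurable_bool_set; apply: measurable_fun_ler => //; exact: mlnZ.
  apply: (test_prob_ge (wishart_null R n (num_samples gamma n)) (G := G)
    (v := verdict_q) (Nn n) Ha mG en1 (fun Y _ => Hgood n Y) _).
  move=> Y F; rewrite /G /= => YG; rewrite q1 ltr_norml => /andP[h1 h2]; rewrite ifF //.
  have h3 : (ln 2 + 31 / 100 * e ^+ 2) * n%:R < ratr q' * n%:R by rewrite ltr_pM2r.
  apply/negbTE; rewrite -leNgt; clear -h1 h3 YG; lra.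
Qed.
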